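(* Let $\Omega,\Lambda,\gamma$ be positive real parameters with $\gamma\neq1$, and assume $Q\neq0$ and that $k_t,k_p$ have positive imaginary part. Let $r=|x|$. (a) In $\mathbb{R}^2$, there is a unique pair $(G_T,G_P)$ in the linear span of $$\begin{bmatrix}H_0^{(1)}(k_pr)\\ m_pH_0^{(1)}(k_pr)\end{bmatrix},\quad \begin{bmatrix}H_0^{(1)}(k_tr)\\ m_tH_0^{(1)}(k_tr)\end{bmatrix}$$ that satisfies, in the weak (distributional) sense on $\mathbb{R}^2$, the system $$\Omega\nabla^2T+iT-i\frac{\gamma-1}{\gamma}P=\delta,$$ $$(1-i\gamma\Lambda)\nabla^2P+\left[\gamma\left(1-\frac{\Lambda}{\Omega}\right)+\frac{\Lambda}{\Omega}\right]P-\gamma\left(1-\frac{\Lambda}{\Omega}\right)T=-i\gamma\frac{\Lambda}{\Omega}\delta$$ with $(T,P)=(G_T,G_P)$. It is given by $G_T=b_1H_0^{(1)}(k_pr)+b_2H_0^{(1)}(k_tr)$ and $G_P=b_1m_pH_0^{(1)}(k_pr)+b_2m_tH_0^{(1)}(k_tr)$, where $$b_1=\frac{\gamma-1}{4\gamma\Omega Q}\left[im_t+(m_t-1)\gamma\Lambda\right],\qquad b_2=-\frac{\gamma-1}{4\gamma\Omega Q}\left[im_p+(m_p-1)\gamma\Lambda\right].$$ (b) In $\mathbb{R}^3$, there is a unique pair $(G_T,G_P)$ in the linear span of $$\begin{bmatrix}h_0^{(1)}(k_pr)\\ m_ph_0^{(1)}(k_pr)\end{bmatrix},\quad \begin{bmatrix}h_0^{(1)}(k_tr)\\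 m_th_0^{(1)}(k_tr)\end{bmatrix}$$ that satisfies the same system in the weak (distributional) sense on $\mathbb{R}^3$. It is given by $G_T=c_1h_0^{(1)}(k_pr)+c_2h_0^{(1)}(k_tr)$ and $G_P=c_1m_ph_0^{(1)}(k_pr)+c_2m_th_0^{(1)}(k_tr)$, where $$c_1=\frac{k_p(\gamma-1)}{4\pi\gamma\Omega Q}\left[im_t+(m_t-1)\gamma\Lambda\right],\qquad c_2=-\frac{k_t(\gamma-1)}{4\pi\gamma\Omega Q}\left[im_p+(m_p-1)\gamma\Lambda\right].$$
   Context: $Q$ is a complex constant with $Q^2=4(i\Omega+\gamma\Omega\Lambda)+(1-i\gamma\Omega-i\Lambda)^2$. The wave numbers $k_t,k_p\in\mathbb{C}$ satisfy $$k_t^2=\frac{i}{2\Omega}\,\frac{1-i\gamma\Omega-i\Lambda+Q}{1-i\gamma\Lambda},\qquad k_p^2=\frac{i}{2\Omega}\,\frac{1-i\gamma\Omega-i\Lambda-Q}{1-i\gamma\Lambda},$$ and $m_t=\frac{\gamma}{\gamma-1}(1+i\Omega k_t^2)$, $m_p=\frac{\gamma}{\gamma-1}(1+i\Omega k_p^2)$. $H_0^{(1)}$ is the Hankel function of the first kind of order zero, $h_0^{(1)}(z)=\frac{-i}{z}e^{iz}$ is the spherical Hankel function of the first kind of order zero, and $\delta$ is the Dirac delta at the origin. The pair $(G_T,G_P)$ is the free-space Green's function of the Morse-Ingard equations; the spans above are the subspaces of the radially symmetric solutions of the homogeneous system away from the origin selected by boundedness at infinity. *)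

(* Defs.v *)
From HB Require Import structures.
From mathcomp Require Import all_boot all_order all_algebra.
From mathcomp Require Import complex.
From mathcomp Require Import all_classical all_reals all_analysis.
Set Implicit Arguments.
Unset Strict Implicit.
Unset Printing Implicit Defensive.
Import Order.TTheory GRing.Theory Num.Theory.
Import numFieldNormedType.Exports.
Local Open Scope classical_set_scope.
Local Open Scope ring_scope.
Local Open Scope complex_scope.

Section special_functions.
Variable R : realType.
Implicit Types z : R[i].

(* R[i] carries no topology in the library, so complex series are summed
   componentwise. *)
Definition csum (a : nat -> R[i]) : R[i] :=
  limn (series (fun k => complex.Re (a k))) +i*
  limn (series (fun k => complex.Im (a k))).

Definition cexp z : R[i] :=
  (expR (complex.Re z))%:C * (cos (complex.Im z) +i* sin (complex.Im z)).

Definition cmod z : R := Num.sqrt (complex.Re z ^+ 2 + complex.Im z ^+ 2).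

(* Principal argument, in ]-pi, pi] for z != 0. *)
Definition carg z : R :=
  if 0 <= complex.Im z then acos (complex.Re z / cmod z)
  else - acos (complex.Re z / cmod z).

Definition clog z : R[i] := ln (cmod z) +i* carg z.

(* The n-th harmonic number 1 + 1/2 + ... + 1/n; the library's sequence
   [harmonic] is k |-> 1/(k+1). *)
Definition harmonic_number (n : nat) : R := series harmonic n.

Definition euler_gamma : R := limn (fun n : nat => harmonic_number n - ln n%:R).

Definition besselJ0 z : R[i] :=
  csum (fun k => (-1) ^+ k * (z / 2) ^+ (2 * k) / ((k`!)%:R ^+ 2)).

(* Bessel function of the second kind: its ascending series
   Y_0(z) = (2/pi) (log(z/2) + gamma_E) J_0(z)
            - (2/pi) \sum_k (-1)^k H_k (z/2)^(2k) / (k!)^2,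
   with the principal branch of the logarithm. *)
Definition besselY0 z : R[i] :=
  (2 / pi)%:C * (clog (z / 2) + euler_gamma%:C) * besselJ0 z
  - (2 / pi)%:C *
    csum (fun k => (-1) ^+ k * (harmonic_number k)%:C * (z / 2) ^+ (2 * k)
                   / ((k`!)%:R ^+ 2)).

Definition hankelH0 z : R[i] := besselJ0 z + 'i%C * besselY0 z.

Definition sph_hankelh0 z : R[i] := - 'i%C / z * cexp ('i%C * z).

End special_functions.

(* Distributions on a space E with a fixed basis [:: e_1; ...; e_n]. *)
Section distributions.
Variables (R : realType) (E : normedModType R) (basis : seq E).
Implicit Types (f : E -> R) (phi : E -> R[i]).

Definition iter_partial (vs : seq E) f : E -> R :=
  foldr (fun v g => fun x => 'D_v g x) f vs.

Definition smooth f : Prop :=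
  forall vs : seq E, all (mem basis) vs ->
    continuous (iter_partial vs f) /\
    forall v x, v \in basis -> derivable (iter_partial vs f) x v.

Definition test_function phi : Prop :=
  [/\ smooth (fun x => complex.Re (phi x)),
      smooth (fun x => complex.Im (phi x)) &
      compact (closure [set x | phi x != 0])].

Definition real_laplacian f (x : E) : R :=
  \sum_(v <- basis) iter_partial [:: v; v] f x.

Definition laplacian phi (x : E) : R[i] :=
  real_laplacian (fun y => complex.Re (phi y)) x +i*
  real_laplacian (fun y => complex.Im (phi y)) x.

Definition distr := (E -> R[i]) -> R[i].

Definition distr_laplacian (u : distr) : distr := fun phi => u (laplacian phi).

Definition dirac0 : distr := fun phi => phi 0.

Definition distr_eq (u v : distr) : Prop :=
  forall phi, test_function phi -> u phi = v phi.

Definition morse_ingard (Omega Lambda gamma : R) (T P : distr) : Prop :=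
  distr_eq
    (fun phi => Omega%:C * distr_laplacian T phi + 'i%C * T phi
                - 'i%C * ((gamma - 1) / gamma)%:C * P phi)
    dirac0
  /\
  distr_eq
    (fun phi =>
       (1 - 'i%C * (gamma * Lambda)%:C) * distr_laplacian P phi
       + (gamma * (1 - Lambda / Omega) + Lambda / Omega)%:C * P phi
       - (gamma * (1 - Lambda / Omega))%:C * T phi)
    (fun phi => - 'i%C * (gamma * (Lambda / Omega))%:C * dirac0 phi).

End distributions.

Section regular_distributions.
Variables (R : realType) (d : measure_display) (X : measurableType d).
Variable mu : {measure set X -> \bar R}.

(* The distribution phi |-> \int u phi defined by a function u. *)
Definition regular_distr (u phi : X -> R[i]) : R[i] :=
  (\int[mu]_x complex.Re (u x * phi x)) +i*
  (\int[mu]_x complex.Im (u x * phi x)).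

(* Same definition as the library's [locally_integrable], which is restricted
   to functions on the real line. The predicate [is_compact] stands for
   compactness in X, whose topology is not part of its measurableType
   structure. *)
Definition locally_integrable_for (is_compact : set X -> Prop) (u : X -> R[i])
    : Prop :=
  let li (f : X -> R) :=
    measurable_fun setT f /\
    forall K, is_compact K -> (\int[mu]_(x in K) `|f x|%:E < +oo)%E in
  li (fun x => complex.Re (u x)) /\ li (fun x => complex.Im (u x)).

End regular_distributions.

Section spaces.
Variable R : realType.

Definition basis2 : seq (R * R) := [:: (1, 0); (0, 1)].
Definition basis3 : seq (R * R * R) := [:: (1, 0, 0); (0, 1, 0); (0, 0, 1)].

(* The Euclidean norm |x|; the library's norm on products is the max norm. *)
Definition radius2 (x : R * R) : R := Num.sqrt (x.1 ^+ 2 + x.2 ^+ 2).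
Definition radius3 (x : R * R * R) : R :=
  Num.sqrt (x.1.1 ^+ 2 + x.1.2 ^+ 2 + x.2 ^+ 2).

(* [measurableTypeR R] is R with its Borel sigma-algebra. *)
Definition leb2 :
    {measure set (measurableTypeR R * measurableTypeR R) -> \bar R} :=
  (@lebesgue_measure R \x @lebesgue_measure R)%E.
Definition leb3 :
    {measure set (measurableTypeR R * measurableTypeR R * measurableTypeR R)
       -> \bar R} :=
  ((@lebesgue_measure R \x @lebesgue_measure R)%E \x @lebesgue_measure R)%E.

Definition weak_solution2 (Omega Lambda gamma : R) (T P : R * R -> R[i])
    : Prop :=
  [/\ locally_integrable_for leb2 (@compact (R * R)%type) T,
      locally_integrable_for leb2 (@compact (R * R)%type) P &
      morse_ingard basis2 Omega Lambda gamma
        (regular_distr leb2 T) (regular_distr leb2 P)].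

Definition weak_solution3 (Omega Lambda gamma : R) (T P : R * R * R -> R[i])
    : Prop :=
  [/\ locally_integrable_for leb3 (@compact (R * R * R)%type) T,
      locally_integrable_for leb3 (@compact (R * R * R)%type) P &
      morse_ingard basis3 Omega Lambda gamma
        (regular_distr leb3 T) (regular_distr leb3 P)].

End spaces.

(* Functions singular at the origin are total functions on the whole space; as
   their value at the origin is immaterial, functions are compared only away
   from it. *)
Section pairs.
Variables (R : realType) (E : zmodType).
Implicit Types (T P : E -> R[i]).

Definition pair_eq T P T' P' : Prop :=
  forall x, x != 0 -> T x = T' x /\ P x = P' x.

Definition in_span (U1 V1 U2 V2 T P : E -> R[i]) : Prop :=
  exists a b : R[i],
    pair_eq T P (fun x => a * U1 x + b * U2 x) (fun x => a * V1 x + b * V2 x).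

Definition is_unique_pair (S : (E -> R[i]) -> (E -> R[i]) -> Prop) T P : Prop :=
  S T P /\ forall T' P', S T' P' -> pair_eq T' P' T P.

End pairs.

(* Main.v *)
Require Import Defs.
From HB Require Import structures.
From mathcomp Require Import all_boot all_order all_algebra.
From mathcomp Require Import complex.
From mathcomp Require Import all_classical all_reals all_analysis.
From mathcomp Require Import measurable_realfun.
From mathcomp Require Import ring lra.
Set Implicit Arguments.
Unset Strict Implicit.
Unset Printing Implicit Defensive.
Import Order.TTheory GRing.Theory Num.Theory.
Import numFieldNormedType.Exports.
Local Open Scope classical_set_scope.
Local Open Scope ring_scope.
Local Open Scope complex_scope.

(** In the sense of distributions [Delta u = - k^2 u + c delta], with [c = 4 i]
    for [u = H_0^(1)(k r)] in the plane and [c = 4 pi i / k] for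
    [u = h_0^(1)(k r)] in space. Since [k_p^2] and [k_t^2] are the two roots of
    the dispersion relation and [m_p], [m_t] the matching amplitude ratios, both
    vectors solve the homogeneous system; on their span the weak system reduces,
    after testing against a [phi] with [phi 0 != 0], to two linear equations for
    the coefficients of [delta], whose determinant is a nonzero multiple of
    [m_t - m_p = - gamma Q / ((gamma - 1) (1 - i gamma Lambda))].

    The Helmholtz identities come from Green's formula on a box, applied after
    replacing [r] by [sqrt (r^2 + e^2)]. The Laplacian of the regularized
    singularity contains an explicit approximate identity, whose mass over the
    box is an arctangent. In the plane [H_0^(1)(k r) = f(r^2) log (r^2) + g(r^2)]
    with [f], [g] entire, so that the Bessel equation is a recurrence for power
    series coefficients; in space [h_0^(1)(k r) = f(r) / r] with [f] smooth. *)

(** * Integration over boxes *)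

(** On a box, one-variable calculus and Fubini suffice: a test function supported well inside
    vanishes with its derivatives on every face, so no boundary term survives. The obstacle is the
    origin, where [ln (r^2)] and [1/r] are not differentiable; with [r^2 + e^2] inside the logarithm
    or the root every integrand is continuous on the box. The limit in [e] is dominated convergence,
    and the majorants are products of one-variable powers, [1/r <= |x|^(-1/2) |y|^(-1/2)] and
    [1/r^2 <= |x y z|^(-2/3)], so that integrability also reduces to the line. The approximate
    identity itself has no integrable majorant; its product with an increment from the origin has
    one, because a Lipschitz bound gains one power of the radius. In both dimensions its mass tends
    to [4 pi]: the leading coefficients [i/pi] of [ln (r^2)] and [-i/k] of [1/r] turn this into
    [4 i] and, since the Laplacian of [1/r] carries a minus sign, [4 pi i / k]. Real and imaginary
    parts are treated separately up to the Helmholtz identities. The linear algebra is done once,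
    over an abstract pairing whose delta strengths [cp], [ct] are parameters; uniqueness is obtained
    for the coefficients of any representation in the span. *)

Section foundations.
Context {R : realType}.

(** Continuity in the last variable lets it be replaced by grid points, where measurability in the
    other variable applies; the limit of measurable functions is measurable. This yields
    measurability of continuous functions for the product sigma-algebra, one coordinate at a
    time. *)
Lemma measurable_caratheodory d (X : measurableType d)
    (f : X * measurableTypeR R -> R) :
  (forall c, measurable_fun setT (fun p => f (p, c))) ->
  (forall p, continuous (fun z : R => f (p, z))) ->
  measurable_fun setT f.
Proof.
move=> mf cf.
(* Rounding down to the grid of mesh [1 / (n + 1)]. *)
pose q (n : nat) (z : R) : R := (Num.floor (z * n.+1%:R))%:~R / n.+1%:R.
have q_cvg z : q ^~ z @ \oo --> z.
  apply/cvgrPdist_le => e e0; near=> n.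
  have n0 : (0 : R) < n.+1%:R by [].
  have -> : z - q n z = (z * n.+1%:R - (Num.floor (z * n.+1%:R))%:~R) / n.+1%:R.
    by rewrite /q mulrBl mulfK// gt_eqF.
  have /andP[h1 h2] := floor_itv (z * n.+1%:R).
  rewrite ger0_norm; last by rewrite divr_ge0// subr_ge0.
  rewrite ler_pdivrMr//.
  have : (1 : R) <= e * n.+1%:R.
    rewrite mulrC -ler_pdivrMr//; near: n.
    exists (Num.truncn (1 / e)) => // n /= hn.
    apply: ltW; apply: lt_le_trans (truncnS_gt _) _.
    by rewrite ler_nat.
  apply: le_trans; rewrite lerBlDl -[X in _ <= _ + X]mulr1z -intrD.
  exact: ltW.
apply: (@measurable_fun_cvg _ _ _ setT (fun n p => f (p.1, q n p.2))).
  move=> n _ A mA; rewrite setTI.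
  (* [q n] takes countably many values, each on a half-open interval, so the preimage is a countable
     union of measurable rectangles. *)
  have -> : (fun p => f (p.1, q n p.2)) @^-1` A =
    \bigcup_(m : int) (((fun p => f (p, m%:~R / n.+1%:R)) @^-1` A) `*`
       [set z : R | Num.floor (z * n.+1%:R) = m]).
    apply/seteqP; split => [[x z] /= Ax|[x z] [m _ /= [Ax zm]]].
      by exists (Num.floor (z * n.+1%:R)).
    by rewrite /q zm.
  apply: countable_bigcupT_measurable => // m.
  apply: measurableX; first by rewrite -[X in measurable X]setTI; exact: mf.
  have -> : [set z : R | Num.floor (z * n.+1%:R) = m] =
      `[m%:~R / n.+1%:R, (m + 1)%:~R / n.+1%:R[%classic.
    apply/seteqP; split => z /=; rewrite in_itv/= ler_pdivrMr// ltr_pdivlMr//.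
      by move=> <-; exact: floor_itv.
    by move=> h; exact: floor_def.
  exact: measurable_itv.
move=> [x z] _ /=.
apply: (@continuous_cvg _ _ _ _ _ (q ^~ z) (fun t => f (x, t)) z (cf x z)).
exact: q_cvg.

Unshelve. all: by end_near. Qed.

End foundations.

Section box_integrals.
Context {R : realType} d1 d2 (X : measurableType d1) (Y : measurableType d2).
Variables (m1 : {sigma_finite_measure set X -> \bar R})
          (m2 : {sigma_finite_measure set Y -> \bar R}).
Variables (A : set X) (C : set Y) (f : X * Y -> R) (M : R).
Hypotheses (mA : measurable A) (mC : measurable C).
Hypotheses (fA : (m1 A < +oo)%E) (fC : (m2 C < +oo)%E).
Hypotheses (mf : measurable_fun setT f).
Hypothesis (fM : forall p, (A `*` C) p -> `|f p| <= M).

Lemma box_integrable : (m1 \x m2)%E.-integrable (A `*` C) (EFin \o f).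
Proof.
apply: measurable_bounded_integrable.
- exact: measurableX.
- by have := product_measure1E m1 m2 mA mC => /= ->; rewrite lte_mul_pinfty// ge0_fin_numE.
- exact: measurable_funTS.
- exists M; split; first exact: num_real.
  by move=> x Mx p /fM /le_trans; apply; exact: ltW.
Qed.

Let fp := (EFin \o f) \_ (A `*` C).

Let ifp : (m1 \x m2)%E.-integrable setT fp.
Proof.
apply/(integrable_mkcond (EFin \o f) (measurableX mA mC)).
exact: box_integrable.
Qed.

(** Extension by zero outside the box turns both sides into integrals over the whole space, where
    Fubini applies; the slices of [fp] vanish outside [A]. *)
Lemma box_Fubini12 :
  \int[(m1 \x m2)%E]_(p in A `*` C) f p =
  \int[m1]_(x in A) \int[m2]_(y in C) f (x, y).
Proof.
rewrite /Rintegral; congr fine.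
rewrite integral_mkcond -/fp -(integral12_prod_meas1 ifp) [RHS]integral_mkcond.
apply: eq_integral => x _.
rewrite patchE; case: ifPn => xA; last first.
  apply: integral0_eq => y _.
  rewrite /fp patchE ifF//; apply/negP; rewrite inE => -[/= Ax _].
  by move: xA; rewrite notin_setE; apply.
transitivity (\int[m2]_(y in C) (f (x, y))%:E)%E.
  rewrite [RHS]integral_mkcond; apply: eq_integral => y _.
  rewrite /fp !patchE; congr (if _ then _ else _).
  by rewrite in_setX xA.
rewrite fineK// integral_fune_fin_num//.
apply: measurable_bounded_integrable => //.
- apply/measurable_funTS; apply: measurableT_comp => //.
- exists M; split; first exact: num_real.
  move=> z Mz y Cy /=; apply: le_trans (fM _) (ltW Mz).
  by split => //=; exact: set_mem.
Qed.

Lemma box_Fubini21 :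
  \int[(m1 \x m2)%E]_(p in A `*` C) f p =
  \int[m2]_(y in C) \int[m1]_(x in A) f (x, y).
Proof.
rewrite /Rintegral; congr fine.
rewrite integral_mkcond -/fp -(integral21_prod_meas1 ifp) [RHS]integral_mkcond.
apply: eq_integral => y _.
rewrite patchE; case: ifPn => yC; last first.
  apply: integral0_eq => x _.
  rewrite /fp patchE ifF//; apply/negP; rewrite inE => -[/= _ Cy].
  by move: yC; rewrite notin_setE; apply.
transitivity (\int[m1]_(x in A) (f (x, y))%:E)%E.
  rewrite [RHS]integral_mkcond; apply: eq_integral => x _.
  rewrite /fp !patchE; congr (if _ then _ else _).
  by rewrite in_setX yC andbT.
rewrite fineK// integral_fune_fin_num//.
apply: measurable_bounded_integrable => //.
- apply/measurable_funTS; apply: measurableT_comp => //.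
- exists M; split; first exact: num_real.
  move=> z Mz x Ax /=; apply: le_trans (fM _) (ltW Mz).
  by split => //=; exact: set_mem.
Qed.

End box_integrals.

(* The library's sigma-finite instance on [m1 \x m2] is shadowed by the
   later one on products of subprobabilities; an alias makes it available. *)
Section product_sigma_finite.
Context {R : realType} d1 d2 (X : measurableType d1) (Y : measurableType d2).
Variables (m1 : {sigma_finite_measure set X -> \bar R})
          (m2 : {sigma_finite_measure set Y -> \bar R}).

Definition sigma_finite_prod : set (X * Y) -> \bar R := (m1 \x m2)%E.

HB.instance Definition _ := Measure.on sigma_finite_prod.

Let sigma_finite_prodT : sigma_finite setT sigma_finite_prod.
Proof.
have /sigma_finiteP[F [TF ndF Foo]] := sigma_finiteT m1.
have /sigma_finiteP[G [TG ndG Goo]] := sigma_finiteT m2.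
exists (fun n => F n `*` G n).
  apply/seteqP; split => // -[x y] _.
  have [n _ Fx] : (\bigcup_i F i) x by rewrite -TF.
  have [m _ Gy] : (\bigcup_i G i) y by rewrite -TG.
  exists (maxn n m) => //; split => /=.
    exact: (subsetPset _ _ (ndF _ _ (leq_maxl n m))).
  exact: (subsetPset _ _ (ndG _ _ (leq_maxr n m))).
move=> k; have [mF Fk] := Foo k; have [mG Gk] := Goo k.
split; first exact: measurableX.
have := product_measure1E m1 m2 mF mG; rewrite /sigma_finite_prod => ->.
by rewrite lte_mul_pinfty// ge0_fin_numE.
Qed.

HB.instance Definition _ := Measure_isSigmaFinite.Build _ _ _ sigma_finite_prod
  sigma_finite_prodT.

End product_sigma_finite.

Notation lam R := (@lebesgue_measure R : {sigma_finite_measure set (measurableTypeR R) -> \bar R}).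
Notation lam2 R := (sigma_finite_prod (lam R) (lam R)).
Notation lam3 R := (lam2 R \x lam R)%E.

Section slices.
Context {T U V : topologicalType}.

Lemma continuous_slicel (f : T * U -> V) c : continuous f ->
  continuous (fun x => f (x, c)).
Proof.
move=> cf x; apply: (@cvg_comp _ _ _ (fun x => (x, c)) f _ (nbhs (x, c))).
  by apply: (@cvg_pair _ _ _ _ (nbhs x) (nbhs c)); [exact: cvg_id|exact: cvg_cst].
exact: cf.
Qed.

Lemma continuous_slicer (f : T * U -> V) c : continuous f ->
  continuous (fun y => f (c, y)).
Proof.
move=> cf y; apply: (@cvg_comp _ _ _ (fun y => (c, y)) f _ (nbhs (c, y))).
  by apply: (@cvg_pair _ _ _ _ (nbhs c) (nbhs y)); [exact: cvg_cst|exact: cvg_id].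
exact: cf.
Qed.

End slices.

(* A plain proposition, so that the typeclass search triggered by [is_derive]
   does not interfere with the lemmas below. *)
Definition der (R : realType) (f : R -> R) (x a : R) : Prop := is_derive x 1 f a.

Section boxes.
Context {R : realType}.
Implicit Types B : R.

Definition box1 B : set (measurableTypeR R) := `[- B, B]%classic.
Definition box2 B : set (measurableTypeR R * measurableTypeR R) :=
  box1 B `*` box1 B.
Definition box3 B
    : set (measurableTypeR R * measurableTypeR R * measurableTypeR R) :=
  box2 B `*` box1 B.

Lemma measurable_box1 B : measurable (box1 B). Proof. exact: measurable_itv. Qed.
Lemma measurable_box2 B : measurable (box2 B).
Proof. by apply: measurableX; exact: measurable_box1. Qed.
Lemma measurable_box3 B : measurable (box3 B).
Proof. by apply: measurableX; [exact: measurable_box2|exact: measurable_box1]. Qed.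

Lemma fin_box1 B : (lam R (box1 B) < +oo)%E.
Proof. by rewrite /= lebesgue_measure_itv/=; case: ifP => // _; exact: ltry. Qed.
Lemma fin_box2 B : (lam2 R (box2 B) < +oo)%E.
Proof.
have := product_measure1E (lam R) (lam R) (measurable_box1 B) (measurable_box1 B).
rewrite /sigma_finite_prod /box2 /= => ->; have := fin_box1 B => h.
by rewrite lte_mul_pinfty// ge0_fin_numE.
Qed.

Lemma continuous_measurable2 (f : R * R -> R) : continuous f ->
  measurable_fun [set: measurableTypeR R * measurableTypeR R] f.
Proof.
move=> cf; apply: measurable_caratheodory.
  move=> c; apply: continuous_measurable_fun .
  exact: continuous_slicel.
by move=> p; exact: continuous_slicer.
Qed.

Lemma continuous_measurable3 (f : R * R * R -> R) : continuous f ->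
  measurable_fun
    [set: measurableTypeR R * measurableTypeR R * measurableTypeR R] f.
Proof.
move=> cf; apply: measurable_caratheodory.
  move=> c; apply: continuous_measurable2 .
  exact: continuous_slicel.
by move=> p; exact: continuous_slicer.
Qed.

Lemma compact_box2 B : compact (box2 B : set (R * R)).
Proof. by apply: compact_setX; exact: segment_compact. Qed.
Lemma compact_box3 B : compact (box3 B : set (R * R * R)).
Proof. by apply: compact_setX; [exact: compact_box2|exact: segment_compact]. Qed.

Lemma continuous_bounded_on (T : topologicalType) (f : T -> R) (A : set T) :
  compact A -> continuous f -> exists2 M : R, 0 < M & forall p, A p -> `|f p| <= M.
Proof.
move=> cA cf.
have /compact_bounded [M [_ hM]] : compact (f @` A).
  by apply: continuous_compact => //; exact: continuous_subspaceT.
exists (`|M| + 1); first by rewrite ltr_pwDr.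
move=> p Ap; apply: hM; last by exists p.
by rewrite (le_lt_trans (ler_norm _))// ltrDl.
Qed.

Lemma FTC_box1 (F f : R -> R) B : 0 < B -> continuous f ->
  (forall x, der F x (f x)) ->
  \int[lam R]_(x in box1 B) f x = F B - F (- B).
Proof.
move=> B0 cf dF; rewrite /Rintegral /box1 (@continuous_FTC2 _ _ F)//.
- by rewrite gtrN.
- exact: continuous_subspaceT.
- have cF : continuous F.
    by move=> x; apply/differentiable_continuous/derivable1_diffP; case: (dF x).
  split; first by move=> x _; case: (dF x).
    exact/cvg_at_right_filter/cF.
  exact/cvg_at_left_filter/cF.
- by move=> x _; rewrite derive1E; case: (dF x).
Qed.

Lemma FTC_box2_last (F f : R * R -> R) B : 0 < B -> continuous f ->
  (forall x y, der (fun y => F (x, y)) y (f (x, y))) ->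
  \int[lam2 R]_(p in box2 B) f p =
  \int[lam R]_(x in box1 B) (F (x, B) - F (x, - B)).
Proof.
move=> B0 cf dF.
have [M _ hM] := continuous_bounded_on (@compact_box2 B) cf.
rewrite (@box_Fubini12 _ _ _ _ _ (lam R) (lam R) _ _ _ M)//;
  try exact: measurable_box1; try exact: fin_box1; last first.
  exact: continuous_measurable2.
apply: eq_Rintegral => x _.
apply: (FTC_box1 (F := fun y => F (x, y))) => //.
exact: continuous_slicer.
Qed.

Lemma FTC_box2_first (F f : R * R -> R) B : 0 < B -> continuous f ->
  (forall x y, der (fun x => F (x, y)) x (f (x, y))) ->
  \int[lam2 R]_(p in box2 B) f p =
  \int[lam R]_(y in box1 B) (F (B, y) - F (- B, y)).
Proof.
move=> B0 cf dF.
have [M _ hM] := continuous_bounded_on (@compact_box2 B) cf.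
rewrite (@box_Fubini21 _ _ _ _ _ (lam R) (lam R) _ _ _ M)//;
  try exact: measurable_box1; try exact: fin_box1; last first.
  exact: continuous_measurable2.
apply: eq_Rintegral => y _.
apply: (FTC_box1 (F := fun x => F (x, y))) => //.
exact: continuous_slicel.
Qed.

Lemma FTC_box3_last (F f : R * R * R -> R) B : 0 < B -> continuous f ->
  (forall p z, der (fun z => F (p, z)) z (f (p, z))) ->
  \int[lam3 R]_(p in box3 B) f p =
  \int[lam2 R]_(p in box2 B) (F (p, B) - F (p, - B)).
Proof.
move=> B0 cf dF.
have [M _ hM] := continuous_bounded_on (@compact_box3 B) cf.
rewrite (@box_Fubini12 _ _ _ _ _ (lam2 R) (lam R) _ _ _ M)//;
  try exact: measurable_box2; try exact: measurable_box1; try exact: fin_box2;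
  try exact: fin_box1; last first.
  exact: continuous_measurable3.
apply: eq_Rintegral => x _.
apply: (FTC_box1 (F := fun y => F (x, y))) => //.
exact: continuous_slicer.
Qed.

(** Fubini takes the last coordinate outside, and the planar lemma on each slice makes the
    differentiated coordinate the innermost one. *)
Lemma FTC_box3_mid (F f : R * R * R -> R) B : 0 < B -> continuous f ->
  (forall x y z, der (fun y => F (x, y, z)) y (f (x, y, z))) ->
  \int[lam3 R]_(p in box3 B) f p =
  \int[lam R]_(z in box1 B)
     \int[lam R]_(x in box1 B) (F (x, B, z) - F (x, - B, z)).
Proof.
move=> B0 cf dF.
have [M _ hM] := continuous_bounded_on (@compact_box3 B) cf.
rewrite (@box_Fubini21 _ _ _ _ _ (lam2 R) (lam R) _ _ _ M)//;
  try exact: measurable_box2; try exact: measurable_box1; try exact: fin_box2;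
  try exact: fin_box1; last first.
  exact: continuous_measurable3.
apply: eq_Rintegral => z _.
apply: (FTC_box2_last (F := fun p => F (p, z))) => //.
exact: continuous_slicel.
Qed.

Lemma FTC_box3_first (F f : R * R * R -> R) B : 0 < B -> continuous f ->
  (forall x y z, der (fun x => F (x, y, z)) x (f (x, y, z))) ->
  \int[lam3 R]_(p in box3 B) f p =
  \int[lam R]_(z in box1 B)
     \int[lam R]_(y in box1 B) (F (B, y, z) - F (- B, y, z)).
Proof.
move=> B0 cf dF.
have [M _ hM] := continuous_bounded_on (@compact_box3 B) cf.
rewrite (@box_Fubini21 _ _ _ _ _ (lam2 R) (lam R) _ _ _ M)//;
  try exact: measurable_box2; try exact: measurable_box1; try exact: fin_box2;
  try exact: fin_box1; last first.
  exact: continuous_measurable3.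
apply: eq_Rintegral => z _.
apply: (FTC_box2_first (F := fun p => F (p, z))) => //.
exact: continuous_slicel.
Qed.

End boxes.

#[export] Hint Extern 0 (measurable (box1 _)) => solve [exact: measurable_box1] : core.
#[export] Hint Extern 0 (measurable (box2 _)) => solve [exact: measurable_box2] : core.
#[export] Hint Extern 0 (measurable (box3 _)) => solve [exact: measurable_box3] : core.

(** * Calculus on the line *)

Section calculus.
Context {R : realType}.
Implicit Types (f g : R -> R) (x a b : R).

(** Lets the rules below produce a derivative first, to be matched with the expected value by [ring]
    or [field]. *)
Lemma der_eq f x a b : der f x a -> a = b -> der f x b.
Proof. by move=> h <-. Qed.

Lemma der_cst c x : der (fun=> c) x 0. Proof. exact: is_derive_cst. Qed.

Lemma der_id x : der (fun t => t) x 1. Proof. exact: is_derive_id. Qed.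

Lemma derD f g x a b : der f x a -> der g x b -> der (fun t => f t + g t) x (a + b).
Proof. by move=> df dg; exact: is_deriveD. Qed.

Lemma derN f x a : der f x a -> der (fun t => - f t) x (- a).
Proof. by move=> df; exact: is_deriveN. Qed.

Lemma derB f g x a b : der f x a -> der g x b -> der (fun t => f t - g t) x (a - b).
Proof. by move=> df dg; exact: is_deriveB. Qed.

Lemma derM f g x a b : der f x a -> der g x b ->
  der (fun t => f t * g t) x (a * g x + f x * b).
Proof.
move=> df dg; apply: der_eq (is_deriveM df dg) _.
by rewrite addrC; congr (_ + _); rewrite mulrC.
Qed.

Lemma derZ c f x a : der f x a -> der (fun t => c * f t) x (c * a).
Proof. by move=> df; exact: (is_deriveZ c df). Qed.

Lemma derX2 f x a : der f x a -> der (fun t => f t ^+ 2) x (2 * f x * a).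
Proof.
move=> df; rewrite (_ : (fun t => _) = (fun t => f t * f t)).
  by apply: der_eq (derM df df) _; ring.
by apply/funext => t; rewrite expr2.
Qed.

Lemma der_comp f g x a b : der f (g x) a -> der g x b ->
  der (fun t => f (g t)) x (a * b).
Proof. by move=> df dg; exact: is_derive1_comp. Qed.

Lemma derV f x a : f x != 0 -> der f x a ->
  der (fun t => (f t)^-1) x (- a / f x ^+ 2).
Proof.
move=> fx0 df; have dfx : derivable f x 1 by case: df.
split; first exact: derivableV.
rewrite deriveV// (_ : 'D_1 f x = a); last by case: df.
by rewrite /GRing.scale/= !mulNr mulrC.
Qed.

Lemma der_sqrt f x a : 0 < f x -> der f x a ->
  der (fun t => Num.sqrt (f t)) x (a / (2 * Num.sqrt (f x))).
Proof.
move=> fx0 df; apply: der_eq (der_comp (is_derive1_sqrt fx0) df) _.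
by rewrite mulrC.
Qed.

Lemma der_ln f x a : 0 < f x -> der f x a -> der (fun t => ln (f t)) x (a / f x).
Proof.
move=> fx0 df; apply: der_eq (der_comp (is_derive1_ln fx0) df) _.
by rewrite mulrC.
Qed.

Lemma der_powR f x a r : 0 < f x -> der f x a ->
  der (fun t => f t `^ r) x (r * f x `^ (r - 1) * a).
Proof.
by move=> fx0 df; exact: (der_comp (is_derive1_powR r fx0) df).
Qed.

Lemma der_continuous f x a : der f x a -> {for x, continuous f}.
Proof. by case=> df _; exact/differentiable_continuous/derivable1_diffP. Qed.

Lemma der_continuousT f g : (forall x, der f x (g x)) -> continuous f.
Proof. by move=> df x; exact: der_continuous (df x). Qed.

End calculus.

(** * Dominated convergence and the regularization *)

Section dominated.
Context {R : realType} d (X : measurableType d).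
Variables (mu : {measure set X -> \bar R}).

Lemma Rintegral_dominated_cvg (D : set X) (f_ : (X -> R)^nat) (f g : X -> R) :
  measurable D -> (forall n, measurable_fun setT (f_ n)) ->
  measurable_fun setT f ->
  {ae mu, forall x, D x -> f_ n x @[n --> \oo] --> f x} ->
  mu.-integrable D (EFin \o g) ->
  {ae mu, forall x, forall n, D x -> `|f_ n x| <= g x} ->
  \int[mu]_(x in D) f_ n x @[n --> \oo] --> \int[mu]_(x in D) f x.
Proof.
move=> mD mf_ mf f_f ig f_g.
have [|||||fi _ ] := @dominated_convergence _ X R mu D mD
  (fun n => EFin \o f_ n) (EFin \o f) (EFin \o g).
- by move=> n; apply/measurable_EFinP/measurable_funTS.
- exact/measurable_EFinP/measurable_funTS.
- apply: filterS f_f => x h Dx; apply: cvg_EFin; last exact: h.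
  exact: nearW.
- exact: ig.
- apply: filterS f_g => x h n Dx; rewrite /= lee_fin; exact: h.
move=> h; rewrite /Rintegral; apply: fine_cvg; rewrite fineK//.
by apply: integrable_fin_num.
Qed.

(** Dominated convergence for the constant sequence [f], whose conclusion includes integrability of
    the limit. *)
Lemma ae_dominated_integrable (D : set X) (f g : X -> R) :
  measurable D -> measurable_fun setT f ->
  mu.-integrable D (EFin \o g) ->
  {ae mu, forall x, D x -> `|f x| <= g x} ->
  mu.-integrable D (EFin \o f).
Proof.
move=> mD mf ig fg.
have [|||||//] := @dominated_convergence _ X R mu D mD
  (fun n => EFin \o f) (EFin \o f) (EFin \o g).
- by move=> n; exact/measurable_EFinP/measurable_funTS.
- exact/measurable_EFinP/measurable_funTS.
- by apply: aeW => x Dx; exact: cvg_cst.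
- exact: ig.
- apply: filterS fg => x h n Dx; rewrite /= lee_fin; exact: h.
Qed.

End dominated.

Section integrable_product.
Context {R : realType} d1 d2 (X : measurableType d1) (Y : measurableType d2).
Variables (m1 : {sigma_finite_measure set X -> \bar R})
          (m2 : {sigma_finite_measure set Y -> \bar R}).

(** By Tonelli the integral of the absolute value factors into two finite one-variable integrals. *)
Lemma integrable_tensor (A : set X) (C : set Y) (f : X -> R) (g : Y -> R) :
  measurable A -> measurable C ->
  measurable_fun setT f -> measurable_fun setT g ->
  m1.-integrable A (EFin \o f) -> m2.-integrable C (EFin \o g) ->
  (m1 \x m2)%E.-integrable (A `*` C) (fun p => (f p.1 * g p.2)%:E).
Proof.
move=> mA mC mf mg fi gi.
apply/(integrable_mkcond _ (measurableX mA mC)).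
set h := (X in integrable _ _ X).
have mh : measurable_fun setT h.
  apply/(measurable_restrictT _ _).1; first exact: measurableX.
  apply/measurable_EFinP/measurable_funTS/measurable_funM.
    exact: measurableT_comp.
  exact: measurableT_comp.
apply/(@integrable12ltyP _ _ _ _ _ m1 m2 h mh).
have hE x y : `|h (x, y)|%E =
    ((fun x => `|f x|%:E) \_ A x * (fun y => `|g y|%:E) \_ C y)%E.
  rewrite /h !patchE in_setX/=.
  case: ifPn => [/andP[-> ->]|]/=; first by rewrite normrM EFinM.
  by rewrite negb_and => /orP[/negbTE ->|/negbTE ->]; rewrite ?mul0e ?mule0 normr0.
under eq_integral do under eq_integral do rewrite hE.
have /integrableP[_ fA] := fi; have /integrableP[_ gC] := gi.
under eq_integral => x _.
  rewrite ge0_integralZl//; last 3 first.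
  - apply/(measurable_restrictT _ _).1 => //.
    by apply/measurable_EFinP/measurable_funTS; exact: measurableT_comp.
  - by move=> y _; rewrite patchE; case: ifP.
  - by rewrite patchE; case: ifP.
  over.
rewrite /= ge0_integralZr//; last 3 first.
- apply/(measurable_restrictT _ _).1 => //.
  by apply/measurable_EFinP/measurable_funTS; exact: measurableT_comp.
- by move=> y _; rewrite patchE; case: ifP.
- by apply: integral_ge0 => y _; rewrite patchE; case: ifP.
rewrite -!integral_mkcond lte_mul_pinfty//.
- exact: integral_ge0.
- by rewrite ge0_fin_numE//; exact: integral_ge0.
Qed.

End integrable_product.

Section dominators.
Context {R : realType}.
Implicit Types (b B e t : R).

Definition eps (n : nat) : R := n.+1%:R^-1.

Lemma eps_gt0 n : 0 < eps n. Proof. by rewrite invr_gt0. Qed.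

Lemma eps_le1 n : eps n <= 1. Proof. by rewrite invf_le1// ler1n. Qed.

Lemma eps2_gt0 n : 0 < eps n ^+ 2. Proof. by rewrite exprn_gt0// eps_gt0. Qed.

Lemma eps2_le1 n : eps n ^+ 2 <= 1.
Proof. by apply: exprn_ile1; [rewrite ltW// eps_gt0|exact: eps_le1]. Qed.

Lemma cvg_eps : eps @ \oo --> (0 : R). Proof. exact: cvg_harmonic. Qed.

Lemma cvg_eps2 : eps n ^+ 2 @[n --> \oo] --> (0 : R).
Proof.
rewrite [X in _ --> X](_ : _ = 0 * 0 :> R); last by rewrite mulr0.
under eq_fun do rewrite expr2.
by apply: cvgM; exact: cvg_eps.
Qed.

Lemma cvg_regularized s : s + eps n ^+ 2 @[n --> \oo] --> (s : R).
Proof.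
rewrite -[X in _ --> X]addr0.
by apply: cvgD; [exact: cvg_cst|exact: cvg_eps2].
Qed.

(* [t ^ (- 2 b)], written so that it is smooth after adding a constant to
   [t ^ 2]; the junk value at [t = 0] is [0]. *)
Definition singular b t : R := (t ^+ 2) `^ (- b).

Lemma measurable_singular b : measurable_fun [set: measurableTypeR R] (singular b).
Proof.
apply: (measurableT_comp (measurable_powR (- b))).
exact: measurable_funX.
Qed.

Lemma singular_ge0 b t : 0 <= singular b t. Proof. exact: powR_ge0. Qed.

(** The derivative is at least [1 - 2 b] times [(t^2 + e^2)^(-b)], since the ratio
    [t^2 / (t^2 + e^2)] is at most [1]; this is how a power without elementary primitive gets
    integrated below. *)
Lemma der_regularized b e t : e != 0 ->
  der (fun t => t * (t ^+ 2 + e ^+ 2) `^ (- b)) t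
      ((t ^+ 2 + e ^+ 2) `^ (- b) * (1 - 2 * b * (t ^+ 2 / (t ^+ 2 + e ^+ 2)))).
Proof.
move=> e0; have w0 x : 0 < x ^+ 2 + e ^+ 2.
  by rewrite ltr_wpDl ?sqr_ge0// exprn_even_gt0.
apply: der_eq.
  apply: (derM (der_id t)); apply: der_powR; first exact: w0.
  by apply: derD; [apply: derX2; exact: der_id|exact: der_cst].
rewrite powRD; last by apply/implyP => _; rewrite gt_eqF.
by rewrite powR_inv1 ?ltW//; ring.
Qed.

(** The bound of [der_regularized] is integrated by the fundamental theorem; the boundary value
    [2 B (B^2 + e^2)^(-b)] decreases in [e], which makes the estimate uniform in [e]. *)
Lemma regularized_integral_le b e B : 0 < b -> b < 2^-1 -> 0 < B -> e != 0 ->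
  \int[lam R]_(t in box1 B) (t ^+ 2 + e ^+ 2) `^ (- b) <=
  2 * B * (B ^+ 2) `^ (- b) / (1 - 2 * b).
Proof.
move=> b0 b1 B0 e0; have w0 x : 0 < x ^+ 2 + e ^+ 2.
  by rewrite ltr_wpDl ?sqr_ge0// exprn_even_gt0.
have b2 : 0 < 1 - 2 * b by lra.
have cw : continuous (fun t : R => (t ^+ 2 + e ^+ 2) `^ (- b)).
  move=> x; apply: (@der_continuous _ _ x _).
  apply: der_powR; first exact: w0.
  by apply: derD; [apply: derX2; exact: der_id|exact: der_cst].
have cq : continuous (fun t : R => t ^+ 2 / (t ^+ 2 + e ^+ 2)).
  move=> x; apply: (@der_continuous _ _ x _).
  apply: derM; first by apply: derX2; exact: der_id.
  apply: derV; first by rewrite gt_eqF.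
  by apply: derD; [apply: derX2; exact: der_id|exact: der_cst].
have cd : continuous (fun t : R => (t ^+ 2 + e ^+ 2) `^ (- b) *
    (1 - 2 * b * (t ^+ 2 / (t ^+ 2 + e ^+ 2)))).
  move=> x; apply: cvgM; first exact: cw.
  apply: cvgB; first exact: cvg_cst.
  by apply: cvgM; [exact: cvg_cst|exact: cq].
have icont (f : R -> R) : continuous f ->
    (lam R).-integrable (box1 B) (EFin \o f).
  move=> cf; apply: continuous_compact_integrable; first exact: segment_compact.
  exact: continuous_subspaceT.
have /= FT := FTC_box1 B0 cd (fun t => der_regularized b t e0).
rewrite ler_pdivlMr// mulrC -RintegralZl//; last exact: icont.
  apply: le_trans (_ : \int[lam R]_(t in box1 B) ((t ^+ 2 + e ^+ 2) `^ (- b) *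
    (1 - 2 * b * (t ^+ 2 / (t ^+ 2 + e ^+ 2)))) <= _).
    apply: le_Rintegral => //.
    - apply: icont => x; apply: cvgM; [exact: cvg_cst|exact: cw].
    - exact: icont.
    - move=> t _; rewrite mulrC ler_wpM2l ?powR_ge0//.
      rewrite lerD2l lerN2 ler_piMr//; first by lra.
      by rewrite ler_pdivrMr// mul1r lerDl sqr_ge0.
  rewrite FT sqrrN mulNr opprK -mulr2n -[leLHS]mulr_natl -!mulrA !ler_pM2l//.
  rewrite !powRN lef_pV2 ?posrE ?powR_gt0 ?exprn_gt0//.
  by apply: ge0_ler_powR; rewrite ?nnegrE ?ltW ?exprn_gt0// ltrDl exprn_even_gt0.
Qed.

(** Fatou's lemma along [e = eps n], with the uniform bound [C] of the regularized integrals. The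
    condition on [b] says that the exponent [2 b] of [1/|t|] stays below [1]. *)
Lemma integrable_singular b B : 0 < b -> b < 2^-1 -> 0 < B ->
  (lam R).-integrable (box1 B) (EFin \o singular b).
Proof.
move=> b0 b1 B0; apply/integrableP; split.
  apply/measurable_EFinP; apply: measurable_funTS; exact: measurable_singular.
pose g (n : nat) t : \bar R := ((t ^+ 2 + eps n ^+ 2) `^ (- b))%:E.
have n0 n : eps n != 0 by rewrite gt_eqF// eps_gt0.
have mg n : measurable_fun (box1 B) (g n).
  apply/measurable_EFinP/measurable_funTS.
  apply: (measurableT_comp (measurable_powR (- b))).
  by apply: measurable_funD => //; exact: measurable_funX.
have mB := measurable_box1 B.
have g0 n t : box1 B t -> (0 <= g n t)%E by rewrite lee_fin powR_ge0.
have := @fatou _ _ R (lam R) (box1 B) mB g mg g0.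
set C := 2 * B * (B ^+ 2) `^ (- b) / (1 - 2 * b).
have gC n : (\int[lam R]_(t in box1 B) g n t <= C%:E)%E.
  have := @regularized_integral_le b (eps n) B b0 b1 B0 (n0 n).
  rewrite -lee_fin /Rintegral fineK//.
  apply: integrable_fin_num => //.
  apply: continuous_compact_integrable; first exact: segment_compact.
  apply: continuous_subspaceT => x; apply: (@der_continuous _ _ x _).
  apply: der_powR; first by rewrite ltr_wpDl ?sqr_ge0// eps2_gt0.
  by apply: derD; [apply: derX2; exact: der_id|exact: der_cst].
move=> fat; have {fat} fat2 : (\int[lam R]_(t in box1 B) limn_einf (g ^~ t) <= C%:E)%E.
  apply: (le_trans fat); rewrite limn_einf_lim.
  apply: lime_le; first exact: is_cvg_einfs.
  apply: nearW => n; apply: le_trans (gC n).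
  by apply: ereal_inf_lbound; exists n => /=.
apply: le_lt_trans (ltry C); apply: le_trans fat2.
apply: ge0_le_integral => //.
- apply/measurable_EFinP/measurable_funTS.
  by apply: measurableT_comp => //; exact: measurable_singular.
(* The lower limit unfolds to the opposite of the upper limit of the opposites. *)
- change (measurable_fun (box1 B)
    (-%E \o (fun t => limn_esup (fun n => (- g n t)%E)))).
  apply: measurableT_comp; first exact: oppe_measurable.
  apply: measurable_fun_limn_esup => n.
  by apply: measurableT_comp (mg n); exact: oppe_measurable.
- move=> t _; rewrite /= ger0_norm ?singular_ge0//.
  (* At [t = 0] the junk value [0] of [singular] only asks the lower limit to be nonnegative. *)
  have [->|t0] := eqVneq t 0.
    rewrite /singular expr0n/= powR0 ?oppr_eq0 ?gt_eqF//.
    rewrite limn_einf_lim; apply: lime_ge; first exact: is_cvg_einfs.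
    apply: nearW => n; apply: le_ereal_inf_tmp => _ [m _ <-].
    by rewrite lee_fin powR_ge0.
  rewrite (_ : limn_einf _ = (singular b t)%:E)//.
  have gt : g ^~ t @ \oo --> (singular b t)%:E.
    apply: cvg_EFin; first exact: nearW.
    rewrite /comp/= /singular.
    have dp : {for t ^+ 2, continuous (fun x : R => x `^ (- b))}.
      apply: (@der_continuous _ _ (t ^+ 2) _).
      by apply: der_powR (der_id _); rewrite exprn_even_gt0.
    apply: (@continuous_cvg _ _ _ _ _ (fun n => t ^+ 2 + eps n ^+ 2)
      (fun x : R => x `^ (- b)) (t ^+ 2) dp).
    exact: cvg_regularized.
  by have [-> _] := cvg_limn_einf_sup gt.
Qed.

End dominators.

Section continuity.
Context {R : realType} {T : topologicalType}.
Implicit Types f g : T -> R.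

Lemma continuous_cst_fun (c : R) : continuous (fun _ : T => c).
Proof. by move=> x; exact: cvg_cst. Qed.

Lemma continuous_add f g : continuous f -> continuous g ->
  continuous (fun x => f x + g x).
Proof. by move=> cf cg x; apply: cvgD; [exact: cf|exact: cg]. Qed.

Lemma continuous_sub f g : continuous f -> continuous g ->
  continuous (fun x => f x - g x).
Proof. by move=> cf cg x; apply: cvgB; [exact: cf|exact: cg]. Qed.

Lemma continuous_mul f g : continuous f -> continuous g ->
  continuous (fun x => f x * g x).
Proof. by move=> cf cg x; apply: cvgM; [exact: cf|exact: cg]. Qed.

Lemma continuous_sqr f : continuous f -> continuous (fun x => f x ^+ 2).
Proof.
move=> cf; rewrite (_ : (fun x => _) = (fun x => f x * f x)).
  exact: continuous_mul.
by apply/funext => x; rewrite expr2.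
Qed.

Lemma continuous_comp_at (h : R -> R) f :
  (forall x, {for f x, continuous h}) -> continuous f ->
  continuous (fun x => h (f x)).
Proof. by move=> ch cf x; apply: continuous_comp; [exact: cf|exact: ch]. Qed.

End continuity.

(** * Squared radii, tensor dominators and increments on boxes *)

Section coordinates.
Context {R : realType}.

Definition sqr2 (p : R * R) : R := p.1 ^+ 2 + p.2 ^+ 2.
Definition sqr3 (p : R * R * R) : R := sqr2 p.1 + p.2 ^+ 2.

Lemma continuous_sqr2 : continuous sqr2.
Proof.
by apply: continuous_add; apply: continuous_sqr => p; [exact: cvg_fst|exact: cvg_snd].
Qed.

Lemma continuous_sqr3 : continuous sqr3.
Proof.
apply: continuous_add; last by apply: continuous_sqr => p; exact: cvg_snd.
by move=> p; apply: continuous_comp; [exact: cvg_fst|exact: continuous_sqr2].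
Qed.

Lemma sqr2_ge0 p : 0 <= sqr2 p. Proof. by rewrite addr_ge0 ?sqr_ge0. Qed.
Lemma sqr3_ge0 p : 0 <= sqr3 p. Proof. by rewrite addr_ge0 ?sqr2_ge0 ?sqr_ge0. Qed.

Lemma sqr2_gt0 p : p.1 != 0 -> 0 < sqr2 p.
Proof. by move=> h; rewrite ltr_wpDr ?sqr_ge0// exprn_even_gt0. Qed.
Lemma sqr3_gt0 p : p.1.1 != 0 -> 0 < sqr3 p.
Proof. by move=> h; rewrite ltr_wpDr ?sqr_ge0// sqr2_gt0. Qed.

Lemma box1P (B x : R) : box1 B x = (`|x| <= B) :> Prop.
Proof. by rewrite /box1/= in_itv/= ler_norml. Qed.

Lemma sqr2_box B p : box2 B p -> sqr2 p <= 2 * B ^+ 2.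
Proof.
rewrite /box2/= !box1P => -[h1 h2].
rewrite mulr_natl mulr2n lerD// -[leLHS]real_normK ?num_real//.
  by rewrite lerXn2r ?nnegrE// (le_trans _ h1).
by rewrite lerXn2r ?nnegrE// (le_trans _ h2).
Qed.

Lemma sqr3_box B p : box3 B p -> sqr3 p <= 3 * B ^+ 2.
Proof.
rewrite /box3/= box1P => -[/sqr2_box h1 h2].
have -> : 3 * B ^+ 2 = 2 * B ^+ 2 + B ^+ 2 by ring.
rewrite lerD//.
by rewrite -[leLHS]real_normK ?num_real// lerXn2r ?nnegrE// (le_trans _ h2).
Qed.

Lemma powRN_le (x y b : R) : 0 < b -> 0 < x -> x <= y -> y `^ (- b) <= x `^ (- b).
Proof.
move=> b0 x0 xy; have y0 := lt_le_trans x0 xy.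
rewrite !powRN lef_pV2 ?posrE ?powR_gt0//.
by apply: ge0_ler_powR => //; rewrite ?nnegrE; exact: ltW.
Qed.

(** Each squared coordinate is at most [r^2], so [|x|^(-1/2) |y|^(-1/2)] majorizes [1/r] and
    [|x y z|^(-2/3)] majorizes [1/r^2]. The parameters [4^-1] and [3^-1] share the power of [r^2]
    evenly among the coordinates and stay below the threshold [2^-1] of [integrable_singular]. *)
Definition dom2 (p : measurableTypeR R * measurableTypeR R) : R :=
  singular 4^-1 p.1 * singular 4^-1 p.2.
Definition dom3 (p : measurableTypeR R * measurableTypeR R * measurableTypeR R)
  : R := singular 3^-1 p.1.1 * singular 3^-1 p.1.2 * singular 3^-1 p.2.

Lemma le_dom2 p : p.1 != 0 -> p.2 != 0 -> (Num.sqrt (sqr2 p))^-1 <= dom2 p.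
Proof.
move=> p1 p2; have s0 := sqr2_gt0 p1.
have q0 : 0 < 4^-1 :> R by rewrite invr_gt0.
rewrite -(powR12_sqrt (ltW s0)) -powRN (_ : - 2^-1 = - 4^-1 + - 4^-1); last by field.
rewrite powRD; last by apply/implyP => _; rewrite gt_eqF.
by rewrite /dom2 /singular ler_pM ?powR_ge0// powRN_le ?exprn_even_gt0// /sqr2 ?lerDl ?lerDr ?sqr_ge0.
Qed.

Lemma le_dom3 p : p.1.1 != 0 -> p.1.2 != 0 -> p.2 != 0 -> (sqr3 p)^-1 <= dom3 p.
Proof.
move=> p1 p2 p3; have s0 := sqr3_gt0 p1.
have q0 : 0 < 3^-1 :> R by rewrite invr_gt0.
rewrite -(powR_inv1 (ltW s0)) (_ : -1 = - 3^-1 + - 3^-1 + - 3^-1 :> R); last by field.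
rewrite powRD; last by apply/implyP => _; rewrite gt_eqF.
rewrite powRD; last by apply/implyP => _; rewrite gt_eqF.
rewrite /dom3 /singular ler_pM ?mulr_ge0 ?powR_ge0//; first rewrite ler_pM ?powR_ge0//;
  rewrite powRN_le ?exprn_even_gt0// /sqr3 /sqr2.
- by rewrite -addrA lerDl addr_ge0 ?sqr_ge0.
- by rewrite addrAC lerDr addr_ge0 ?sqr_ge0.
- by rewrite lerDr addr_ge0 ?sqr_ge0.
Qed.

Lemma integrable_dom2 B : 0 < B -> (lam2 R).-integrable (box2 B) (EFin \o dom2).
Proof.
move=> B0; apply: (integrable_tensor (m1 := lam R) (m2 := lam R)) => //;
  do ?[exact: measurable_singular]; apply: integrable_singular => //; lra.
Qed.

Lemma integrable_dom3 B : 0 < B -> (lam3 R).-integrable (box3 B) (EFin \o dom3).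
Proof.
move=> B0; apply: (integrable_tensor (m1 := lam2 R) (m2 := lam R)
  (f := fun p => singular 3^-1 p.1 * singular 3^-1 p.2)) => //.
- apply: measurable_funM; apply: measurableT_comp => //; exact: measurable_singular.
- exact: measurable_singular.
- apply: (integrable_tensor (m1 := lam R) (m2 := lam R)) => //;
    do ?[exact: measurable_singular]; apply: integrable_singular => //; lra.
- by apply: integrable_singular => //; lra.
Qed.

Lemma ae_lam : {ae lam R, forall x : R, x != 0}.
Proof.
exists [set 0]; split => //; first exact: lebesgue_measure_set1.
by move=> x /= /negP; rewrite negbK => /eqP.
Qed.

(** The exceptional set lies in two strips [N1 * Y] and [X * N2], each of measure zero because zero
    times infinity is zero for extended reals. *)
Lemma ae_tensor d1 d2 (X : measurableType d1) (Y : measurableType d2)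
    (m1 : {sigma_finite_measure set X -> \bar R})
    (m2 : {sigma_finite_measure set Y -> \bar R})
    (P : X -> Prop) (Q : Y -> Prop) :
  {ae m1, forall x, P x} -> {ae m2, forall y, Q y} ->
  {ae (m1 \x m2)%E, forall p, P p.1 /\ Q p.2}.
Proof.
move=> [N1 [mN1 N10 N1P]] [N2 [mN2 N20 N2Q]].
exists ((N1 `*` setT) `|` (setT `*` N2)); split.
- by apply: measurableU; exact: measurableX.
- apply: null_set_setU; do ?exact: measurableX.
    by have := product_measure1E m1 m2 mN1 measurableT => /= ->; rewrite N10 mul0e.
  by have := product_measure1E m1 m2 measurableT mN2 => /= ->; rewrite N20 mule0.
- move=> [x y] /= /not_andP[hP|hQ]; [left|right]; split => //=.
    exact: N1P.
  exact: N2Q.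
Qed.

Lemma ae_lam2 : {ae lam2 R, forall p, p.1 != 0 /\ p.2 != 0}.
Proof. exact: (ae_tensor ae_lam ae_lam). Qed.

Lemma ae_lam3 : {ae lam3 R, forall p, [/\ p.1.1 != 0, p.1.2 != 0 & p.2 != 0]}.
Proof.
by apply: filterS (ae_tensor ae_lam2 ae_lam) => p [[]].
Qed.

(** The dominators take the junk value [0] on the axes, so the bounds by them hold off the axes
    only, which is almost everywhere. *)
Lemma ae_lam2W (P : R * R -> Prop) :
  (forall p, p.1 != 0 -> p.2 != 0 -> P p) -> {ae lam2 R, forall p, P p}.
Proof.
move=> hP; have [N [mN N0 NP]] := ae_lam2.
exists N; split => // p nP; apply: NP => -[p1 p2]; apply: nP; exact: hP.
Qed.

Lemma ae_lam3W (P : R * R * R -> Prop) :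
  (forall p, p.1.1 != 0 -> p.1.2 != 0 -> p.2 != 0 -> P p) ->
  {ae lam3 R, forall p, P p}.
Proof.
move=> hP; have [N [mN N0 NP]] := ae_lam3.
exists N; split => // p nP; apply: NP => -[p1 p2 p3]; apply: nP; exact: hP.
Qed.

Lemma continuous_integrable2 (f : R * R -> R) B : continuous f ->
  (lam2 R).-integrable (box2 B) (EFin \o f).
Proof.
move=> cf; have [M _ fM] := continuous_bounded_on (@compact_box2 _ B) cf.
apply: (box_integrable (m1 := lam R) (m2 := lam R) (M := M)) => //;
  do ?exact: fin_box1; exact: continuous_measurable2.
Qed.

Lemma continuous_integrable3 (f : R * R * R -> R) B : continuous f ->
  (lam3 R).-integrable (box3 B) (EFin \o f).
Proof.
move=> cf; have [M _ fM] := continuous_bounded_on (@compact_box3 _ B) cf.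
apply: (box_integrable (m1 := lam2 R) (m2 := lam R) (M := M)) => //;
  do ?[exact: fin_box1|exact: fin_box2]; exact: continuous_measurable3.
Qed.

(* Increments are measured from [0]; a point of a box sees [0] through a path
   parallel to the axes that stays in the box. *)
Lemma der_increment_le (w w' : R -> R) (M B x : R) :
  (forall t, der w t (w' t)) -> (forall t, box1 B t -> `|w' t| <= M) ->
  box1 B x -> `|w x - w 0| <= M * `|x|.
Proof.
move=> dw wM xB.
have cw := der_continuousT dw.
have step (a b : R) : a <= b -> box1 B a -> box1 B b ->
    `|w b - w a| <= M * (b - a).
  move=> ab aB bB; have [||c cab ->] := @MVT_segment R w w' a b ab.
  - by move=> t _; exact: dw.
  - exact: continuous_subspaceT.
  rewrite normrM [`|b - a|]ger0_norm ?subr_ge0// ler_wpM2r ?subr_ge0//.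
  apply: wM; move: aB bB cab; rewrite /box1/= !in_itv/=.
  by move=> /andP[? _] /andP[_ ?] /andP[? ?]; apply/andP; split; lra.
have B0 : box1 B 0.
  by rewrite box1P normr0; move: xB; rewrite box1P; exact: le_trans.
have [x0|x0] := leP 0 x.
  by have := step _ _ x0 B0 xB; rewrite subr0 [`|x|]ger0_norm.
have := step _ _ (ltW x0) xB B0; rewrite distrC sub0r.
by rewrite [`|x|]ltr0_norm.
Qed.

Lemma norm_le_sqrt (x s : R) : x ^+ 2 <= s -> `|x| <= Num.sqrt s.
Proof. by move=> xs; rewrite -sqrtr_sqr ler_wsqrtr. Qed.

Lemma lipschitz2 (w wx wy : R * R -> R) B : continuous wx -> continuous wy ->
  (forall x y, der (fun x => w (x, y)) x (wx (x, y))) ->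
  (forall x y, der (fun y => w (x, y)) y (wy (x, y))) ->
  exists2 L : R, 0 < L & forall p, box2 B p -> `|w p - w 0| <= L * Num.sqrt (sqr2 p).
Proof.
move=> cx cy dx dy.
have [M M0 hM] := continuous_bounded_on (@compact_box2 _ B) cx.
have [N N0 hN] := continuous_bounded_on (@compact_box2 _ B) cy.
exists (M + N) => [|[x y] [/= xB yB]]; first exact: addr_gt0.
have B0 : box1 B 0.
  by rewrite box1P normr0; move: xB; rewrite box1P; exact: le_trans.
rewrite (_ : w (x, y) - w 0 = (w (x, y) - w (0, y)) + (w (0, y) - w (0, 0)));
  last by rewrite addrA subrK.
rewrite (le_trans (ler_normD _ _))// mulrDl lerD//.
  apply: le_trans (@der_increment_le (fun x => w (x, y)) _ M B x _ _ xB) _.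
  - by move=> t; exact: dx.
  - by move=> t tB; exact: hM.
  by rewrite ler_pM2l// norm_le_sqrt// lerDl sqr_ge0.
apply: le_trans (@der_increment_le (fun y => w (0, y)) _ N B y _ _ yB) _.
- by move=> t; exact: dy.
- by move=> t tB; exact: hN.
by rewrite ler_pM2l// norm_le_sqrt// lerDr sqr_ge0.
Qed.

Lemma lipschitz3 (w wx wy wz : R * R * R -> R) B :
  continuous wx -> continuous wy -> continuous wz ->
  (forall x y z, der (fun x => w (x, y, z)) x (wx (x, y, z))) ->
  (forall x y z, der (fun y => w (x, y, z)) y (wy (x, y, z))) ->
  (forall x y z, der (fun z => w (x, y, z)) z (wz (x, y, z))) ->
  exists2 L : R, 0 < L & forall p, box3 B p -> `|w p - w 0| <= L * Num.sqrt (sqr3 p).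
Proof.
move=> cx cy cz dx dy dz.
have [L L0 hL] := @lipschitz2 (fun p => w (p, 0)) (fun p => wx (p, 0))
  (fun p => wy (p, 0)) B (continuous_slicel cx) (continuous_slicel cy)
  (fun x y => dx x y 0) (fun x y => dy x y 0).
have [N N0 hN] := continuous_bounded_on (@compact_box3 _ B) cz.
exists (L + N) => [|[p z] [/= pB zB]]; first exact: addr_gt0.
rewrite (_ : w (p, z) - w 0 = (w (p, z) - w (p, 0)) + (w (p, 0) - w (0, 0)));
  last by rewrite addrA subrK.
rewrite (le_trans (ler_normD _ _))// addrC mulrDl lerD//.
  apply: le_trans (hL _ pB) _; rewrite ler_pM2l// ler_wsqrtr//.
  by rewrite lerDl sqr_ge0.
case: p pB => x y pB.
apply: le_trans (@der_increment_le (fun z => w (x, y, z)) _ N B z _ _ zB) _.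
- by move=> t; exact: dz.
- by move=> t tB; exact: hN.
by rewrite ler_pM2l// norm_le_sqrt// lerDr sqr2_ge0.
Qed.

End coordinates.

(** * Fundamental solutions in the plane *)

Section plane.
Context {R : realType}.
Implicit Types (p : R * R) (B x y s : R).

(* Vanishing is only required on the boundary of the box [box2 B]. *)
Record planar_test B (psi px pxx py pyy : R * R -> R) : Prop := PlanarTest {
  pt_c : continuous psi;
  pt_cx : continuous px;
  pt_cxx : continuous pxx;
  pt_cy : continuous py;
  pt_cyy : continuous pyy;
  pt_dx : forall x y, der (fun x => psi (x, y)) x (px (x, y));
  pt_dxx : forall x y, der (fun x => px (x, y)) x (pxx (x, y));
  pt_dy : forall x y, der (fun y => psi (x, y)) y (py (x, y));
  pt_dyy : forall x y, der (fun y => py (x, y)) y (pyy (x, y));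
  pt_0x : forall e y, `|e| = B -> psi (e, y) = 0 /\ px (e, y) = 0;
  pt_0y : forall e x, `|e| = B -> psi (x, e) = 0 /\ py (x, e) = 0 }.

Lemma continuous_coord1 : continuous (fun p => p.1).
Proof. by move=> p; exact: cvg_fst. Qed.
Lemma continuous_coord2 : continuous (fun p => p.2).
Proof. by move=> p; exact: cvg_snd. Qed.

Lemma continuous_radial2 (U : R -> R) :
  (forall s, 0 <= s -> {for s, continuous U}) -> continuous (fun p => U (sqr2 p)).
Proof.
move=> cU; apply: continuous_comp_at; last exact: continuous_sqr2.
by move=> p; apply: cU; exact: sqr2_ge0.
Qed.

Lemma der_radial (U : R -> R) u c x : der U (x ^+ 2 + c) u ->
  der (fun x => U (x ^+ 2 + c)) x (2 * x * u).
Proof.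
move=> dU; apply: der_eq.
  apply: (@der_comp _ U (fun x => x ^+ 2 + c) x u _ dU).
  by apply: derD; [apply: derX2; exact: der_id|exact: der_cst].
by rewrite /=; ring.
Qed.

Lemma Rintegral_box2D B (f g : R * R -> R) : continuous f -> continuous g ->
  \int[lam2 R]_(p in box2 B) (f p + g p) =
  \int[lam2 R]_(p in box2 B) f p + \int[lam2 R]_(p in box2 B) g p.
Proof. by move=> cf cg; apply: RintegralD => //; exact: continuous_integrable2. Qed.

Lemma Rintegral_box1_0 B (f : R -> R) : (forall x, f x = 0) ->
  \int[lam R]_(x in box1 B) f x = 0.
Proof.
by move=> f0; under eq_Rintegral do rewrite f0; rewrite Rintegral_cst// mul0r.
Qed.

(** For [U] a function of [s = r^2] the planar Laplacian is [4 (s U'' + U')]. Each component of the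
    field [U grad psi - psi grad U] vanishes on the faces normal to its axis, so its derivative
    along that axis integrates to zero. *)
Lemma green2 B (U U1 U2 : R -> R) psi px pxx py pyy : 0 < B ->
  (forall s, 0 <= s -> der U s (U1 s)) -> (forall s, 0 <= s -> der U1 s (U2 s)) ->
  (forall s, 0 <= s -> {for s, continuous U2}) ->
  planar_test B psi px pxx py pyy ->
  \int[lam2 R]_(p in box2 B) (U (sqr2 p) * (pxx p + pyy p)) =
  \int[lam2 R]_(p in box2 B) ((4 * (sqr2 p * U2 (sqr2 p)) + 4 * U1 (sqr2 p)) * psi p).
Proof.
move=> B0 dU dU1 cU2 T.
have cU : continuous (fun p => U (sqr2 p)).
  by apply: continuous_radial2 => s s0; exact: der_continuous (dU s s0).
have cU1 : continuous (fun p => U1 (sqr2 p)).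
  by apply: continuous_radial2 => s s0; exact: der_continuous (dU1 s s0).
have {}cU2 : continuous (fun p => U2 (sqr2 p)) by exact: continuous_radial2.
have c1 := continuous_coord1; have c2 := continuous_coord2.
(* The second derivative of [U (r^2)] along the axis with coordinate [a]. *)
pose K (a : R) p := 4 * (a ^+ 2 * U2 (sqr2 p)) + 2 * U1 (sqr2 p).
pose fx p := U (sqr2 p) * pxx p - K p.1 p * psi p.
pose fy p := U (sqr2 p) * pyy p - K p.2 p * psi p.
have cf (a ppp : R * R -> R) : continuous a -> continuous ppp ->
    continuous (fun p => U (sqr2 p) * ppp p - K (a p) p * psi p).
  move=> ca cp; apply: continuous_sub; first exact: continuous_mul.
  apply: continuous_mul; last exact: pt_c T.
  apply: continuous_add; apply: continuous_mul => //; try exact: continuous_cst_fun.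
  by apply: continuous_mul => //; exact: continuous_sqr.
have cfx : continuous fx by apply: cf => //; exact: pt_cxx T.
have cfy : continuous fy by apply: cf => //; exact: pt_cyy T.
have Ix : \int[lam2 R]_(p in box2 B) fx p = 0.
  rewrite (@FTC_box2_first _ (fun p => U (sqr2 p) * px p
    - 2 * (p.1 * U1 (sqr2 p)) * psi p) fx B B0 cfx).
    apply: Rintegral_box1_0 => y.
    have [] := pt_0x T (e := B) y; first by rewrite gtr0_norm.
    have [] := pt_0x T (e := - B) y; first by rewrite normrN gtr0_norm.
    by move=> -> -> -> ->; rewrite !mulr0 !subrr.
  move=> x y; have s0 := sqr2_ge0 (x, y).
  apply: der_eq.
    apply: derB.
      apply: derM; first exact: der_radial (dU _ s0).
      exact: pt_dxx T x y.
    apply: derM; last exact: pt_dx T x y.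
    apply: derZ; apply: derM; first exact: der_id.
    exact: der_radial (dU1 _ s0).
  by rewrite /fx /K/=; ring.
have Iy : \int[lam2 R]_(p in box2 B) fy p = 0.
  rewrite (@FTC_box2_last _ (fun p => U (sqr2 p) * py p
    - 2 * (p.2 * U1 (sqr2 p)) * psi p) fy B B0 cfy).
    apply: Rintegral_box1_0 => x.
    have [] := pt_0y T (e := B) x; first by rewrite gtr0_norm.
    have [] := pt_0y T (e := - B) x; first by rewrite normrN gtr0_norm.
    by move=> -> -> -> ->; rewrite !mulr0 !subrr.
  move=> x y; have s0 := sqr2_ge0 (x, y).
  have sC u : sqr2 (x, u) = u ^+ 2 + x ^+ 2 by rewrite /sqr2 addrC.
  apply: der_eq.
    apply: derB.
      apply: derM.
        under eq_fun do rewrite sC.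
        by apply: der_radial; rewrite -sC; exact: dU.
      exact: pt_dyy T x y.
    apply: derM; last exact: pt_dy T x y.
    apply: derZ; apply: derM; first exact: der_id.
    under eq_fun do rewrite sC.
    by apply: der_radial; rewrite -sC; exact: dU1.
  by rewrite /fy /K/= !sC; ring.
apply/eqP; rewrite -subr_eq0 -RintegralB//; last 2 first.
- apply: continuous_integrable2; apply: continuous_mul => //.
  by apply: continuous_add; [exact: pt_cxx T|exact: pt_cyy T].
- apply: continuous_integrable2; apply: continuous_mul; last exact: pt_c T.
  apply: continuous_add; apply: continuous_mul => //; try exact: continuous_cst_fun.
  by apply: continuous_mul => //; exact: continuous_sqr2.
rewrite -[X in _ == X](addr0 0) -{1}Ix -Iy -Rintegral_box2D//.
apply/eqP; apply: eq_Rintegral => p _; rewrite /fx /fy /K /sqr2.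
ring.
Qed.

End plane.

(** * Limits of the regularized integrals in the plane *)

Section plane_limit.
Context {R : realType}.
Implicit Types (p : R * R) (B x y s : R).

(** [ln x < x] is used twice: at [w], and at [w^(-1/2)], where [ln w = - 2 ln (w^(-1/2))]. The
    second choice gives the power [1/r] that [dom2] controls. *)
Lemma abs_ln_le (w : R) : 0 < w -> `|ln w| <= w + 2 * (Num.sqrt w)^-1.
Proof.
move=> w0; have q0 : 0 < Num.sqrt w by rewrite sqrtr_gt0.
have qi : 0 < (Num.sqrt w)^-1 by rewrite invr_gt0.
rewrite ler_norml; apply/andP; split; last first.
  by apply: le_trans (ltW (ln_sublinear w0)) _; rewrite lerDl mulr_ge0 ?ltW.
have -> : ln w = - (2 * ln (Num.sqrt w)^-1).
  by rewrite lnV ?posrE// mulrN opprK mulr_natl -lnXn// sqr_sqrtr// ltW.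
rewrite lerN2; have := ln_sublinear qi; lra.
Qed.

Lemma continuous_der_pos (U : R -> R) c s : 0 < c -> 0 <= s ->
  (forall t, 0 < t -> {for t, continuous U}) -> {for s, continuous (fun s => U (s + c))}.
Proof.
move=> c0 s0 cU; apply: (@continuous_comp _ _ _ (fun s => s + c) U).
  by apply: cvgD; [exact: cvg_id|exact: cvg_cst].
by apply: cU; exact: ltr_wpDl.
Qed.

Lemma continuous_inv_pos (t : R) : 0 < t -> {for t, continuous (fun t : R => t^-1)}.
Proof.
move=> t0; apply: (@der_continuous _ _ t _).
by apply: (@derV _ (fun t => t)); [rewrite gt_eqF|exact: der_id].
Qed.

Lemma continuous_ln_pos (t : R) : 0 < t -> {for t, continuous (@ln R)}.
Proof.
move=> t0; apply: (@der_continuous _ _ t _).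
by apply: (@der_ln _ (fun t => t)) => //; exact: der_id.
Qed.

Lemma cvg_comp_regularized (U : R -> R) s : {for s, continuous U} ->
  U (s + eps n ^+ 2) @[n --> \oo] --> U s.
Proof.
move=> cU.
apply: (@continuous_cvg _ _ _ _ _ (fun n => s + eps n ^+ 2) U s cU); exact: cvg_regularized.
Qed.

Lemma continuous_regularized2 (U : R -> R) n :
  (forall t, 0 < t -> {for t, continuous U}) ->
  continuous (fun p => U (sqr2 p + eps n ^+ 2)).
Proof.
move=> cU; apply: (@continuous_radial2 _ (fun s => U (s + eps n ^+ 2))) => s s0.
by apply: continuous_der_pos => //; exact: eps2_gt0.
Qed.

(** The shape of all terms of the regularized planar identity other than the approximate identity;
    the factor of [b] lies in [[0, 1]] and tends to [1] off the origin. *)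
Lemma limit_log2 B (a b c : R * R -> R) : 0 < B ->
  continuous a -> continuous b -> continuous c ->
  \int[lam2 R]_(p in box2 B) (a p * ln (sqr2 p + eps n ^+ 2)
     + b p * (sqr2 p * (sqr2 p + eps n ^+ 2)^-1) + c p) @[n --> \oo] -->
  \int[lam2 R]_(p in box2 B) (a p * ln (sqr2 p) + b p + c p).
Proof.
move=> B0 ca cb cc.
have [Ma Ma0 hMa] := continuous_bounded_on (@compact_box2 _ B) ca.
have [Mb Mb0 hMb] := continuous_bounded_on (@compact_box2 _ B) cb.
have [Mc Mc0 hMc] := continuous_bounded_on (@compact_box2 _ B) cc.
(* On the box [r^2 <= 2 B^2] and [eps n ^+ 2 <= 1], so [2 B^2 + 1] bounds the linear term of
   [abs_ln_le]. *)
pose K := Ma * (2 * B ^+ 2 + 1) + Mb + Mc.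
apply: (@Rintegral_dominated_cvg _ _ _ (lam2 R) (box2 B) _ _
  (fun p => K + (2 * Ma) * dom2 p)) => //.
- move=> n; apply: continuous_measurable2.
  apply: continuous_add => //; apply: continuous_add; apply: continuous_mul => //.
    apply: continuous_regularized2; exact: continuous_ln_pos.
  apply: continuous_mul; first exact: continuous_sqr2.
  by apply: (@continuous_regularized2 (fun t => t^-1)); exact: continuous_inv_pos.
- apply: measurable_funD; last exact: continuous_measurable2.
  apply: measurable_funD; last exact: continuous_measurable2.
  apply: measurable_funM; first exact: continuous_measurable2.
  apply: measurableT_comp; first exact: measurable_ln.
  exact: (continuous_measurable2 (@continuous_sqr2 R)).
- apply: ae_lam2W => p p1 p2 _; have s0 := sqr2_gt0 p1.
  apply: cvgD; last exact: cvg_cst.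
  apply: cvgD.
    apply: cvgM; first exact: cvg_cst.
    by apply: cvg_comp_regularized; exact: continuous_ln_pos.
  rewrite -[X in _ --> X]mulr1; apply: cvgM; first exact: cvg_cst.
  rewrite -(divff (lt0r_neq0 s0)); apply: cvgM; first exact: cvg_cst.
  by apply: (@cvg_comp_regularized (fun t => t^-1)); exact: continuous_inv_pos.
- have -> : (EFin \o (fun p => K + 2 * Ma * dom2 p)) =
      (fun p => (EFin \o cst K) p + (2 * Ma)%:E * (EFin \o dom2) p)%E.
    by apply/funext => p /=; rewrite EFinD EFinM.
  apply: integrableD => //.
    by apply: (@continuous_integrable2 _ (cst K)); exact: continuous_cst_fun.
  by apply: integrableZl => //; exact: integrable_dom2.
- apply: ae_lam2W => p p1 p2 n pB; have s0 := sqr2_gt0 p1.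
  have w0 : 0 < sqr2 p + eps n ^+ 2 by rewrite addr_gt0// eps2_gt0.
  have e1 : (eps n : R) ^+ 2 <= 1 := eps2_le1 n.
  have qd : (Num.sqrt (sqr2 p + eps n ^+ 2))^-1 <= dom2 p.
    apply: le_trans (le_dom2 p1 p2).
    by rewrite lef_pV2 ?posrE ?sqrtr_gt0// ler_wsqrtr// lerDl ltW// eps2_gt0.
  rewrite (le_trans (ler_normD _ _))//.
  apply: le_trans (_ : Ma * (2 * B ^+ 2 + 1 + 2 * dom2 p) + Mb * 1 + Mc <= _); last first.
    by rewrite /K le_eqVlt; apply/orP; left; apply/eqP; ring.
  apply: lerD; last exact: hMc.
  rewrite (le_trans (ler_normD _ _))// !normrM; apply: lerD.
    apply: ler_pM => //; first exact: hMa.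
    apply: le_trans (abs_ln_le w0) _.
    by apply: lerD; [apply: lerD => //; exact: sqr2_box|rewrite ler_pM2l].
  apply: ler_pM; rewrite ?mulr_ge0//; first exact: hMb.
  rewrite -normrM ger0_norm; last by rewrite divr_ge0 ?ltW.
  by rewrite ler_pdivrMr// mul1r lerDl ltW// eps2_gt0.
Qed.

(** The Laplacian of [ln (r^2 + e^2)]. *)
Definition kernel2 (e : R) p : R := 4 * e ^+ 2 * ((sqr2 p + e ^+ 2) ^+ 2)^-1.

Lemma kernel2_ge0 e p : 0 <= kernel2 e p.
Proof. by rewrite mulr_ge0 ?invr_ge0 ?sqr_ge0// mulr_ge0 ?sqr_ge0. Qed.

Lemma continuous_kernel2 n : continuous (kernel2 (eps n)).
Proof.
apply: continuous_mul; first exact: continuous_cst_fun.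
apply: (@continuous_regularized2 (fun t => (t ^+ 2)^-1)) => t t0.
apply: (@der_continuous _ _ t _).
apply: derV; first by rewrite gt_eqF// exprn_gt0.
by apply: derX2; exact: der_id.
Qed.

(** With [W = r^2 + e^2], the kernel times [L r] equals [4 L / r] times [(e^2 / W) (r^2 / W)], two
    ratios at most [1]. Hence [4 L dom2] dominates, while off the origin the kernel tends to zero
    pointwise. *)
Lemma limit_kernel2 B L (w : R * R -> R) : 0 < B -> 0 < L -> continuous w ->
  (forall p, box2 B p -> `|w p - w 0| <= L * Num.sqrt (sqr2 p)) ->
  \int[lam2 R]_(p in box2 B) (kernel2 (eps n) p * (w p - w 0)) @[n --> \oo] --> (0 : R).
Proof.
move=> B0 L0 cw hw.
have -> : 0 = \int[lam2 R]_(p in box2 B) 0 :> R by rewrite Rintegral_cst// mul0r.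
have cd : continuous (fun p => w p - w 0).
  by apply: continuous_sub => //; exact: continuous_cst_fun.
apply: (@Rintegral_dominated_cvg _ _ _ (lam2 R) (box2 B) _ _ (fun p => (4 * L) * dom2 p)) => //.
- move=> n; apply: continuous_measurable2.
  by apply: continuous_mul => //; exact: continuous_kernel2.
- apply: ae_lam2W => p p1 p2 _; have s0 := sqr2_gt0 p1.
  rewrite -(mul0r (w p - w 0)); apply: cvgM; last exact: cvg_cst.
  rewrite -(mul0r ((sqr2 p ^+ 2)^-1)); apply: cvgM.
    rewrite -(mulr0 4); apply: cvgM; [exact: cvg_cst|exact: cvg_eps2].
  apply: (@cvg_comp_regularized (fun t => (t ^+ 2)^-1)).
  apply: (@der_continuous _ _ (sqr2 p) _).
  apply: derV; first by rewrite gt_eqF// exprn_gt0.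
  by apply: derX2; exact: der_id.
- have -> : (EFin \o (fun p => 4 * L * dom2 p)) =
      (fun p => (4 * L)%:E * (EFin \o dom2) p)%E.
    by apply/funext => p /=; rewrite EFinM.
  by apply: integrableZl => //; exact: integrable_dom2.
- apply: ae_lam2W => p p1 p2 n pB; have s0 := sqr2_gt0 p1.
  have e0 := @eps2_gt0 R n.
  have w0 : 0 < sqr2 p + eps n ^+ 2 by rewrite addr_gt0.
  have q0 : 0 < Num.sqrt (sqr2 p) by rewrite sqrtr_gt0.
  rewrite normrM; apply: le_trans (ler_wpM2l (normr_ge0 _) (hw _ pB)) _.
  rewrite (ger0_norm (kernel2_ge0 _ _)).
  apply: le_trans (_ : 4 * L * (Num.sqrt (sqr2 p))^-1 <= _); last first.
    by rewrite ler_pM2l ?mulr_gt0//; exact: le_dom2.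
  rewrite /kernel2; set W := sqr2 p + _ in w0 *; set q := Num.sqrt _ in q0 *.
  have qq : q ^+ 2 = sqr2 p by rewrite sqr_sqrtr// ltW.
  have -> : 4 * eps n ^+ 2 / W ^+ 2 * (L * q) =
      4 * L * q^-1 * ((eps n ^+ 2 / W) * (q ^+ 2 / W)).
    by field; rewrite !gt_eqF.
  rewrite ler_piMr//; first by rewrite ?mulr_ge0 ?invr_ge0 ?ltW.
  apply: mulr_ile1.
  - by apply: divr_ge0; [exact: sqr_ge0|exact: ltW].
  - by apply: divr_ge0; [exact: sqr_ge0|exact: ltW].
  - by rewrite ler_pdivrMr// mul1r /W lerDr ltW.
  - by rewrite ler_pdivrMr// mul1r qq /W lerDl ltW.
Qed.

(** The kernel is the divergence of [2 p / (r^2 + e^2)], the gradient of the regularized logarithm.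
    Its flux through two opposite sides is the integral of [4 B / (y^2 + q^2)] with
    [q^2 = B^2 + e^2], an arctangent; by symmetry the other pair gives the same. *)
Lemma mass_kernel2 B (e : R) : 0 < B -> 0 < e ->
  \int[lam2 R]_(p in box2 B) kernel2 e p =
  16 * B / Num.sqrt (B ^+ 2 + e ^+ 2) * atan (B / Num.sqrt (B ^+ 2 + e ^+ 2)).
Proof.
move=> B0 e0; have e20 : 0 < e ^+ 2 by rewrite exprn_gt0.
have w0 p : 0 < sqr2 p + e ^+ 2 by rewrite ltr_wpDl ?sqr2_ge0.
have cw : continuous (fun p => sqr2 p + e ^+ 2).
  by apply: continuous_add; [exact: continuous_sqr2|exact: continuous_cst_fun].
have ci : continuous (fun p => (sqr2 p + e ^+ 2)^-1).
  apply: (@continuous_comp_at _ _ (fun t => t^-1)) => // p; exact: continuous_inv_pos.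
(* The component of the field along the coordinate [c]; [f c] is its derivative in that
   coordinate. *)
pose F (c : R * R -> R) p := 2 * (c p * (sqr2 p + e ^+ 2)^-1).
pose f (c : R * R -> R) p :=
  2 * ((sqr2 p + e ^+ 2)^-1 - 2 * (c p * c p) * ((sqr2 p + e ^+ 2)^-1 * (sqr2 p + e ^+ 2)^-1)).
have cf c : continuous c -> continuous (f c).
  move=> cc; apply: continuous_mul; first exact: continuous_cst_fun.
  apply: continuous_sub => //; apply: continuous_mul; last exact: continuous_mul.
  by apply: continuous_mul; [exact: continuous_cst_fun|exact: continuous_mul].
have dF (y c x : R) : 0 < x ^+ 2 + c ->
    der (fun x => 2 * (x * (x ^+ 2 + c)^-1)) x
      (2 * ((x ^+ 2 + c)^-1 - 2 * (x * x) * ((x ^+ 2 + c)^-1 * (x ^+ 2 + c)^-1))).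
  move=> xc0; apply: der_eq.
    apply: derZ; apply: derM; first exact: der_id.
    apply: derV; first by rewrite gt_eqF.
    by apply: derD; [apply: derX2; exact: der_id|exact: der_cst].
  by rewrite /=; field; rewrite gt_eqF.
set q := Num.sqrt _.
have q0 : 0 < q by rewrite sqrtr_gt0 addr_gt0// exprn_gt0.
have q2 : q ^+ 2 = B ^+ 2 + e ^+ 2 by rewrite sqr_sqrtr// ltW// addr_gt0// exprn_gt0.
have face (g : R -> R) : (forall y, g y = 4 * B * (y ^+ 2 + q ^+ 2)^-1) ->
    \int[lam R]_(y in box1 B) g y = 8 * B / q * atan (B / q).
  move=> gE; have yq y : 0 < y ^+ 2 + q ^+ 2 by rewrite ltr_wpDl ?sqr_ge0 ?exprn_gt0.
  have -> : g = (fun y => 4 * B * (y ^+ 2 + q ^+ 2)^-1) by exact/funext.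
  rewrite (@FTC_box1 _ (fun y => 4 * B / q * atan (q^-1 * y))) //.
  - by rewrite mulrN atanN [q^-1 * B]mulrC; ring.
  - move=> y; apply: cvgM; first exact: cvg_cst.
    apply: (@der_continuous _ _ y _); apply: derV; first by rewrite gt_eqF.
    by apply: derD; [apply: derX2; exact: der_id|exact: der_cst].
  move=> y; apply: der_eq.
    apply: derZ; apply: (@der_comp _ atan (fun y => q^-1 * y)).
      exact: is_derive1_atan.
    by apply: derZ; exact: der_id.
  have := yq y => yqy; rewrite /=; field.
  by rewrite !gt_eqF.
have Ix : \int[lam2 R]_(p in box2 B) f (fun p => p.1) p = 8 * B / q * atan (B / q).
  rewrite (@FTC_box2_first _ (F (fun p => p.1)) _ B B0 (cf _ continuous_coord1)).
    apply: face => y; rewrite /F /sqr2/= sqrrN q2.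
    by rewrite (_ : B ^+ 2 + y ^+ 2 + e ^+ 2 = y ^+ 2 + (B ^+ 2 + e ^+ 2)); ring.
  move=> x y; rewrite /F /f /sqr2/=; under eq_fun do rewrite -addrA.
  rewrite -addrA; apply: dF => //; rewrite ltr_wpDl ?sqr_ge0// ltr_wpDl ?sqr_ge0//.
have Iy : \int[lam2 R]_(p in box2 B) f (fun p => p.2) p = 8 * B / q * atan (B / q).
  rewrite (@FTC_box2_last _ (F (fun p => p.2)) _ B B0 (cf _ continuous_coord2)).
    apply: face => x; rewrite /F /sqr2/= sqrrN q2.
    by rewrite -addrA; ring.
  move=> x y; rewrite /F /f /sqr2/=; under eq_fun do rewrite [x ^+ 2 + _]addrC -addrA.
  rewrite [x ^+ 2 + _]addrC -addrA.
  by apply: dF => //; rewrite ltr_wpDl ?sqr_ge0// ltr_wpDl ?sqr_ge0//.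
transitivity (\int[lam2 R]_(p in box2 B) (f (fun p => p.1) p + f (fun p => p.2) p)).
  apply: eq_Rintegral => p _; rewrite /kernel2 /f.
  have := w0 p; rewrite /sqr2 => wp; field; by rewrite gt_eqF.
rewrite Rintegral_box2D; [|exact/cf/continuous_coord1|exact/cf/continuous_coord2].
by rewrite Ix Iy; ring.
Qed.

Lemma cvg_mass_kernel2 B : 0 < B ->
  \int[lam2 R]_(p in box2 B) kernel2 (eps n) p @[n --> \oo] --> (4 * pi : R).
Proof.
move=> B0; have B20 : 0 < B ^+ 2 by rewrite exprn_gt0.
under eq_fun do rewrite mass_kernel2 ?eps_gt0//.
(* The mass as a function of [t = B^2 + e^2]; at [t = B^2] it is [16 atan 1 = 4 pi]. *)
pose U (t : R) := 16 * B * (Num.sqrt t)^-1 * atan (B * (Num.sqrt t)^-1).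
have sB : Num.sqrt (B ^+ 2) = B by rewrite sqrtr_sqr gtr0_norm.
have -> : 4 * pi = U (B ^+ 2).
  by rewrite /U sB -(mulrA 16) divff ?gt_eqF// mulr1 atan1; field.
apply: (@cvg_comp_regularized U); apply: (@der_continuous _ _ (B ^+ 2) _).
have dv : der (fun t => (Num.sqrt t)^-1) (B ^+ 2) (- (1 / (2 * B)) / B ^+ 2).
  rewrite -{2 3}sB; apply: derV; first by rewrite sB gt_eqF.
  by apply: (@der_sqrt _ (fun t => t)) => //; exact: der_id.
apply: derM; first exact: derZ dv.
apply: (@der_comp _ atan (fun t => B * (Num.sqrt t)^-1)).
  exact: is_derive1_atan.
exact: derZ dv.
Qed.

End plane_limit.

Lemma cvg_seq_eq (R : realType) (u v : nat -> R) (l m : R) :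
  u @ \oo --> l -> u =1 v -> l = m -> v @ \oo --> m.
Proof. by move=> h /funext <- <-. Qed.

Lemma cvg_seq_unique (R : realType) (u : nat -> R) (l m : R) :
  u @ \oo --> l -> u @ \oo --> m -> l = m.
Proof. by move=> ul um; rewrite -(cvg_lim _ ul)// -(cvg_lim _ um). Qed.

(** * The distributional Laplacian of a logarithmic singularity *)

Section plane_fundamental.
Context {R : realType}.
Implicit Types (p : R * R) (B x y s : R).

Lemma der_radial2 (U : R -> R) u : (forall s, der U s (u s)) ->
  (forall x y, der (fun x => U (sqr2 (x, y))) x (2 * x * u (sqr2 (x, y)))) /\
  (forall x y, der (fun y => U (sqr2 (x, y))) y (2 * y * u (sqr2 (x, y)))).
Proof.
move=> dU; split => x y; rewrite /sqr2/=; first exact: der_radial.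
under eq_fun do rewrite addrC.
by rewrite addrC; exact: der_radial.
Qed.

(** Only the logarithm is regularized. With [w = s + e^2], the Laplacian [4 (s U'' + U')] of
    [f ln w + g] contains the cross term [8 f' s / w], which tends to [8 f'], and
    [4 f (1 / w - s / w^2) = f kernel2], which produces the point mass [4 pi f(0)]. *)
Lemma fundamental2 B (f f1 f2 g g1 g2 : R -> R) psi px pxx py pyy : 0 < B ->
  (forall s, der f s (f1 s)) -> (forall s, der f1 s (f2 s)) -> continuous f2 ->
  (forall s, der g s (g1 s)) -> (forall s, der g1 s (g2 s)) -> continuous g2 ->
  planar_test B psi px pxx py pyy ->
  \int[lam2 R]_(p in box2 B)
    ((f (sqr2 p) * ln (sqr2 p) + g (sqr2 p)) * (pxx p + pyy p)) =
  \int[lam2 R]_(p in box2 B)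
    ((4 * (sqr2 p * f2 (sqr2 p) + f1 (sqr2 p)) * ln (sqr2 p) +
      8 * f1 (sqr2 p) + 4 * (sqr2 p * g2 (sqr2 p) + g1 (sqr2 p))) * psi p)
  + 4 * pi * (f 0 * psi 0).
Proof.
move=> B0 df df1 cf2 dg dg1 cg2 T.
have cf := der_continuousT df; have cf1 := der_continuousT df1.
have cg := der_continuousT dg; have cg1 := der_continuousT dg1.
have rad (h : R -> R) : continuous h -> continuous (fun p => h (sqr2 p)).
  by move=> ch; apply: continuous_radial2 => s _; exact: ch.
have cs := @continuous_sqr2 R.
have cc (c : R) := @continuous_cst_fun R (R * R)%type c.
have cpsi := pt_c T.
have cL : continuous (fun p => pxx p + pyy p).
  by apply: continuous_add; [exact: pt_cxx T|exact: pt_cyy T].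
pose w p := f (sqr2 p) * psi p.
have w0 : w 0 = f 0 * psi 0 by rewrite /w /sqr2/= expr0n/= addr0.
have cw : continuous w by apply: continuous_mul => //; exact: rad.
pose a p := 4 * (sqr2 p * f2 (sqr2 p) + f1 (sqr2 p)) * psi p.
pose b p := 8 * f1 (sqr2 p) * psi p.
pose c p := 4 * (sqr2 p * g2 (sqr2 p) + g1 (sqr2 p)) * psi p.
have ca : continuous a.
  apply: continuous_mul => //; apply: continuous_mul => //.
  apply: continuous_add; last exact: rad.
  by apply: continuous_mul => //; exact: rad.
have cb : continuous b.
  by apply: continuous_mul => //; apply: continuous_mul => //; exact: rad.
have cc' : continuous c.
  apply: continuous_mul => //; apply: continuous_mul => //.
  apply: continuous_add; last exact: rad.
  by apply: continuous_mul => //; exact: rad.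
have [dfx dfy] := der_radial2 df.
have [||||L L0 hL] := @lipschitz2 _ w
  (fun p => 2 * p.1 * f1 (sqr2 p) * psi p + f (sqr2 p) * px p)
  (fun p => 2 * p.2 * f1 (sqr2 p) * psi p + f (sqr2 p) * py p) B.
- apply: continuous_add; apply: continuous_mul => //; try exact: rad.
    apply: continuous_mul; last exact: rad.
    by apply: continuous_mul => //; exact: continuous_coord1.
  exact: pt_cx T.
- apply: continuous_add; apply: continuous_mul => //; try exact: rad.
    apply: continuous_mul; last exact: rad.
    by apply: continuous_mul => //; exact: continuous_coord2.
  exact: pt_cy T.
- by move=> x y; apply: derM; [exact: dfx|exact: pt_dx T x y].
- by move=> x y; apply: derM; [exact: dfy|exact: pt_dy T x y].
pose w2 n s := s + eps n ^+ 2 : R.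
pose U n s := f s * ln (w2 n s) + g s.
pose U1 n s := f1 s * ln (w2 n s) + f s * (w2 n s)^-1 + g1 s.
pose U2 n s := f2 s * ln (w2 n s) + 2 * (f1 s * (w2 n s)^-1)
  - f s * ((w2 n s) ^+ 2)^-1 + g2 s.
have w20 n s : 0 <= s -> 0 < w2 n s.
  by move=> s0; rewrite ltr_wpDl// eps2_gt0.
have dw2 n s : der (w2 n) s 1.
  apply: der_eq; last exact: addr0.
  by apply: derD; [exact: der_id|exact: der_cst].
have dln n s : 0 <= s -> der (fun s => ln (w2 n s)) s (1 / w2 n s).
  by move=> s0; apply: der_ln; [exact: w20|exact: dw2].
have dinv n s : 0 <= s -> der (fun s => (w2 n s)^-1) s (- 1 / w2 n s ^+ 2).
  by move=> s0; apply: derV; [rewrite gt_eqF// w20|exact: dw2].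
have dU n s : 0 <= s -> der (U n) s (U1 n s).
  move=> s0; apply: der_eq.
    by apply: derD; last exact: dg; apply: derM; [exact: df|exact: dln].
  by rewrite /U1 mul1r.
have dU1 n s : 0 <= s -> der (U1 n) s (U2 n s).
  move=> s0; apply: der_eq.
    apply: derD; last exact: dg1.
    by apply: derD; apply: derM; [exact: df1|exact: dln|exact: df|exact: dinv].
  by rewrite /U2; ring.
have cU2 n s : 0 <= s -> {for s, continuous (U2 n)}.
  move=> s0; have w0s := w20 n s s0.
  have cln : {for s, continuous (fun s => ln (w2 n s))} := der_continuous (dln n s s0).
  have cin : {for s, continuous (fun s => (w2 n s)^-1)} := der_continuous (dinv n s s0).
  have cin2 : {for s, continuous (fun s => ((w2 n s) ^+ 2)^-1)}.
    apply: (@der_continuous _ _ s _); apply: derV.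
      by rewrite gt_eqF// exprn_gt0.
    exact: derX2 (dw2 n s).
  apply: cvgD; last exact: cg2.
  apply: cvgB; last by apply: cvgM; [exact: cf|exact: cin2].
  apply: cvgD; first by apply: cvgM; [exact: cf2|exact: cln].
  by apply: cvgM; [exact: cvg_cst|apply: cvgM; [exact: cf1|exact: cin]].
have ck := @continuous_kernel2 R.
(* The three integrals match [limit_log2], [limit_kernel2] and [cvg_mass_kernel2]: the function
   multiplying the kernel is split into its value at the origin and an increment. *)
have GE n : \int[lam2 R]_(p in box2 B) (U n (sqr2 p) * (pxx p + pyy p)) =
    \int[lam2 R]_(p in box2 B) (a p * ln (w2 n (sqr2 p)) +
       b p * (sqr2 p * (w2 n (sqr2 p))^-1) + c p)
    + \int[lam2 R]_(p in box2 B) (kernel2 (eps n) p * (w p - w 0))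
    + \int[lam2 R]_(p in box2 B) kernel2 (eps n) p * (f 0 * psi 0).
  rewrite (green2 B0 (dU n) (dU1 n) (cU2 n) T).
  rewrite -RintegralZr//; last exact: continuous_integrable2.
  have cA : continuous (fun p => a p * ln (w2 n (sqr2 p)) +
       b p * (sqr2 p * (w2 n (sqr2 p))^-1) + c p).
    apply: continuous_add => //; apply: continuous_add; apply: continuous_mul => //.
      by apply: (@continuous_regularized2 _ (@ln R)) => t; exact: continuous_ln_pos.
    apply: continuous_mul => //.
    by apply: (@continuous_regularized2 _ (fun t => t^-1)) => t; exact: continuous_inv_pos.
  have cK : continuous (fun p => kernel2 (eps n) p * (w p - w 0)).
    by apply: continuous_mul => //; exact: continuous_sub.
  rewrite -!Rintegral_box2D//; last 2 first.
  - exact: continuous_add.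
  - exact: continuous_mul.
  apply: eq_Rintegral => p _.
  have := w20 n (sqr2 p) (sqr2_ge0 p).
  rewrite w0 /U1 /U2 /a /b /c /w /kernel2.
  (* Eliminating [eps n] leaves a rational identity in [W] and [r^2] as independent quantities. *)
  rewrite -/(w2 n (sqr2 p)) (_ : eps n ^+ 2 = w2 n (sqr2 p) - sqr2 p); last first.
    by rewrite /w2 addrC addKr.
  move: (w2 n (sqr2 p)) => W W0.
  by field; rewrite gt_eqF.
have lhs : \int[lam2 R]_(p in box2 B) (U n (sqr2 p) * (pxx p + pyy p)) @[n --> \oo] -->
    \int[lam2 R]_(p in box2 B)
      ((f (sqr2 p) * ln (sqr2 p) + g (sqr2 p)) * (pxx p + pyy p)).
  have := @limit_log2 R B (fun p => f (sqr2 p) * (pxx p + pyy p)) (fun=> 0)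
    (fun p => g (sqr2 p) * (pxx p + pyy p)) B0.
  have h1 : continuous (fun p => f (sqr2 p) * (pxx p + pyy p)).
    by apply: continuous_mul => //; exact: rad.
  have h2 : continuous (fun p => g (sqr2 p) * (pxx p + pyy p)).
    by apply: continuous_mul => //; exact: rad.
  move=> /(_ h1 (cc 0) h2) /cvg_seq_eq; apply => [n|].
    by apply: eq_Rintegral => p _; rewrite /U /w2; ring.
  by apply: eq_Rintegral => p _; ring.
have rhs : \int[lam2 R]_(p in box2 B) (U n (sqr2 p) * (pxx p + pyy p)) @[n --> \oo] -->
    \int[lam2 R]_(p in box2 B) (a p * ln (sqr2 p) + b p + c p) + 0 +
    4 * pi * (f 0 * psi 0).
  under eq_fun do rewrite GE.
  apply: cvgD; last by apply: cvgM; [exact: cvg_mass_kernel2|exact: cvg_cst].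
  apply: cvgD; first exact: limit_log2.
  exact: limit_kernel2 hL.
rewrite (cvg_seq_unique lhs rhs) addr0; congr (_ + _).
by apply: eq_Rintegral => p _; rewrite /a /b /c; ring.
Qed.

End plane_fundamental.

(** * Fundamental solutions in space *)

Section space.
Context {R : realType}.
Implicit Types (p : R * R * R) (B x y z s : R).

Record spatial_test B (psi px pxx py pyy pz pzz : R * R * R -> R) : Prop :=
  SpatialTest {
  st_c : continuous psi;
  st_cx : continuous px;
  st_cxx : continuous pxx;
  st_cy : continuous py;
  st_cyy : continuous pyy;
  st_cz : continuous pz;
  st_czz : continuous pzz;
  st_dx : forall x y z, der (fun x => psi (x, y, z)) x (px (x, y, z));
  st_dxx : forall x y z, der (fun x => px (x, y, z)) x (pxx (x, y, z));
  st_dy : forall x y z, der (fun y => psi (x, y, z)) y (py (x, y, z));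
  st_dyy : forall x y z, der (fun y => py (x, y, z)) y (pyy (x, y, z));
  st_dz : forall x y z, der (fun z => psi (x, y, z)) z (pz (x, y, z));
  st_dzz : forall x y z, der (fun z => pz (x, y, z)) z (pzz (x, y, z));
  st_0x : forall e y z, `|e| = B -> psi (e, y, z) = 0 /\ px (e, y, z) = 0;
  st_0y : forall e x z, `|e| = B -> psi (x, e, z) = 0 /\ py (x, e, z) = 0;
  st_0z : forall e x y, `|e| = B -> psi (x, y, e) = 0 /\ pz (x, y, e) = 0 }.

Lemma continuous_coord31 : continuous (fun p => p.1.1).
Proof. by move=> p; apply: continuous_comp; exact: cvg_fst. Qed.
Lemma continuous_coord32 : continuous (fun p => p.1.2).
Proof. by move=> p; apply: continuous_comp; [exact: cvg_fst|exact: cvg_snd]. Qed.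
Lemma continuous_coord33 : continuous (fun p => p.2).
Proof. by move=> p; exact: cvg_snd. Qed.

Lemma continuous_radial3 (U : R -> R) :
  (forall s, 0 <= s -> {for s, continuous U}) -> continuous (fun p => U (sqr3 p)).
Proof.
move=> cU; apply: continuous_comp_at; last exact: continuous_sqr3.
by move=> p; apply: cU; exact: sqr3_ge0.
Qed.

Lemma Rintegral_box3D B (f g : R * R * R -> R) : continuous f -> continuous g ->
  \int[lam3 R]_(p in box3 B) (f p + g p) =
  \int[lam3 R]_(p in box3 B) f p + \int[lam3 R]_(p in box3 B) g p.
Proof. by move=> cf cg; apply: RintegralD => //; exact: continuous_integrable3. Qed.

Lemma Rintegral_box2_0 B (f : R * R -> R) : (forall a, f a = 0) ->
  \int[lam2 R]_(a in box2 B) f a = 0.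
Proof.
by move=> f0; under eq_Rintegral do rewrite f0; rewrite Rintegral_cst// mul0r.
Qed.

Lemma sqr3x x y z : sqr3 (x, y, z) = x ^+ 2 + (y ^+ 2 + z ^+ 2).
Proof. by rewrite /sqr3 /sqr2/= addrA. Qed.
Lemma sqr3y x y z : sqr3 (x, y, z) = y ^+ 2 + (x ^+ 2 + z ^+ 2).
Proof. by rewrite sqr3x addrCA. Qed.
Lemma sqr3z x y z : sqr3 (x, y, z) = z ^+ 2 + (x ^+ 2 + y ^+ 2).
Proof. by rewrite sqr3x addrA addrC. Qed.

(** As in the plane, with the spatial Laplacian [4 s U'' + 6 U'] of a function of [s = r^2]: each of
    the three axes contributes [2 U']. *)
Lemma green3 B (U U1 U2 : R -> R) psi px pxx py pyy pz pzz : 0 < B ->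
  (forall s, 0 <= s -> der U s (U1 s)) -> (forall s, 0 <= s -> der U1 s (U2 s)) ->
  (forall s, 0 <= s -> {for s, continuous U2}) ->
  spatial_test B psi px pxx py pyy pz pzz ->
  \int[lam3 R]_(p in box3 B) (U (sqr3 p) * (pxx p + pyy p + pzz p)) =
  \int[lam3 R]_(p in box3 B) ((4 * (sqr3 p * U2 (sqr3 p)) + 6 * U1 (sqr3 p)) * psi p).
Proof.
move=> B0 dU dU1 cU2 T.
have cU : continuous (fun p => U (sqr3 p)).
  by apply: continuous_radial3 => s s0; exact: der_continuous (dU s s0).
have cU1 : continuous (fun p => U1 (sqr3 p)).
  by apply: continuous_radial3 => s s0; exact: der_continuous (dU1 s s0).
have {}cU2 : continuous (fun p => U2 (sqr3 p)) by exact: continuous_radial3.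
have c1 := continuous_coord31; have c2 := continuous_coord32.
have c3 := continuous_coord33.
pose K (a : R) p := 4 * (a ^+ 2 * U2 (sqr3 p)) + 2 * U1 (sqr3 p).
pose fx p := U (sqr3 p) * pxx p - K p.1.1 p * psi p.
pose fy p := U (sqr3 p) * pyy p - K p.1.2 p * psi p.
pose fz p := U (sqr3 p) * pzz p - K p.2 p * psi p.
have cf (a ppp : R * R * R -> R) : continuous a -> continuous ppp ->
    continuous (fun p => U (sqr3 p) * ppp p - K (a p) p * psi p).
  move=> ca cp; apply: continuous_sub; first exact: continuous_mul.
  apply: continuous_mul; last exact: st_c T.
  apply: continuous_add; apply: continuous_mul => //; try exact: continuous_cst_fun.
  by apply: continuous_mul => //; exact: continuous_sqr.
have cfx : continuous fx by apply: cf => //; exact: st_cxx T.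
have cfy : continuous fy by apply: cf => //; exact: st_cyy T.
have cfz : continuous fz by apply: cf => //; exact: st_czz T.
have Ix : \int[lam3 R]_(p in box3 B) fx p = 0.
  rewrite (@FTC_box3_first _ (fun p => U (sqr3 p) * px p
    - 2 * (p.1.1 * U1 (sqr3 p)) * psi p) fx B B0 cfx).
    apply: Rintegral_box1_0 => z; apply: Rintegral_box1_0 => y.
    have [] := st_0x T (e := B) y z; first by rewrite gtr0_norm.
    have [] := st_0x T (e := - B) y z; first by rewrite normrN gtr0_norm.
    by move=> -> -> -> ->; rewrite !mulr0 !subrr.
  move=> x y z; have s0 := sqr3_ge0 (x, y, z).
  apply: der_eq.
    apply: derB.
      apply: derM.
        under eq_fun do rewrite sqr3x.
        by apply: der_radial; rewrite -sqr3x; exact: dU.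
      exact: st_dxx T x y z.
    apply: derM; last exact: st_dx T x y z.
    apply: derZ; apply: derM; first exact: der_id.
    under eq_fun do rewrite sqr3x.
    by apply: der_radial; rewrite -sqr3x; exact: dU1.
  by rewrite /fx /K/= !sqr3x; ring.
have Iy : \int[lam3 R]_(p in box3 B) fy p = 0.
  rewrite (@FTC_box3_mid _ (fun p => U (sqr3 p) * py p
    - 2 * (p.1.2 * U1 (sqr3 p)) * psi p) fy B B0 cfy).
    apply: Rintegral_box1_0 => z; apply: Rintegral_box1_0 => x.
    have [] := st_0y T (e := B) x z; first by rewrite gtr0_norm.
    have [] := st_0y T (e := - B) x z; first by rewrite normrN gtr0_norm.
    by move=> -> -> -> ->; rewrite !mulr0 !subrr.
  move=> x y z; have s0 := sqr3_ge0 (x, y, z).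
  apply: der_eq.
    apply: derB.
      apply: derM.
        under eq_fun do rewrite sqr3y.
        by apply: der_radial; rewrite -sqr3y; exact: dU.
      exact: st_dyy T x y z.
    apply: derM; last exact: st_dy T x y z.
    apply: derZ; apply: derM; first exact: der_id.
    under eq_fun do rewrite sqr3y.
    by apply: der_radial; rewrite -sqr3y; exact: dU1.
  by rewrite /fy /K/= !sqr3y; ring.
have Iz : \int[lam3 R]_(p in box3 B) fz p = 0.
  rewrite (@FTC_box3_last _ (fun p => U (sqr3 p) * pz p
    - 2 * (p.2 * U1 (sqr3 p)) * psi p) fz B B0 cfz).
    apply: Rintegral_box2_0 => -[x y].
    have [] := st_0z T (e := B) x y; first by rewrite gtr0_norm.
    have [] := st_0z T (e := - B) x y; first by rewrite normrN gtr0_norm.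
    by move=> -> -> -> ->; rewrite !mulr0 !subrr.
  move=> [x y] z; have s0 := sqr3_ge0 (x, y, z).
  apply: der_eq.
    apply: derB.
      apply: derM.
        under eq_fun do rewrite sqr3z.
        by apply: der_radial; rewrite -sqr3z; exact: dU.
      exact: st_dzz T x y z.
    apply: derM; last exact: st_dz T x y z.
    apply: derZ; apply: derM; first exact: der_id.
    under eq_fun do rewrite sqr3z.
    by apply: der_radial; rewrite -sqr3z; exact: dU1.
  by rewrite /fz /K/= !sqr3z; ring.
have cpsi := st_c T.
apply/eqP; rewrite -subr_eq0 -RintegralB//; last 2 first.
- apply: continuous_integrable3; apply: continuous_mul => //.
  by apply: continuous_add; [apply: continuous_add;
    [exact: st_cxx T|exact: st_cyy T]|exact: st_czz T].
- apply: continuous_integrable3; apply: continuous_mul => //.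
  apply: continuous_add; apply: continuous_mul => //; try exact: continuous_cst_fun.
  by apply: continuous_mul => //; exact: continuous_sqr3.
have <- : \int[lam3 R]_(p in box3 B) (fx p + fy p + fz p) = 0.
  rewrite Rintegral_box3D//; last exact: continuous_add.
  by rewrite Rintegral_box3D// Ix Iy Iz !addr0.
apply/eqP; apply: eq_Rintegral => p _; rewrite /fx /fy /fz /K /sqr3 /sqr2.
ring.
Qed.

(** With [t = pi / 6], [cos (3 t) = 0] and [cos t > 0] force [4 cos(t)^2 = 3]. The value occurs as a
    sixth of the solid-angle computation for the cube. *)
Lemma atan_invsqrt3 : atan (Num.sqrt 3)^-1 = pi / 6 :> R.
Proof.
have p0 := @pi_gt0 R.
set t := pi / 6 : R.
have t0 : 0 < t by rewrite divr_gt0.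
have t2 : t < pi / 2 by rewrite /t; lra.
have tpi : t < pi by rewrite /t; lra.
have c0 : 0 < cos t by apply: cos_gt0_pihalf; rewrite t2 andbT; lra.
have s0 : 0 < sin t by apply: sin_gt0_pi; rewrite t0.
have c3 : cos (t + t + t) = 0.
  by rewrite (_ : t + t + t = pi / 2) ?cos_pihalf// /t; field.
have cs := cos2Dsin2 t.
have h : cos t * (4 * cos t ^+ 2 - 3) = 0.
  rewrite -c3 !cosD sinD.
  have -> : sin t * sin t = 1 - cos t ^+ 2 by rewrite -cs; ring.
  rewrite (_ : (sin t * cos t + cos t * sin t) * sin t
    = 2 * cos t * (sin t ^+ 2)); last by ring.
  rewrite (_ : sin t ^+ 2 = 1 - cos t ^+ 2); last by rewrite -cs; ring.
  by ring.
move/eqP: h; rewrite mulf_eq0 gt_eqF//= subr_eq0 => /eqP c2.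
have s2 : 4 * sin t ^+ 2 = 1.
  rewrite (_ : sin t ^+ 2 = 1 - cos t ^+ 2); last by rewrite -cs; ring.
  by rewrite mulrBr c2; ring.
have tt : tan t = (Num.sqrt 3)^-1.
  rewrite /tan; apply: (@pexpIrn _ 2) => //.
  - by rewrite nnegrE divr_ge0 ?ltW.
  - by rewrite nnegrE invr_ge0 sqrtr_ge0.
  rewrite exprMn !exprVn sqr_sqrtr// -c2.
  have -> : sin t ^+ 2 = 4^-1 by lra.
  by field; rewrite gt_eqF.
by rewrite -tt tanK// in_itv/=; apply/andP; split => //; lra.
Qed.

(** [3 e^2 (r^2 + e^2)^(-5/2)], minus the Laplacian of [(r^2 + e^2)^(-1/2)]. *)
Definition kernel3 (e : R) p : R :=
  3 * e ^+ 2 * (Num.sqrt (sqr3 p + e ^+ 2) * (sqr3 p + e ^+ 2) ^+ 2)^-1.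

(** The kernel is the divergence of [p (r^2 + e^2)^(-3/2)], so its mass is a flux through three
    pairs of opposite faces, equal by symmetry. On a face both integrations are elementary. *)
Lemma mass_kernel3 B (e : R) : 0 < B -> 0 < e ->
  let q := Num.sqrt (B ^+ 2 + e ^+ 2) in
  \int[lam3 R]_(p in box3 B) kernel3 e p =
  24 * B / q * atan (B ^+ 2 / (q * Num.sqrt (3 * B ^+ 2 + e ^+ 2))).
Proof.
move=> B0 e0 q; have e20 : 0 < e ^+ 2 by rewrite exprn_gt0.
have B20 : 0 < B ^+ 2 by rewrite exprn_gt0.
have w0 p : 0 < sqr3 p + e ^+ 2 by rewrite ltr_wpDl ?sqr3_ge0.
have cw : continuous (fun p => sqr3 p + e ^+ 2).
  by apply: continuous_add; [exact: continuous_sqr3|exact: continuous_cst_fun].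
pose r1 t : R := (Num.sqrt t * t)^-1.
pose r2 t : R := (Num.sqrt t * t ^+ 2)^-1.
have dr1 t : 0 < t -> der r1 t (- (3 / 2) * r2 t).
  move=> t0; have q0 : 0 < Num.sqrt t by rewrite sqrtr_gt0.
  apply: der_eq.
    apply: derV; first by rewrite gt_eqF// mulr_gt0.
    apply: derM; last exact: der_id.
    by apply: (@der_sqrt _ (fun t => t)); [exact: t0|exact: der_id].
  rewrite /r2 /=; have tE : t = Num.sqrt t ^+ 2 by rewrite sqr_sqrtr// ltW.
  move: (Num.sqrt t) q0 tE => v v0 ->; field; rewrite gt_eqF//=.
have cr1 : continuous (fun p => r1 (sqr3 p + e ^+ 2)).
  apply: continuous_comp_at => // p; exact: der_continuous (dr1 _ (w0 p)).
have cr2 : continuous (fun p => r2 (sqr3 p + e ^+ 2)).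
  apply: (@continuous_comp_at _ _ r2) => // p.
  apply: (@der_continuous _ _ (sqr3 p + e ^+ 2) _); apply: derV.
    by rewrite gt_eqF// mulr_gt0 ?exprn_gt0 ?sqrtr_gt0.
  apply: derM; last by apply: derX2; exact: der_id.
  by apply: (@der_sqrt _ (fun t => t)) => //; exact: der_id.
pose F (c : R * R * R -> R) p := c p * r1 (sqr3 p + e ^+ 2).
pose f (c : R * R * R -> R) p :=
  r1 (sqr3 p + e ^+ 2) - 3 * (c p * c p) * r2 (sqr3 p + e ^+ 2).
have cf c : continuous c -> continuous (f c).
  move=> cc; apply: continuous_sub => //; apply: continuous_mul => //.
  by apply: continuous_mul; [exact: continuous_cst_fun|exact: continuous_mul].
have dF (c x : R) : 0 < x ^+ 2 + c + e ^+ 2 ->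
    der (fun x => x * r1 (x ^+ 2 + c + e ^+ 2)) x
      (r1 (x ^+ 2 + c + e ^+ 2) - 3 * (x * x) * r2 (x ^+ 2 + c + e ^+ 2)).
  under eq_fun do rewrite -addrA.
  rewrite -addrA => xc0; apply: der_eq.
    by apply: derM; [exact: der_id|apply: der_radial; exact: dr1].
  by rewrite /=; field.
have q0 : 0 < q by rewrite sqrtr_gt0 addr_gt0.
have q2 : q ^+ 2 = B ^+ 2 + e ^+ 2 by rewrite sqr_sqrtr// ltW// addr_gt0.
set at_ := atan _.
(* The flux through one pair of faces, in the two remaining coordinates. *)
have face (g : R -> R -> R) :
    (forall y z, g y z = 2 * B * r1 (y ^+ 2 + (z ^+ 2 + q ^+ 2))) ->
    \int[lam R]_(z in box1 B) \int[lam R]_(y in box1 B) g y z = 8 * B / q * at_.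
  move=> gE.
  have c0 z : 0 < z ^+ 2 + q ^+ 2 by rewrite ltr_wpDl ?sqr_ge0 ?exprn_gt0.
  have inner z : \int[lam R]_(y in box1 B) g y z =
      4 * B ^+ 2 * ((z ^+ 2 + q ^+ 2) * Num.sqrt (z ^+ 2 + (q ^+ 2 + B ^+ 2)))^-1.
    have yc0 y : 0 < y ^+ 2 + (z ^+ 2 + q ^+ 2) by rewrite ltr_wpDl ?sqr_ge0.
    (* With [C = z^2 + q^2], a primitive of [(y^2 + C)^(-3/2)] is [y / (C (y^2 + C)^(1/2))]. *)
    rewrite (@FTC_box1 _ (fun y => 2 * B / (z ^+ 2 + q ^+ 2) *
      (y * (Num.sqrt (y ^+ 2 + (z ^+ 2 + q ^+ 2)))^-1)) _ B B0).
    - rewrite sqrrN.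
      have -> : B ^+ 2 + (z ^+ 2 + q ^+ 2) = z ^+ 2 + (q ^+ 2 + B ^+ 2) by ring.
      have v0 : 0 < Num.sqrt (z ^+ 2 + (q ^+ 2 + B ^+ 2)).
        by rewrite sqrtr_gt0 addrA addr_gt0.
      by have := c0 z => cz; field; rewrite !gt_eqF.
    - have -> : (fun y => g y z) = (fun y => 2 * B * r1 (y ^+ 2 + (z ^+ 2 + q ^+ 2))).
        by apply/funext => y.
      move=> y; apply: (@der_continuous _ _ y _); apply: derZ.
      by apply: der_radial; exact: dr1.
    - move=> y; have v0 : 0 < Num.sqrt (y ^+ 2 + (z ^+ 2 + q ^+ 2)) by rewrite sqrtr_gt0.
      apply: der_eq.
        apply: derZ; apply: derM; first exact: der_id.
        apply: derV; first by rewrite gt_eqF.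
        apply: der_sqrt; first by [].
        by apply: derD; [apply: derX2; exact: der_id|exact: der_cst].
      rewrite gE /r1/=.
      have tE : y ^+ 2 + (z ^+ 2 + q ^+ 2) =
        Num.sqrt (y ^+ 2 + (z ^+ 2 + q ^+ 2)) ^+ 2 by rewrite sqr_sqrtr// ltW.
      have cz := c0 z.
      move: (Num.sqrt _) v0 tE => v v0 tE; rewrite tE.
      have yE : y ^+ 2 = v ^+ 2 - (z ^+ 2 + q ^+ 2) by rewrite -tE; ring.
      move: (z ^+ 2 + q ^+ 2) cz yE => C C0 yE.
      transitivity (2 * B / C * ((v ^+ 2 - y ^+ 2) / v ^+ 3)).
        by field; rewrite !gt_eqF.
      by rewrite yE; field; rewrite !gt_eqF.
  under eq_Rintegral do rewrite inner.
  pose D := q ^+ 2 + B ^+ 2; have D0 : 0 < D by rewrite addr_gt0 ?exprn_gt0.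
  have zD z : 0 < z ^+ 2 + D by rewrite ltr_wpDl ?sqr_ge0.
  (* With [D = q^2 + B^2], the function [1 / ((z^2 + q^2) (z^2 + D)^(1/2))] has the primitive
     [atan (B z / (q (z^2 + D)^(1/2))) / (q B)]. *)
  rewrite (@FTC_box1 _ (fun z => 4 * B / q *
      atan (B / q * (z * (Num.sqrt (z ^+ 2 + D))^-1))) _ B B0).
  - rewrite sqrrN mulNr mulrN atanN /at_.
    have -> : B ^+ 2 + D = 3 * B ^+ 2 + e ^+ 2 by rewrite /D q2; ring.
    have -> : B / q * (B / Num.sqrt (3 * B ^+ 2 + e ^+ 2)) =
      B ^+ 2 / (q * Num.sqrt (3 * B ^+ 2 + e ^+ 2)).
      have v0 : 0 < Num.sqrt (3 * B ^+ 2 + e ^+ 2) by rewrite sqrtr_gt0 addr_gt0 ?mulr_gt0.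
      by field; rewrite !gt_eqF.
    by ring.
  - move=> z; apply: (@der_continuous _ _ z _); apply: derZ; apply: derV.
      by rewrite gt_eqF// mulr_gt0// sqrtr_gt0.
    apply: derM.
      by apply: derD; [apply: derX2; exact: der_id|exact: der_cst].
    apply: der_sqrt; first by [].
    by apply: derD; [apply: derX2; exact: der_id|exact: der_cst].
  - move=> z; have v0 : 0 < Num.sqrt (z ^+ 2 + D) by rewrite sqrtr_gt0.
    apply: der_eq.
      apply: derZ; apply: (@der_comp _ atan
        (fun z => B / q * (z * (Num.sqrt (z ^+ 2 + D))^-1))).
        exact: is_derive1_atan.
      apply: derZ; apply: derM; first exact: der_id.
      apply: derV; first by rewrite gt_eqF.
      apply: der_sqrt; first by [].
      by apply: derD; [apply: derX2; exact: der_id|exact: der_cst].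
    rewrite -/D /=.
    have vE : Num.sqrt (z ^+ 2 + D) ^+ 2 = z ^+ 2 + D by rewrite sqr_sqrtr// ltW.
    have cz := c0 z.
    move: (Num.sqrt _) v0 vE => v v0 vE.
    have DE : D = v ^+ 2 - z ^+ 2 by rewrite vE; ring.
    (* The denominator created by the derivative of the arctangent; the factor [D] cancels against
       the derivative of its argument. *)
    have den : q ^+ 2 * v ^+ 2 + B ^+ 2 * z ^+ 2 = D * (z ^+ 2 + q ^+ 2).
      by rewrite vE /D; ring.
    have den0 : 0 < q ^+ 2 * v ^+ 2 + B ^+ 2 * z ^+ 2 by rewrite den mulr_gt0.
    have num : v ^+ 2 - z ^+ 2 = D by rewrite DE.
    transitivity (4 * B / q * ((B / q) * ((v ^+ 2 - z ^+ 2) / v ^+ 3) *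
        (q ^+ 2 * v ^+ 2) / (q ^+ 2 * v ^+ 2 + B ^+ 2 * z ^+ 2))).
      by field; rewrite !exprMn !gt_eqF.
    by rewrite den num; field; rewrite !gt_eqF.
have Ix : \int[lam3 R]_(p in box3 B) f (fun p => p.1.1) p = 8 * B / q * at_.
  rewrite (@FTC_box3_first _ (F (fun p => p.1.1)) _ B B0 (cf _ continuous_coord31)).
    apply: (face (fun y z => F (fun p => p.1.1) (B, y, z) - F (fun p => p.1.1) (- B, y, z))).
    move=> y z; rewrite /F !sqr3x/= sqrrN q2.
    rewrite (_ : B ^+ 2 + (y ^+ 2 + z ^+ 2) + e ^+ 2 =
      y ^+ 2 + (z ^+ 2 + (B ^+ 2 + e ^+ 2))); ring.
  move=> x y z; rewrite /F /f sqr3x/=; under eq_fun do rewrite sqr3x.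
  by apply: dF; rewrite -sqr3x.
have Iy : \int[lam3 R]_(p in box3 B) f (fun p => p.1.2) p = 8 * B / q * at_.
  rewrite (@FTC_box3_mid _ (F (fun p => p.1.2)) _ B B0 (cf _ continuous_coord32)).
    apply: (face (fun x z => F (fun p => p.1.2) (x, B, z) - F (fun p => p.1.2) (x, - B, z))).
    move=> x z; rewrite /F !sqr3y/= sqrrN q2.
    rewrite (_ : B ^+ 2 + (x ^+ 2 + z ^+ 2) + e ^+ 2 =
      x ^+ 2 + (z ^+ 2 + (B ^+ 2 + e ^+ 2))); ring.
  move=> x y z; rewrite /F /f sqr3y/=; under eq_fun do rewrite sqr3y.
  by apply: dF; rewrite -sqr3y.
have Iz : \int[lam3 R]_(p in box3 B) f (fun p => p.2) p = 8 * B / q * at_.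
  rewrite (@FTC_box3_last _ (F (fun p => p.2)) _ B B0 (cf _ continuous_coord33)).
    have cF : continuous (fun a => F (fun p => p.2) (a, B) - F (fun p => p.2) (a, - B)).
      apply: continuous_sub; apply: (@continuous_slicel _ _ _ (F (fun p => p.2)));
        by apply: continuous_mul => //; exact: continuous_coord33.
    (* For the last axis the face integral comes as a planar one and has to be iterated before
       [face] applies. *)
    have [M _ hM] := continuous_bounded_on (@compact_box2 _ B) cF.
    rewrite (@box_Fubini21 _ _ _ _ _ (lam R) (lam R) _ _ _ M)//;
      try exact: fin_box1; last exact: continuous_measurable2.
    apply: (face (fun x y => F (fun p => p.2) (x, y, B) - F (fun p => p.2) (x, y, - B))).
    move=> x y; rewrite /F !sqr3z/= sqrrN q2.
    rewrite (_ : B ^+ 2 + (x ^+ 2 + y ^+ 2) + e ^+ 2 =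
      x ^+ 2 + (y ^+ 2 + (B ^+ 2 + e ^+ 2))); ring.
  move=> [x y] z; rewrite /F /f sqr3z/=; under eq_fun do rewrite sqr3z.
  by apply: dF; rewrite -sqr3z.
transitivity (\int[lam3 R]_(p in box3 B) (f (fun p => p.1.1) p + f (fun p => p.1.2) p
    + f (fun p => p.2) p)).
  apply: eq_Rintegral => p _; rewrite /kernel3 /f /r1 /r2.
  have v0 : 0 < Num.sqrt (sqr3 p + e ^+ 2) by rewrite sqrtr_gt0.
  have := w0 p; move: v0; rewrite /sqr3 /sqr2; move: (Num.sqrt _) => v v0 wp.
  by field; rewrite !gt_eqF.
have c1 := cf _ continuous_coord31; have c2 := cf _ continuous_coord32.
have c3 := cf _ continuous_coord33.
rewrite Rintegral_box3D//; last exact: continuous_add.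
by rewrite Rintegral_box3D// Ix Iy Iz; ring.
Qed.

End space.

(** * Limits of the regularized integrals in space *)

Section space_limit.
Context {R : realType}.
Implicit Types (p : R * R * R) (B x y z s : R).

Lemma continuous_regularized3 (U : R -> R) n :
  (forall t, 0 < t -> {for t, continuous U}) ->
  continuous (fun p => U (sqr3 p + eps n ^+ 2)).
Proof.
move=> cU; apply: (@continuous_radial3 _ (fun s => U (s + eps n ^+ 2))) => s s0.
by apply: continuous_der_pos => //; exact: eps2_gt0.
Qed.

Lemma continuous_sqrt_inv (h : R -> R) (t : R) : continuous h -> 0 < t ->
  {for t, continuous (fun t => h (Num.sqrt t) * (Num.sqrt t)^-1)}.
Proof.
move=> ch t0.
have cs : {for t, continuous (@Num.sqrt R)}.
  by apply: (@der_continuous _ _ t _); apply: (@der_sqrt _ (fun t => t)); [exact: t0|exact: der_id].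
apply: cvgM; first by apply: continuous_comp; [exact: cs|exact: ch].
by apply: cvgV; [rewrite gt_eqF// sqrtr_gt0|exact: cs].
Qed.

Lemma continuous_sqrt_pos (t : R) : 0 < t -> {for t, continuous (@Num.sqrt R)}.
Proof.
move=> t0; apply: (@der_continuous _ _ t _).
by apply: (@der_sqrt _ (fun t => t)); [exact: t0|exact: der_id].
Qed.

(** On a box [1/r = r / r^2] with [r] bounded, so the dominator of [1/r^2] also serves for the
    potential itself. *)
Lemma sqrt_inv_le_dom3 B p : 0 < B -> box3 B p ->
  p.1.1 != 0 -> p.1.2 != 0 -> p.2 != 0 ->
  (Num.sqrt (sqr3 p))^-1 <= Num.sqrt (3 * B ^+ 2) * dom3 p.
Proof.
move=> B0 pB p1 p2 p3; have s0 := sqr3_gt0 p1.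
have v0 : 0 < Num.sqrt (sqr3 p) by rewrite sqrtr_gt0.
have -> : (Num.sqrt (sqr3 p))^-1 = Num.sqrt (sqr3 p) * (sqr3 p)^-1.
  have : sqr3 p = Num.sqrt (sqr3 p) ^+ 2 by rewrite sqr_sqrtr// ltW.
  by move: (Num.sqrt _) v0 => v v0 ->; field; rewrite gt_eqF.
apply: ler_pM; [exact: ltW|by rewrite invr_ge0 ltW| |exact: le_dom3].
by apply: ler_wsqrtr; exact: sqr3_box.
Qed.

Lemma integrable_dom3Z B (K : R) : 0 < B ->
  (lam3 R).-integrable (box3 B) (EFin \o (fun p => K * dom3 p)).
Proof.
move=> B0; have -> : (EFin \o (fun p => K * dom3 p)) =
    (fun p => K%:E * (EFin \o dom3) p)%E by apply/funext => p /=; rewrite EFinM.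
by apply: integrableZl => //; exact: integrable_dom3.
Qed.

Lemma rho_box B p n : 0 < B -> box3 B p ->
  box1 (Num.sqrt (3 * B ^+ 2 + 1)) (Num.sqrt (sqr3 p + eps n ^+ 2)).
Proof.
move=> B0 pB; rewrite box1P ger0_norm ?sqrtr_ge0//.
by rewrite ler_wsqrtr// lerD ?sqr3_box// eps2_le1.
Qed.

Lemma measurable_potential3 (h : R -> R) : continuous h ->
  measurable_fun [set: measurableTypeR R * measurableTypeR R * measurableTypeR R]
    (fun p => h (Num.sqrt (sqr3 p)) * (Num.sqrt (sqr3 p))^-1).
Proof.
move=> ch.
have mr : measurable_fun [set: measurableTypeR R * measurableTypeR R * measurableTypeR R]
    (fun p => Num.sqrt (sqr3 p)).
  apply: continuous_measurable3; apply: (@continuous_comp_at _ _ (@Num.sqrt R)).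
    by move=> p; exact: sqrt_continuous.
  exact: continuous_sqr3.
apply: measurable_funM.
  by apply: measurableT_comp mr; exact: continuous_measurable_fun.
(* The reciprocal as a real power, to use [measurable_powR]; at the origin both sides are [0]. *)
have -> : (fun p => (Num.sqrt (sqr3 p))^-1) = (fun p => Num.sqrt (sqr3 p) `^ (-1)).
  by apply/funext => p; rewrite powR_inv1 ?sqrtr_ge0.
by apply: (measurableT_comp (measurable_powR (-1))).
Qed.

Lemma limit_potential3 B (a : R * R * R -> R) (h : R -> R) : 0 < B ->
  continuous a -> continuous h ->
  \int[lam3 R]_(p in box3 B) (a p *
    (h (Num.sqrt (sqr3 p + eps n ^+ 2)) * (Num.sqrt (sqr3 p + eps n ^+ 2))^-1))
  @[n --> \oo] -->
  \int[lam3 R]_(p in box3 B) (a p *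
    (h (Num.sqrt (sqr3 p)) * (Num.sqrt (sqr3 p))^-1)).
Proof.
move=> B0 ca ch.
have [Ma Ma0 hMa] := continuous_bounded_on (@compact_box3 _ B) ca.
(* All regularized radii stay below [sqrt (3 B^2 + 1)], because [eps n <= 1]. *)
have [Mh Mh0 hMh] := continuous_bounded_on
  (@segment_compact _ (- Num.sqrt (3 * B ^+ 2 + 1)) (Num.sqrt (3 * B ^+ 2 + 1))) ch.
apply: (@Rintegral_dominated_cvg _ _ _ (lam3 R) (box3 B) _ _
  (fun p => (Ma * (Mh * Num.sqrt (3 * B ^+ 2))) * dom3 p)) => //.
- move=> n; apply: continuous_measurable3; apply: continuous_mul => //.
  apply: (@continuous_regularized3 (fun t => h (Num.sqrt t) * (Num.sqrt t)^-1)).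
  by move=> t t0; exact: continuous_sqrt_inv.
- by apply: measurable_funM; [exact: continuous_measurable3|exact: measurable_potential3].
- apply: ae_lam3W => p p1 p2 p3 _; have s0 := sqr3_gt0 p1.
  apply: cvgM; first exact: cvg_cst.
  apply: (@cvg_comp_regularized _ (fun t => h (Num.sqrt t) * (Num.sqrt t)^-1)).
  exact: continuous_sqrt_inv.
- exact: integrable_dom3Z.
- apply: ae_lam3W => p p1 p2 p3 n pB; have s0 := sqr3_gt0 p1.
  have w0 : 0 < sqr3 p + eps n ^+ 2 by rewrite addr_gt0// eps2_gt0.
  have v0 : 0 < Num.sqrt (sqr3 p + eps n ^+ 2) by rewrite sqrtr_gt0.
  rewrite !normrM -!mulrA; apply: ler_pM; rewrite ?mulr_ge0//; first exact: hMa.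
  apply: ler_pM => //; first by apply: hMh; exact: rho_box.
  rewrite normfV gtr0_norm//; apply: le_trans (sqrt_inv_le_dom3 B0 pB p1 p2 p3).
  by rewrite lef_pV2 ?posrE ?sqrtr_gt0// ler_wsqrtr// lerDl ltW// eps2_gt0.
Qed.

(** Serves for the remainder of the spatial identity. The ratio [e^2 / (r^2 + e^2)] tends to zero
    off the origin and is at most [1], so [1/r^2] dominates up to a constant. *)
Lemma limit_potential3_ratio B (a : R * R * R -> R) (h : R -> R) : 0 < B ->
  continuous a -> continuous h ->
  \int[lam3 R]_(p in box3 B) (a p * (h (Num.sqrt (sqr3 p + eps n ^+ 2)) *
    ((sqr3 p + eps n ^+ 2)^-1 * (eps n ^+ 2 * (sqr3 p + eps n ^+ 2)^-1))))
  @[n --> \oo] --> (0 : R).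
Proof.
move=> B0 ca ch.
have -> : 0 = \int[lam3 R]_(p in box3 B) 0 :> R by rewrite Rintegral_cst// mul0r.
have [Ma Ma0 hMa] := continuous_bounded_on (@compact_box3 _ B) ca.
have [Mh Mh0 hMh] := continuous_bounded_on
  (@segment_compact _ (- Num.sqrt (3 * B ^+ 2 + 1)) (Num.sqrt (3 * B ^+ 2 + 1))) ch.
have chs t : 0 < t -> {for t, continuous (fun t => h (Num.sqrt t))}.
  by move=> t0; apply: (@continuous_comp _ _ _ (@Num.sqrt R) h);
    [exact: (continuous_sqrt_pos t0)|exact: ch].
apply: (@Rintegral_dominated_cvg _ _ _ (lam3 R) (box3 B) _ _
  (fun p => (Ma * Mh) * dom3 p)) => //.
- move=> n; apply: continuous_measurable3; apply: continuous_mul => //.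
  have ci : continuous (fun p => (sqr3 p + eps n ^+ 2)^-1).
    by apply: (@continuous_regularized3 (fun t => t^-1)); exact: continuous_inv_pos.
  apply: continuous_mul.
    exact: (@continuous_regularized3 (fun t => h (Num.sqrt t))).
  apply: continuous_mul => //.
  by apply: continuous_mul => //; exact: continuous_cst_fun.
- apply: ae_lam3W => p p1 p2 p3 _; have s0 := sqr3_gt0 p1.
  have ci := @cvg_comp_regularized _ (fun t => t^-1) _ (continuous_inv_pos s0).
  rewrite -(mulr0 (a p)); apply: cvgM; first exact: cvg_cst.
  rewrite -(mulr0 (h (Num.sqrt (sqr3 p)))); apply: cvgM.
    exact: (@cvg_comp_regularized _ (fun t => h (Num.sqrt t)) _ (chs _ s0)).
  rewrite -(mulr0 (sqr3 p)^-1); apply: (cvgM ci).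
  by rewrite -(mul0r (sqr3 p)^-1); apply: (cvgM _ ci); exact: cvg_eps2.
- exact: integrable_dom3Z.
- apply: ae_lam3W => p p1 p2 p3 n pB; have s0 := sqr3_gt0 p1.
  have e0 := @eps2_gt0 R n.
  have w0 : 0 < sqr3 p + eps n ^+ 2 by rewrite addr_gt0.
  rewrite (normrM (a p)) (normrM (h _)) -(mulrA Ma).
  apply: ler_pM; rewrite ?mulr_ge0//; first exact: hMa.
  apply: ler_pM; rewrite ?mulr_ge0//; first by apply: hMh; exact: rho_box.
  apply: le_trans (le_dom3 p1 p2 p3).
  have r0 : 0 <= eps n ^+ 2 / (sqr3 p + eps n ^+ 2) by apply: divr_ge0; exact: ltW.
  rewrite ger0_norm ?mulr_ge0// ?invr_ge0 ?(ltW w0)//.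
  apply: le_trans (_ : (sqr3 p + eps n ^+ 2)^-1 * 1 <= _).
    rewrite ler_pM2l ?invr_gt0//.
    by rewrite ler_pdivrMr// mul1r lerDr ltW.
  by rewrite mulr1 lef_pV2 ?posrE// lerDl ltW.
Qed.

Lemma continuous_kernel3 n : continuous (kernel3 (eps n : R)).
Proof.
apply: continuous_mul; first exact: continuous_cst_fun.
apply: (@continuous_regularized3 (fun t => (Num.sqrt t * t ^+ 2)^-1)) => t t0.
apply: (@der_continuous _ _ t _).
apply: derV; first by rewrite gt_eqF// mulr_gt0 ?exprn_gt0 ?sqrtr_gt0.
apply: derM; last by apply: derX2; exact: der_id.
by apply: (@der_sqrt _ (fun t => t)); [exact: t0|exact: der_id].
Qed.

Lemma kernel3_ge0 (e : R) p : 0 <= kernel3 e p.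
Proof.
rewrite mulr_ge0 ?invr_ge0//; first by rewrite mulr_ge0 ?sqr_ge0.
by rewrite mulr_ge0 ?sqrtr_ge0 ?sqr_ge0.
Qed.

(** The increment is measured by the regularized radius [v]: here [f] is evaluated at [v], so the
    difference need not vanish at the origin. [kernel3] times [L v] is [3 L / v^2] times a ratio at
    most [1]. *)
Lemma limit_kernel3 B L (f : R -> R) (psi : R * R * R -> R) : 0 < B -> 0 < L ->
  continuous f -> continuous psi ->
  (forall p n, box3 B p ->
    `|f (Num.sqrt (sqr3 p + eps n ^+ 2)) * psi p - f 0 * psi 0| <=
    L * Num.sqrt (sqr3 p + eps n ^+ 2)) ->
  \int[lam3 R]_(p in box3 B) (kernel3 (eps n) p *
    (f (Num.sqrt (sqr3 p + eps n ^+ 2)) * psi p - f 0 * psi 0)) @[n --> \oo] --> (0 : R).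
Proof.
move=> B0 L0 cf cpsi; move: (f 0 * psi 0) => c0 hw.
have -> : 0 = \int[lam3 R]_(p in box3 B) 0 :> R by rewrite Rintegral_cst// mul0r.
have cfs t : 0 < t -> {for t, continuous (fun t => f (Num.sqrt t))}.
  by move=> t0; apply: (@continuous_comp _ _ _ (@Num.sqrt R) f);
    [exact: (continuous_sqrt_pos t0)|exact: cf].
apply: (@Rintegral_dominated_cvg _ _ _ (lam3 R) (box3 B) _ _
  (fun p => (3 * L) * dom3 p)) => //.
- move=> n; apply: continuous_measurable3.
  apply: continuous_mul; first exact: continuous_kernel3.
  apply: continuous_sub; last exact: continuous_cst_fun.
  apply: continuous_mul => //.
  exact: (@continuous_regularized3 (fun t => f (Num.sqrt t))).
- apply: ae_lam3W => p p1 p2 p3 _; have s0 := sqr3_gt0 p1.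
  have cK : kernel3 (eps n) p @[n --> \oo] --> (0 : R).
    rewrite -(mul0r ((Num.sqrt (sqr3 p) * sqr3 p ^+ 2)^-1)); apply: cvgM.
      by rewrite -(mulr0 3); apply: cvgM; [exact: cvg_cst|exact: cvg_eps2].
    apply: (@cvg_comp_regularized _ (fun t => (Num.sqrt t * t ^+ 2)^-1)).
    apply: (@der_continuous _ _ (sqr3 p) _).
    apply: derV; first by rewrite gt_eqF// mulr_gt0 ?exprn_gt0 ?sqrtr_gt0.
    apply: derM; last by apply: derX2; exact: der_id.
    by apply: (@der_sqrt _ (fun t => t)); [exact: s0|exact: der_id].
  have cf' := @cvg_comp_regularized _ (fun t => f (Num.sqrt t)) _ (cfs _ s0).
  rewrite -[X in _ --> X](mul0r (f (Num.sqrt (sqr3 p)) * psi p - c0)).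
  exact: (cvgM cK (cvgB (cvgM cf' (cvg_cst (psi p))) (cvg_cst (c0)))).
- exact: integrable_dom3Z.
- apply: ae_lam3W => p p1 p2 p3 n pB; have s0 := sqr3_gt0 p1.
  have e0 := @eps2_gt0 R n.
  have w0 : 0 < sqr3 p + eps n ^+ 2 by rewrite addr_gt0.
  have v0 : 0 < Num.sqrt (sqr3 p + eps n ^+ 2) by rewrite sqrtr_gt0.
  rewrite normrM; apply: le_trans (ler_wpM2l (normr_ge0 _) (hw _ n pB)) _.
  rewrite (ger0_norm (kernel3_ge0 _ _)).
  apply: le_trans (_ : 3 * L * (sqr3 p)^-1 <= _); last first.
    by rewrite ler_pM2l ?mulr_gt0//; exact: le_dom3.
  apply: le_trans (_ : 3 * L * (sqr3 p + eps n ^+ 2)^-1 <= _); last first.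
    by rewrite ler_pM2l ?mulr_gt0// lef_pV2 ?posrE// lerDl ltW.
  rewrite /kernel3; move: (Num.sqrt _) v0 => v v0.
  have -> : 3 * eps n ^+ 2 / (v * (sqr3 p + eps n ^+ 2) ^+ 2) * (L * v) =
    3 * L * (sqr3 p + eps n ^+ 2)^-1 * (eps n ^+ 2 / (sqr3 p + eps n ^+ 2)).
    by field; rewrite !gt_eqF.
  rewrite ler_piMr ?mulr_ge0 ?invr_ge0 ?(ltW L0) ?(ltW w0)//.
  by rewrite ler_pdivrMr// mul1r lerDr ltW.
Qed.

Lemma cvg_mass_kernel3 B : 0 < B ->
  \int[lam3 R]_(p in box3 B) kernel3 (eps n) p @[n --> \oo] --> (4 * pi : R).
Proof.
move=> B0; have B20 : 0 < B ^+ 2 by rewrite exprn_gt0.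
(* The mass as a function of [t = B^2 + e^2], where [3 B^2 + e^2 = t + 2 B^2]; at [t = B^2] it is
   [24 atan (1 / sqrt 3) = 4 pi]. *)
pose U (t : R) := 24 * B * (Num.sqrt t)^-1 *
  atan (B ^+ 2 * (Num.sqrt t * Num.sqrt (t + 2 * B ^+ 2))^-1).
have sB : Num.sqrt (B ^+ 2) = B by rewrite sqrtr_sqr gtr0_norm.
have s3 : B ^+ 2 + 2 * B ^+ 2 = 3 * B ^+ 2 by ring.
have UE : U (B ^+ 2) = 4 * pi.
  rewrite /U sB s3 sqrtrM// sB -(mulrA 24) divff ?gt_eqF//.
  have -> : B ^+ 2 / (B * (Num.sqrt 3 * B)) = (Num.sqrt 3)^-1.
    have v0 : 0 < Num.sqrt 3 :> R by rewrite sqrtr_gt0.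
    by field; rewrite !gt_eqF.
  by rewrite atan_invsqrt3; field.
rewrite -UE; apply: cvg_seq_eq (_ : U (B ^+ 2 + eps n ^+ 2) @[n --> \oo] --> U (B ^+ 2)) _ _ => //.
  apply: cvg_comp_regularized.
  have cs := continuous_sqrt_pos B20.
  have ci : {for B ^+ 2, continuous (fun t => (Num.sqrt t)^-1)}.
    by apply: cvgV; [rewrite sB gt_eqF|exact: cs].
  have c3 : {for B ^+ 2, continuous (fun t => Num.sqrt (t + 2 * B ^+ 2))}.
    apply: (@continuous_comp _ _ _ (fun t => t + 2 * B ^+ 2) (@Num.sqrt R)).
      by apply: cvgD; [exact: cvg_id|exact: cvg_cst].
    by rewrite s3; apply: continuous_sqrt_pos; rewrite mulr_gt0.
  apply: cvgM; first by apply: cvgM; [exact: cvg_cst|exact: ci].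
  apply: (@continuous_comp _ _ _
    (fun t => B ^+ 2 * (Num.sqrt t * Num.sqrt (t + 2 * B ^+ 2))^-1) (@atan R)).
    apply: cvgM; first exact: cvg_cst.
    apply: cvgV; last by apply: cvgM; [exact: cs|exact: c3].
    by rewrite s3 gt_eqF// mulr_gt0// sqrtr_gt0// mulr_gt0.
  exact: continuous_atan.
move=> n; rewrite mass_kernel3 ?eps_gt0// /U.
by rewrite (_ : B ^+ 2 + eps n ^+ 2 + 2 * B ^+ 2 = 3 * B ^+ 2 + eps n ^+ 2)//; ring.
Qed.

(** The product is varied one factor at a time: the mean value theorem bounds [f v - f 0] by [M v],
    and [lipschitz3] bounds the increment of [psi] by [L r <= L v]. *)
Lemma product_increment_rho B (f f1 : R -> R) (psi px py pz : R * R * R -> R) :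
  0 < B -> (forall s, der f s (f1 s)) -> continuous f1 -> continuous psi ->
  continuous px -> continuous py -> continuous pz ->
  (forall x y z, der (fun x => psi (x, y, z)) x (px (x, y, z))) ->
  (forall x y z, der (fun y => psi (x, y, z)) y (py (x, y, z))) ->
  (forall x y z, der (fun z => psi (x, y, z)) z (pz (x, y, z))) ->
  exists2 L : R, 0 < L & forall p n, box3 B p ->
    `|f (Num.sqrt (sqr3 p + eps n ^+ 2)) * psi p - f 0 * psi 0| <=
    L * Num.sqrt (sqr3 p + eps n ^+ 2).
Proof.
move=> B0 df cf1 cpsi cx cy cz dx dy dz.
have [L L0 hL] := @lipschitz3 _ psi px py pz B cx cy cz dx dy dz.
have [Mp Mp0 hMp] := continuous_bounded_on (@compact_box3 _ B) cpsi.
pose P := Num.sqrt (3 * B ^+ 2 + 1).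
have [M M0 hM] := continuous_bounded_on (@segment_compact _ (- P) P) cf1.
exists (M * Mp + `|f 0| * L) => [|p n pB].
  by rewrite ltr_pwDl ?mulr_gt0// mulr_ge0// ltW.
set v := Num.sqrt _; have v0 : 0 <= v by rewrite sqrtr_ge0.
rewrite (_ : f v * psi p - f 0 * psi 0 = (f v - f 0) * psi p + f 0 * (psi p - psi 0));
  last by ring.
rewrite (le_trans (ler_normD _ _))// !normrM mulrDl; apply: lerD.
  rewrite [leRHS]mulrAC; apply: ler_pM => //; last exact: hMp.
  rewrite -[v in leRHS]ger0_norm//.
  by apply: (@der_increment_le _ f f1 M P) => //; exact: rho_box.
rewrite -mulrA; apply: ler_wpM2l => //; apply: le_trans (hL _ pB) _.
by rewrite ler_pM2l// ler_wsqrtr// lerDl ltW// eps2_gt0.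
Qed.

End space_limit.

(** * The distributional Laplacian of f(r) / r *)

Section space_fundamental.
Context {R : realType}.
Implicit Types (p : R * R * R) (B x y z s : R).

(** Away from the origin the Laplacian of [f(r)/r] is [f''(r)/r]. With [v^2 = r^2 + e^2], that of
    [f(v)/v] is [f''/v + e^2 (3 f' - v f'') / v^4 - f kernel3]: the middle term disappears in the
    limit and the last one gives the point mass. *)
Lemma fundamental3 B (f f1 f2 : R -> R) psi px pxx py pyy pz pzz : 0 < B ->
  (forall s, der f s (f1 s)) -> (forall s, der f1 s (f2 s)) -> continuous f2 ->
  spatial_test B psi px pxx py pyy pz pzz ->
  \int[lam3 R]_(p in box3 B)
    ((pxx p + pyy p + pzz p) * (f (Num.sqrt (sqr3 p)) * (Num.sqrt (sqr3 p))^-1)) =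
  \int[lam3 R]_(p in box3 B)
    (psi p * (f2 (Num.sqrt (sqr3 p)) * (Num.sqrt (sqr3 p))^-1))
  - 4 * pi * (f 0 * psi 0).
Proof.
move=> B0 df df1 cf2 T.
have cf := der_continuousT df; have cf1 := der_continuousT df1.
have cpsi := st_c T.
have cL : continuous (fun p => pxx p + pyy p + pzz p).
  by apply: continuous_add; [apply: continuous_add;
    [exact: st_cxx T|exact: st_cyy T]|exact: st_czz T].
pose w2 n s := s + eps n ^+ 2 : R.
have w20 n s : 0 <= s -> 0 < w2 n s.
  by move=> s0; rewrite ltr_wpDl// eps2_gt0.
pose U n s := f (Num.sqrt (w2 n s)) * (Num.sqrt (w2 n s))^-1.
pose U1 n s := 2^-1 * (f1 (Num.sqrt (w2 n s)) * (w2 n s)^-1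
  - f (Num.sqrt (w2 n s)) * (Num.sqrt (w2 n s) * w2 n s)^-1).
pose U2 n s := 4^-1 * (f2 (Num.sqrt (w2 n s)) * (Num.sqrt (w2 n s) * w2 n s)^-1
  - 3 * (f1 (Num.sqrt (w2 n s)) * ((w2 n s) ^+ 2)^-1)
  + 3 * (f (Num.sqrt (w2 n s)) * (Num.sqrt (w2 n s) * (w2 n s) ^+ 2)^-1)).
have dw2 n s : der (w2 n) s 1.
  apply: der_eq; last exact: addr0.
  by apply: derD; [exact: der_id|exact: der_cst].
have dv n s : 0 <= s -> der (fun s => Num.sqrt (w2 n s)) s (1 / (2 * Num.sqrt (w2 n s))).
  by move=> s0; apply: der_sqrt; [exact: w20|exact: dw2].
have dh n s (h h1 : R -> R) : 0 <= s -> (forall s, der h s (h1 s)) ->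
    der (fun s => h (Num.sqrt (w2 n s))) s
      (h1 (Num.sqrt (w2 n s)) * (1 / (2 * Num.sqrt (w2 n s)))).
  by move=> s0 hh; apply: (@der_comp _ h (fun s => Num.sqrt (w2 n s))); [exact: hh|exact: dv].
have v0 n s : 0 <= s -> 0 < Num.sqrt (w2 n s) by move=> s0; rewrite sqrtr_gt0 w20.
have dvw n s : 0 <= s -> der (fun s => Num.sqrt (w2 n s) * w2 n s) s
    (1 / (2 * Num.sqrt (w2 n s)) * w2 n s + Num.sqrt (w2 n s) * 1).
  by move=> s0; apply: derM; [exact: dv|exact: dw2].
have vE n s : 0 <= s -> w2 n s = Num.sqrt (w2 n s) ^+ 2.
  by move=> s0; rewrite sqr_sqrtr// ltW// w20.
have dU n s : 0 <= s -> der (U n) s (U1 n s).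
  move=> s0; apply: der_eq.
    by apply: derM; [exact: dh|apply: derV; [rewrite gt_eqF// v0|exact: dv]].
  rewrite /U1 /=; have := v0 n s s0; move: (vE n s s0).
  by move: (Num.sqrt _) => v -> vv; field; rewrite gt_eqF.
have dU1 n s : 0 <= s -> der (U1 n) s (U2 n s).
  move=> s0; apply: der_eq.
    apply: derZ; apply: derB; apply: derM.
    - exact: dh.
    - by apply: derV; [rewrite gt_eqF// w20|exact: dw2].
    - exact: dh.
    - by apply: derV; [rewrite gt_eqF// mulr_gt0 ?v0 ?w20|exact: dvw].
  rewrite /U2 /=; have := v0 n s s0; move: (vE n s s0).
  by move: (Num.sqrt _) => v -> vv; field; rewrite gt_eqF.
have cU2 n s : 0 <= s -> {for s, continuous (U2 n)}.
  move=> s0; have w0 := w20 n s s0; have v0s := v0 n s s0.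
  have cv : {for s, continuous (fun s => Num.sqrt (w2 n s))} := der_continuous (dv n s s0).
  have cw : {for s, continuous (w2 n)} := der_continuous (dw2 n s).
  have cw2 : {for s, continuous (fun s => (w2 n s) ^+ 2)} := der_continuous (derX2 (dw2 n s)).
  have cf2v : {for s, continuous (fun s => f2 (Num.sqrt (w2 n s)))}.
    by apply: (@continuous_comp _ _ _ (fun s => Num.sqrt (w2 n s)) f2); [exact: cv|exact: cf2].
  have cf1v : {for s, continuous (fun s => f1 (Num.sqrt (w2 n s)))} := der_continuous (dh n s _ _ s0 df1).
  have cfv : {for s, continuous (fun s => f (Num.sqrt (w2 n s)))} := der_continuous (dh n s _ _ s0 df).
  apply: cvgM; first exact: cvg_cst.
  apply: cvgD.
    apply: cvgB.
      apply: (cvgM cf2v); apply: cvgV; first by rewrite gt_eqF// mulr_gt0.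
      exact: (cvgM cv cw).
    apply: cvgM; first exact: cvg_cst.
    by apply: (cvgM cf1v); apply: cvgV; [rewrite gt_eqF// exprn_gt0|exact: cw2].
  apply: cvgM; first exact: cvg_cst.
  apply: (cvgM cfv); apply: cvgV; first by rewrite gt_eqF// mulr_gt0// exprn_gt0.
  exact: (cvgM cv cw2).
have [L L0 hL] := product_increment_rho B0 df cf1 cpsi (st_cx T) (st_cy T) (st_cz T)
  (st_dx T) (st_dy T) (st_dz T).
have ck n := @continuous_kernel3 R n.
pose A n p := psi p * (f2 (Num.sqrt (w2 n (sqr3 p))) * (Num.sqrt (w2 n (sqr3 p)))^-1).
(* The numerator of the vanishing term; [C n] is this term against [psi]. *)
pose h1 t := - (t * f2 t) + 3 * f1 t.
have ch1 : continuous h1.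
  apply: continuous_add; last first.
    by apply: continuous_mul; [exact: continuous_cst_fun|exact: cf1].
  by move=> t; apply: cvgN; apply: cvgM; [exact: cvg_id|exact: cf2].
pose C n p := psi p * (h1 (Num.sqrt (w2 n (sqr3 p))) *
    ((w2 n (sqr3 p))^-1 * (eps n ^+ 2 * (w2 n (sqr3 p))^-1))).
pose K n p := kernel3 (eps n) p *
   (f (Num.sqrt (w2 n (sqr3 p))) * psi p - f 0 * psi 0).
have creg n (h : R -> R) : continuous h -> continuous (fun p => h (Num.sqrt (w2 n (sqr3 p)))).
  move=> ch; rewrite /w2; apply: (@continuous_regularized3 R (fun t => h (Num.sqrt t)) n) => t t0.
  by apply: (@continuous_comp _ _ _ (@Num.sqrt R) h);
    [exact: (continuous_sqrt_pos t0)|exact: ch].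
have ciw n : continuous (fun p => (w2 n (sqr3 p))^-1).
  by rewrite /w2; apply: (@continuous_regularized3 R (fun t => t^-1) n); exact: continuous_inv_pos.
have cA n : continuous (A n).
  rewrite /A /w2; apply: continuous_mul => //.
  apply: (@continuous_regularized3 R (fun t => f2 (Num.sqrt t) * (Num.sqrt t)^-1) n) => t.
  exact: continuous_sqrt_inv.
have cC n : continuous (C n).
  apply: continuous_mul => //; apply: continuous_mul; first exact: creg.
  apply: continuous_mul => //; apply: continuous_mul => //; exact: continuous_cst_fun.
have cK n : continuous (K n).
  apply: continuous_mul; first exact: ck.
  apply: continuous_sub; last exact: continuous_cst_fun.
  by apply: continuous_mul => //; exact: creg.
have GE n : \int[lam3 R]_(p in box3 B) (U n (sqr3 p) * (pxx p + pyy p + pzz p)) =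
    \int[lam3 R]_(p in box3 B) A n p + \int[lam3 R]_(p in box3 B) C n p
    - \int[lam3 R]_(p in box3 B) K n p
    - \int[lam3 R]_(p in box3 B) kernel3 (eps n) p * (f 0 * psi 0).
  rewrite (green3 B0 (dU n) (dU1 n) (cU2 n) T).
  rewrite -RintegralZr//; last exact: continuous_integrable3.
  rewrite -Rintegral_box3D//.
  rewrite -RintegralB//; last 2 first.
  - by apply: continuous_integrable3; exact: continuous_add.
  - exact: continuous_integrable3.
  rewrite -RintegralB//; last 2 first.
  - apply: continuous_integrable3; apply: continuous_sub => //; exact: continuous_add.
  - apply: continuous_integrable3; apply: continuous_mul; first exact: ck.
    exact: continuous_cst_fun.
  apply: eq_Rintegral => p _.
  have s0 := sqr3_ge0 p.
  have := v0 n (sqr3 p) s0; have := vE n (sqr3 p) s0.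
  rewrite /U1 /U2 /A /C /K /kernel3 /h1.
  rewrite -/(w2 n (sqr3 p)).
  have -> : eps n ^+ 2 = w2 n (sqr3 p) - sqr3 p by rewrite /w2 addrC addKr.
  move: (Num.sqrt (w2 n (sqr3 p))) => v; move: (w2 n (sqr3 p)) => W -> vv.
  by field; rewrite gt_eqF.
have lhs : \int[lam3 R]_(p in box3 B) (U n (sqr3 p) * (pxx p + pyy p + pzz p)) @[n --> \oo] -->
    \int[lam3 R]_(p in box3 B)
      ((pxx p + pyy p + pzz p) * (f (Num.sqrt (sqr3 p)) * (Num.sqrt (sqr3 p))^-1)).
  apply: cvg_seq_eq (limit_potential3 B0 cL cf) _ _ => // n.
  by apply: eq_Rintegral => p _; rewrite /U mulrC.
have rhs : \int[lam3 R]_(p in box3 B) (U n (sqr3 p) * (pxx p + pyy p + pzz p)) @[n --> \oo] -->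
    \int[lam3 R]_(p in box3 B) (psi p * (f2 (Num.sqrt (sqr3 p)) * (Num.sqrt (sqr3 p))^-1))
    + 0 - 0 - 4 * pi * (f 0 * psi 0).
  under eq_fun do rewrite GE.
  apply: cvgB; last by apply: cvgM; [exact: cvg_mass_kernel3|exact: cvg_cst].
  apply: cvgB; last exact: limit_kernel3 hL.
  apply: cvgD; first exact: limit_potential3.
  exact: limit_potential3_ratio.
by rewrite (cvg_seq_unique lhs rhs) addr0 subr0.
Qed.

End space_fundamental.

(** * Power series of the Bessel functions *)

Section entire_series.
Context {R : realType}.
Implicit Types (c d : nat -> R) (x : R).

(** An exponential majorant for the coefficients. It gives convergence everywhere and is inherited
    by [pseries_diffs], so that termwise differentiation can be iterated. *)
Definition entire c : Prop :=
  exists C M : R, [/\ 0 <= C, 0 <= M & forall j, `|c j| <= C * (M ^+ j / j`!%:R)].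

Definition psum c x : R := limn (pseries c x).

Lemma entire_cvg c x : entire c -> cvgn (pseries c x).
Proof.
move=> [C [M [C0 M0 hc]]]; apply: normed_cvg.
apply: (@series_le_cvg R _ (fun j => C * exp_coeff (M * `|x|) j)).
- by move=> j; exact: normr_ge0.
- by move=> j; rewrite mulr_ge0// exp_coeff_ge0// mulr_ge0.
- move=> j; rewrite /= normrM normrX /exp_coeff/= exprMn.
  rewrite [leRHS](_ : _ = C * (M ^+ j / j`!%:R) * `|x| ^+ j); last by ring.
  by apply: ler_wpM2r; [exact: exprn_ge0|exact: hc].
have -> : (fun j => C * exp_coeff (M * `|x|) j) = C *: exp_coeff (M * `|x|) by [].
by apply: is_cvg_seriesZ; exact: is_cvg_series_exp_coeff.
Qed.

Lemma entire_diffs c : entire c -> entire (pseries_diffs c).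
Proof.
move=> [C [M [C0 M0 hc]]]; exists (C * M), M; split=> //; first exact: mulr_ge0.
move=> j; rewrite /pseries_diffs normrM.
have j1 : 0 < j.+1%:R :> R by [].
have jf : 0 < j`!%:R :> R by rewrite ltr0n fact_gt0.
rewrite gtr0_norm//; apply: le_trans (ler_wpM2l (ltW j1) (hc _)) _.
rewrite le_eqVlt; apply/orP; left; apply/eqP.
by rewrite factS natrM exprS; field; rewrite !gt_eqF.
Qed.

Lemma der_psum c x : entire c -> der (psum c) x (psum (pseries_diffs c) x).
Proof.
move=> ec; have ed := entire_diffs ec; have edd := entire_diffs ed.
apply: (@pseries_snd_diffs R c (`|x| + 1)); try exact: entire_cvg.
by rewrite [ltRHS]ger0_norm ?addr_ge0// ltrDl.
Qed.

Lemma continuous_psum c : entire c -> continuous (psum c).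
Proof. by move=> ec x; exact: der_continuous (der_psum x ec). Qed.

Lemma entireD c d : entire c -> entire d -> entire (fun j => c j + d j).
Proof.
move=> [C [M [C0 M0 hc]]] [D [N [D0 N0 hd]]].
exists (C + D), (M + N); split; [exact: addr_ge0|exact: addr_ge0|move=> j].
have jf : 0 < j`!%:R^-1 :> R by rewrite invr_gt0 ltr0n fact_gt0.
rewrite (le_trans (ler_normD _ _))// mulrDl lerD//.
  apply: le_trans (hc j) _; apply: ler_wpM2l => //; rewrite ler_pM2r//.
  by rewrite lerXn2r ?nnegrE ?addr_ge0// lerDl.
apply: le_trans (hd j) _; apply: ler_wpM2l => //; rewrite ler_pM2r//.
by rewrite lerXn2r ?nnegrE ?addr_ge0// lerDr.
Qed.

Lemma entireZ k c : entire c -> entire (fun j => k * c j).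
Proof.
move=> [C [M [C0 M0 hc]]]; exists (`|k| * C), M; split=> //; first exact: mulr_ge0.
by move=> j; rewrite normrM -mulrA ler_wpM2l.
Qed.

Lemma psumD c d x : entire c -> entire d ->
  psum (fun j => c j + d j) x = psum c x + psum d x.
Proof.
move=> ec ed; rewrite [LHS]/psum; apply: cvg_lim => //.
rewrite (_ : pseries _ x = (fun n => pseries c x n + pseries d x n)); last first.
  apply/funext => n; rewrite /pseries/= /series/= -big_split/=.
  by apply: eq_bigr => i _; rewrite mulrDl.
by apply: cvgD; exact: entire_cvg.
Qed.

Lemma psumZ k c x : entire c -> psum (fun j => k * c j) x = k * psum c x.
Proof.
move=> ec; rewrite [LHS]/psum; apply: cvg_lim => //.
rewrite (_ : pseries _ x = (fun n => k * pseries c x n)); last first.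
  apply/funext => n; rewrite /pseries/= /series/= mulr_sumr.
  by apply: eq_bigr => i _; rewrite mulrA.
by apply: cvgM; [exact: cvg_cst|exact: entire_cvg].
Qed.

Lemma psum_shift d x : entire d ->
  x * psum d x = psum (fun j => if j is j'.+1 then d j' else 0) x.
Proof.
move=> ed; apply: esym; rewrite [LHS]/psum; apply: cvg_lim => //.
rewrite -(cvg_shiftS (pseries _ x)) (_ : [sequence _]_n = (fun n => x * pseries d x n)).
  by apply: cvgM; [exact: cvg_cst|exact: entire_cvg].
apply/funext => n; rewrite /pseries/= /series/= big_nat_recl//= mul0r add0r mulr_sumr.
by apply: eq_bigr => i _; rewrite exprS mulrCA.
Qed.

(* The coefficients of [x f'' + f'] for [f = psum c]. *)
Lemma psum_bessel c x : entire c ->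
  x * psum (pseries_diffs (pseries_diffs c)) x + psum (pseries_diffs c) x =
  psum (fun j => j.+1%:R ^+ 2 * c j.+1) x.
Proof.
move=> ec; have ed := entire_diffs ec; have edd := entire_diffs ed.
have es : entire (fun j => if j is j'.+1 then pseries_diffs (pseries_diffs c) j' else 0).
  have -> : (fun j => if j is j'.+1 then pseries_diffs (pseries_diffs c) j' else 0) =
      (fun j => j%:R * pseries_diffs c j).
    by apply/funext => -[|j]; rewrite ?mul0r.
  have [C [M [C0 M0 hc]]] := edd; have [C' [M' [C0' M0' hc']]] := ed.
  (* The extra factor [j] is absorbed by [j <= 2 * 2^j]. *)
  exists (C' * 2), (M' * 2); split; [exact: mulr_ge0|exact: mulr_ge0|move=> j].
  rewrite normrM normr_nat exprMn.
  rewrite [leRHS](_ : _ = (2 * 2 ^+ j) * (C' * (M' ^+ j / j`!%:R))); last by ring.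
  apply: ler_pM => //.
  rewrite -natrX -natrM ler_nat.
  by apply: leq_trans (ltnW (ltn_expl j (isT : (1 < 2)%N))) _; rewrite leq_pmull.
rewrite psum_shift// -psumD//; congr psum; apply/funext => -[|j].
  by rewrite add0r /pseries_diffs expr1n.
by rewrite /pseries_diffs; rewrite -[j.+2%:R in RHS]natr1; ring.
Qed.

End entire_series.

(** * Complex coefficients, componentwise *)

Section complex_series.
Context {R : realType}.
Implicit Types (a b : nat -> R[i]) (z w : R[i]) (s : R).

Definition centire a : Prop :=
  entire (fun j => complex.Re (a j)) /\ entire (fun j => complex.Im (a j)).

Definition cpsum a s : R[i] :=
  psum (fun j => complex.Re (a j)) s +i* psum (fun j => complex.Im (a j)) s.

Lemma complex_ReM z w : complex.Re (z * w) =
  complex.Re z * complex.Re w - complex.Im z * complex.Im w.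
Proof. by case: z => ? ?; case: w. Qed.

Lemma complex_ImM z w : complex.Im (z * w) =
  complex.Re z * complex.Im w + complex.Im z * complex.Re w.
Proof. by case: z => ? ?; case: w. Qed.

Lemma complex_ReD z w : complex.Re (z + w) = complex.Re z + complex.Re w.
Proof. by case: z => ? ?; case: w. Qed.

Lemma complex_ImD z w : complex.Im (z + w) = complex.Im z + complex.Im w.
Proof. by case: z => ? ?; case: w. Qed.

Lemma complex_ext z w : complex.Re z = complex.Re w -> complex.Im z = complex.Im w ->
  z = w.
Proof. by case: z => ? ?; case: w => ? ? /= -> ->. Qed.

Lemma complex_ReZ (x : R) z : complex.Re (x%:C * z) = x * complex.Re z.
Proof. by rewrite complex_ReM /= mul0r subr0. Qed.

Lemma complex_ImZ (x : R) z : complex.Im (x%:C * z) = x * complex.Im z.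
Proof. by rewrite complex_ImM /= mul0r addr0. Qed.

Lemma complex_ReZr (x : R) z : complex.Re (z * x%:C) = complex.Re z * x.
Proof. by rewrite mulrC complex_ReZ mulrC. Qed.

Lemma complex_ImZr (x : R) z : complex.Im (z * x%:C) = complex.Im z * x.
Proof. by rewrite mulrC complex_ImZ mulrC. Qed.

Lemma cmodM z w : cmod (z * w) = cmod z * cmod w.
Proof. by have := Normc.normcM z w; case: z => ? ?; case: w. Qed.

Lemma cmodX z n : cmod (z ^+ n) = cmod z ^+ n.
Proof.
elim: n => [|n IH]; last by rewrite !exprS cmodM IH.
by rewrite !expr0 /cmod/= expr1n expr0n/= addr0 sqrtr1.
Qed.

Lemma cmod_real (x : R) : cmod x%:C = `|x|.
Proof. by rewrite /cmod/= expr0n/= addr0 sqrtr_sqr. Qed.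

Lemma cmod_ge0 z : 0 <= cmod z. Proof. exact: sqrtr_ge0. Qed.

Lemma cmod_gt0 z : z != 0 -> 0 < cmod z.
Proof.
move=> z0; rewrite lt_neqAle cmod_ge0 andbT eq_sym; apply: contra z0 => /eqP h.
by apply/eqP/Normc.eq0_normc; move: h; case: z.
Qed.

Lemma Re_le_cmod z : `|complex.Re z| <= cmod z.
Proof. by apply: norm_le_sqrt; rewrite lerDl sqr_ge0. Qed.

Lemma Im_le_cmod z : `|complex.Im z| <= cmod z.
Proof. by apply: norm_le_sqrt; rewrite lerDr sqr_ge0. Qed.

Lemma centire_cmod a (M : R) : 0 <= M ->
  (forall j, cmod (a j) <= M ^+ j / j`!%:R) -> centire a.
Proof.
move=> M0 h; split; exists 1, M; split=> // j; rewrite mul1r.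
  exact: le_trans (Re_le_cmod _) (h j).
exact: le_trans (Im_le_cmod _) (h j).
Qed.

Lemma centireD a b : centire a -> centire b -> centire (fun j => a j + b j).
Proof.
move=> [ar ai] [br bi]; split.
  by under eq_fun do rewrite complex_ReD; exact: entireD.
by under eq_fun do rewrite complex_ImD; exact: entireD.
Qed.

Lemma centireZ z a : centire a -> centire (fun j => z * a j).
Proof.
move=> [ar ai]; split.
  under eq_fun do rewrite complex_ReM -mulNr.
  by apply: entireD; exact: entireZ.
under eq_fun do rewrite complex_ImM.
by apply: entireD; exact: entireZ.
Qed.

Lemma cpsumD a b s : centire a -> centire b ->
  cpsum (fun j => a j + b j) s = cpsum a s + cpsum b s.
Proof.
move=> [ar ai] [br bi]; apply: complex_ext => /=.
  by under eq_fun do rewrite complex_ReD; rewrite psumD.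
by under eq_fun do rewrite complex_ImD; rewrite psumD.
Qed.

Lemma cpsumZ z a s : centire a -> cpsum (fun j => z * a j) s = z * cpsum a s.
Proof.
move=> [ar ai]; apply: complex_ext; rewrite ?complex_ReM ?complex_ImM /=.
  under eq_fun do rewrite complex_ReM -mulNr.
  by rewrite psumD ?psumZ ?mulNr//; exact: entireZ.
under eq_fun do rewrite complex_ImM.
by rewrite psumD ?psumZ//; exact: entireZ.
Qed.

Lemma csum_cpsum a s : csum (fun j => a j * (s ^+ j)%:C) = cpsum a s.
Proof.
rewrite /csum /cpsum /psum /pseries; congr (limn (series _) +i* limn (series _));
  by apply/funext => j; rewrite ?complex_ReM ?complex_ImM/= mulr0 ?subr0 ?add0r.
Qed.

Lemma nat_complex n : (n%:R : R[i]) = (n%:R : R)%:C.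
Proof. by rewrite rmorph_nat. Qed.

Lemma exp_complex (x : R) n : ((x ^+ n)%:C : R[i]) = x%:C ^+ n.
Proof. by rewrite rmorphXn. Qed.

Lemma inv_complex (x : R) : ((x^-1)%:C : R[i]) = (x%:C)^-1.
Proof. by rewrite fmorphV. Qed.

Lemma mul_complex (x y : R) : ((x * y)%:C : R[i]) = x%:C * y%:C.
Proof. by rewrite rmorphM. Qed.

End complex_series.

(** * The Hankel function as series in the squared radius *)

Section hankel_series.
Context {R : realType}.
Implicit Types (k z : R[i]) (s : R).

(** The natural parameter of the series: [J_0 (k r)] is the sum of [q^j s^j / (j!)^2] in
    [s = r^2]. *)
Definition bessel_q k : R[i] := - (k / 2) ^+ 2.

Definition bessel_coef k j : R[i] := bessel_q k ^+ j * ((j`!%:R ^+ 2)^-1 : R)%:C.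

Definition neumann_coef k j : R[i] := (harmonic_number R j)%:C * bessel_coef k j.

Lemma fact_gt0R j : 0 < j`!%:R :> R. Proof. by rewrite ltr0n fact_gt0. Qed.

(** The Bessel equation in the variable [s = r^2]: by [psum_bessel] the left side lists the
    coefficients of [s f'' + f'], so this reads [4 (s f'' + f') = - k^2 f]. *)
Lemma bessel_coefS k j :
  (j.+1%:R ^+ 2 : R)%:C * bessel_coef k j.+1 = bessel_q k * bessel_coef k j.
Proof.
rewrite /bessel_coef (exprS (bessel_q k)) -!mulrA; rewrite mulrCA; congr (_ * _).
rewrite mulrCA; congr (_ * _); rewrite -rmorphM; congr (_%:C).
have := fact_gt0R j; rewrite factS natrM => f0.
by field; rewrite !gt_eqF.
Qed.

Lemma harmonic_numberS j :
  harmonic_number R j.+1 = harmonic_number R j + j.+1%:R^-1.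
Proof. by rewrite /harmonic_number seriesSr. Qed.

Lemma harmonic_number_ge0 j : 0 <= harmonic_number R j.
Proof. by apply: sumr_ge0 => i _; rewrite /harmonic/= invr_ge0. Qed.

Lemma harmonic_number_le j : harmonic_number R j <= j%:R.
Proof.
elim: j => [|j IH]; first by rewrite /harmonic_number /series/= big_geq.
rewrite harmonic_numberS -[leRHS]natr1 lerD// invf_le1 ?ltr0n//.
by rewrite ler1n.
Qed.

(** The same recurrence with a defect, which comes from the step [1/(j+1)] of the harmonic
    numbers. *)
Lemma neumann_coefS k j :
  (j.+1%:R ^+ 2 : R)%:C * neumann_coef k j.+1 =
  bessel_q k * neumann_coef k j + (j.+1%:R : R)%:C * bessel_coef k j.+1.
Proof.
rewrite /neumann_coef harmonic_numberS rmorphD mulrDl mulrDr; congr (_ + _).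
  by rewrite mulrCA bessel_coefS mulrCA.
by rewrite mulrA -rmorphM; congr (_%:C * _); rewrite expr2 mulfK.
Qed.

Lemma cmod_bessel_coef k j :
  cmod (bessel_coef k j) = cmod (bessel_q k) ^+ j / (j`!%:R ^+ 2).
Proof.
by rewrite cmodM cmodX cmod_real ger0_norm// invr_ge0 sqr_ge0.
Qed.

Lemma leq_fact j : (j <= j`!)%N.
Proof. by case: j => // j; rewrite factS leq_pmulr// fact_gt0. Qed.

Lemma centire_bessel_coef k : centire (bessel_coef k).
Proof.
apply: (@centire_cmod _ _ (cmod (bessel_q k))); first exact: cmod_ge0.
move=> j; rewrite cmod_bessel_coef; apply: ler_wpM2l; first by rewrite exprn_ge0// cmod_ge0.
rewrite lef_pV2 ?posrE ?exprn_gt0 ?fact_gt0R//.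
by rewrite expr2 ler_pMr ?fact_gt0R// ler1n fact_gt0.
Qed.

(** The harmonic number is at most [j], hence at most [j!], and one of the two factorials in the
    denominator absorbs it. *)
Lemma centire_neumann_coef k : centire (neumann_coef k).
Proof.
apply: (@centire_cmod _ _ (cmod (bessel_q k))); first exact: cmod_ge0.
move=> j; rewrite cmodM cmod_real cmod_bessel_coef ger0_norm ?harmonic_number_ge0//.
rewrite mulrCA; apply: ler_wpM2l; first by rewrite exprn_ge0// cmod_ge0.
have f0 := fact_gt0R j.
rewrite expr2 invfM mulrA ler_piMl ?invr_ge0 ?(ltW f0)//.
rewrite ler_pdivrMr// mul1r; apply: le_trans (harmonic_number_le j) _.
by rewrite ler_nat leq_fact.
Qed.

Lemma besselJ0E k s : 0 <= s -> besselJ0 (k * (Num.sqrt s)%:C) = cpsum (bessel_coef k) s.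
Proof.
move=> s0; rewrite -csum_cpsum /besselJ0; congr csum; apply/funext => j.
rewrite /bessel_coef /bessel_q [in RHS]exprNn.
rewrite (_ : s ^+ j = Num.sqrt s ^+ (2 * j)); last by rewrite exprM sqr_sqrtr.
rewrite exp_complex (mulrAC k) exprMn -exprM inv_complex exp_complex -nat_complex.
by ring.
Qed.

Lemma neumann_sumE k s : 0 <= s ->
  csum (fun j => (-1) ^+ j * (harmonic_number R j)%:C *
     (k * (Num.sqrt s)%:C / 2) ^+ (2 * j) / ((j`!)%:R ^+ 2)) = cpsum (neumann_coef k) s.
Proof.
move=> s0; rewrite -csum_cpsum; congr csum; apply/funext => j.
rewrite /neumann_coef /bessel_coef /bessel_q [in RHS]exprNn.
rewrite (_ : s ^+ j = Num.sqrt s ^+ (2 * j)); last by rewrite exprM sqr_sqrtr.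
rewrite exp_complex (mulrAC k) exprMn -exprM inv_complex exp_complex -nat_complex.
by ring.
Qed.

(** A positive factor leaves the principal argument unchanged, so the logarithm splits without a
    branch correction. *)
Lemma clog_scale z s : z != 0 -> 0 < s ->
  clog (z * (Num.sqrt s)%:C) = (ln (cmod z) + ln s / 2) +i* carg z.
Proof.
move=> z0 s0; have r0 : 0 < Num.sqrt s by rewrite sqrtr_gt0.
have c0 := cmod_gt0 z0.
have ln2 : ln s = ln (Num.sqrt s) * 2.
  by rewrite -{1}(sqr_sqrtr (ltW s0)) lnXn// mulr_natr.
rewrite /clog cmodM cmod_real gtr0_norm// lnM ?posrE// ln2 mulfK//.
congr (_ +i* _); rewrite /carg cmodM cmod_real gtr0_norm//.
rewrite !complex_ReM !complex_ImM/= !mulr0 subr0 add0r pmulr_lge0//.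
by rewrite invfM mulrACA divff ?gt_eqF// mulr1.
Qed.

(** In [i Y_0] the logarithm occurs as [(2 i / pi) ln r = (i / pi) ln (r^2)]. *)
Definition hankel_log_coef k j : R[i] := (pi^-1 : R)%:C * 'i%C * bessel_coef k j.

(* The constant that multiplies [J_0] besides the logarithm of [r ^ 2]. *)
Definition hankel_const k : R[i] :=
  1 + 2 * (pi^-1 : R)%:C * 'i%C *
      ((ln (cmod (k / 2)) + euler_gamma R) +i* carg (k / 2)).

Definition hankel_reg_coef k j : R[i] :=
  hankel_const k * bessel_coef k j
  + - (2 * (pi^-1 : R)%:C * 'i%C) * neumann_coef k j.

Lemma centire_hankel_log k : centire (hankel_log_coef k).
Proof. by apply: centireZ; exact: centire_bessel_coef. Qed.

Lemma centire_hankel_reg k : centire (hankel_reg_coef k).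
Proof.
by apply: centireD; apply: centireZ;
  [exact: centire_bessel_coef|exact: centire_neumann_coef].
Qed.

Lemma hankel_log_coefS k j :
  (j.+1%:R ^+ 2 : R)%:C * hankel_log_coef k j.+1 = bessel_q k * hankel_log_coef k j.
Proof. by rewrite mulrCA bessel_coefS mulrCA. Qed.

(** The defect, multiplied by [4], is exactly what cancels the cross term [8 f'] in
    [fundamental2]. *)
Lemma hankel_reg_coefS k j :
  (j.+1%:R ^+ 2 : R)%:C * hankel_reg_coef k j.+1 =
  bessel_q k * hankel_reg_coef k j - 2 * (j.+1%:R : R)%:C * hankel_log_coef k j.+1.
Proof.
rewrite /hankel_reg_coef /hankel_log_coef mulrDr mulrCA bessel_coefS.
rewrite [X in _ + X]mulrCA neumann_coefS.
by ring.
Qed.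

Lemma hankelH0E k s : k != 0 -> 0 < s ->
  hankelH0 (k * (Num.sqrt s)%:C) =
  cpsum (hankel_log_coef k) s * (ln s)%:C + cpsum (hankel_reg_coef k) s.
Proof.
move=> k0 s0; have s0' := ltW s0.
have k20 : k / 2 != 0 by rewrite mulf_neq0// invr_eq0 pnatr_eq0.
have cb := centire_bessel_coef k; have cn := centire_neumann_coef k.
rewrite /hankel_reg_coef cpsumD; [|exact: centireZ|exact: centireZ].
rewrite !cpsumZ// /hankelH0 /besselY0 besselJ0E// neumann_sumE//.
rewrite (mulrAC k) clog_scale//.
set L := ln (cmod _); set th := carg _.
have -> : (L + ln s / 2) +i* th + (euler_gamma R)%:C =
  ((L + euler_gamma R) +i* th) + (ln s)%:C / 2.
  rewrite nat_complex -inv_complex -mul_complex; apply: complex_ext => /=; ring.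
rewrite /hankel_const !mul_complex -nat_complex -/L -/th.
move: (cpsum _ _) (cpsum _ _) (_ +i* _) ((ln s)%:C) ((pi^-1)%:C) 'i%C => F S z l p i.
by field.
Qed.

End hankel_series.

(** * Regular distributions *)

Section regular_distributions.
Context {R : realType} d (X : measurableType d).
Variables (mu : {measure set X -> \bar R}) (box : R -> set X).
Hypothesis mbox : forall B, measurable (box B).
Implicit Types (f g : X -> R) (u v w : X -> R[i]).

Definition box_locally_integrable f : Prop :=
  measurable_fun setT f /\ forall B, 0 < B -> mu.-integrable (box B) (EFin \o f).

Definition cbox_locally_integrable u : Prop :=
  box_locally_integrable (fun x => complex.Re (u x)) /\
  box_locally_integrable (fun x => complex.Im (u x)).

(** What the pairing needs of a test function and of its Laplacian: measurable, bounded and zero off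
    some box. *)
Definition box_supported f : Prop :=
  measurable_fun setT f /\ exists B M : R,
    [/\ 0 < B, 0 <= M, forall x, `|f x| <= M & forall x, ~ box B x -> f x = 0].

Definition cbox_supported w : Prop :=
  box_supported (fun x => complex.Re (w x)) /\
  box_supported (fun x => complex.Im (w x)).

Lemma integrable_box_supported f g :
  box_locally_integrable f -> box_supported g ->
  mu.-integrable setT (EFin \o (fun x => f x * g x)).
Proof.
move=> [mf intf] [mg [B [M [B0 M0 gM g0]]]].
have -> : (EFin \o (fun x => f x * g x)) =
    (EFin \o (fun x => f x * g x)) \_ (box B).
  apply/funext => x; rewrite patchE; case: ifPn => //= xB.
  by rewrite g0 ?mulr0//; move: xB; rewrite notin_setE.
apply/(integrable_mkcond _ (mbox B)).
have mfg : measurable_fun setT (fun x => f x * g x) by exact: measurable_funM.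
apply: (le_integrable (mbox B) _ _ (integrableZl (mbox B) M (intf B B0))).
  by apply/measurable_EFinP; exact: measurable_funTS.
move=> x _ /=; rewrite lee_fin !normrM mulrC (ger0_norm M0).
by apply: ler_wpM2r.
Qed.

Lemma cintegrable_box_supported u w :
  cbox_locally_integrable u -> cbox_supported w ->
  mu.-integrable setT (EFin \o (fun x => complex.Re (u x * w x))) /\
  mu.-integrable setT (EFin \o (fun x => complex.Im (u x * w x))).
Proof.
move=> [ur ui] [wr wi]; split.
  have -> : (fun x => complex.Re (u x * w x)) = (fun x =>
      complex.Re (u x) * complex.Re (w x) - complex.Im (u x) * complex.Im (w x)).
    by apply/funext => x; rewrite complex_ReM.
  exact: (integrableB measurableT (integrable_box_supported ur wr)
    (integrable_box_supported ui wi)).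
have -> : (fun x => complex.Im (u x * w x)) = (fun x =>
    complex.Re (u x) * complex.Im (w x) + complex.Im (u x) * complex.Re (w x)).
  by apply/funext => x; rewrite complex_ImM.
exact: (integrableD measurableT (integrable_box_supported ur wi)
  (integrable_box_supported ui wr)).
Qed.

Lemma box_locally_integrableD f g :
  box_locally_integrable f -> box_locally_integrable g ->
  box_locally_integrable (fun x => f x + g x).
Proof.
move=> [mf intf] [mg intg]; split; first exact: measurable_funD.
by move=> B B0; exact: (integrableD (mbox B) (intf B B0) (intg B B0)).
Qed.

Lemma box_locally_integrableZ (c : R) f :
  box_locally_integrable f -> box_locally_integrable (fun x => c * f x).
Proof.
move=> [mf intf]; split; first by apply: measurable_funM => //; exact: measurable_cst.
by move=> B B0; exact: (integrableZl (mbox B) c (intf B B0)).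
Qed.

Lemma cbox_locally_integrableD u v :
  cbox_locally_integrable u -> cbox_locally_integrable v ->
  cbox_locally_integrable (fun x => u x + v x).
Proof.
move=> [ur ui] [vr vi]; split.
  by under eq_fun do rewrite complex_ReD; exact: box_locally_integrableD.
by under eq_fun do rewrite complex_ImD; exact: box_locally_integrableD.
Qed.

Lemma cbox_locally_integrableZ (c : R[i]) u :
  cbox_locally_integrable u -> cbox_locally_integrable (fun x => c * u x).
Proof.
move=> [ur ui]; split.
  under eq_fun do rewrite complex_ReM -mulNr.
  by apply: box_locally_integrableD; exact: box_locally_integrableZ.
under eq_fun do rewrite complex_ImM.
by apply: box_locally_integrableD; exact: box_locally_integrableZ.
Qed.

Lemma regular_distrD u v w : cbox_locally_integrable u ->
  cbox_locally_integrable v -> cbox_supported w ->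
  regular_distr mu (fun x => u x + v x) w =
  regular_distr mu u w + regular_distr mu v w.
Proof.
move=> lu lv sw; have [ur ui] := cintegrable_box_supported lu sw.
have [vr vi] := cintegrable_box_supported lv sw.
apply: complex_ext => /=.
  by under eq_Rintegral do rewrite mulrDl complex_ReD; rewrite RintegralD.
by under eq_Rintegral do rewrite mulrDl complex_ImD; rewrite RintegralD.
Qed.

Lemma regular_distrZ (c : R[i]) u w : cbox_locally_integrable u -> cbox_supported w ->
  regular_distr mu (fun x => c * u x) w = c * regular_distr mu u w.
Proof.
move=> lu sw; have [ur ui] := cintegrable_box_supported lu sw.
apply: complex_ext; rewrite ?complex_ReM ?complex_ImM /=.
  under eq_Rintegral do rewrite -mulrA complex_ReM.
  rewrite RintegralB//; [by rewrite !RintegralZl|exact: (integrableZl _ _ ur)|].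
  exact: (integrableZl _ _ ui).
under eq_Rintegral do rewrite -mulrA complex_ImM.
rewrite RintegralD//; [by rewrite !RintegralZl|exact: (integrableZl _ _ ui)|].
exact: (integrableZl _ _ ur).
Qed.

Lemma regular_distrE u w : cbox_locally_integrable u -> cbox_supported w ->
  regular_distr mu u w =
  (\int[mu]_x (complex.Re (u x) * complex.Re (w x)) -
   \int[mu]_x (complex.Im (u x) * complex.Im (w x))) +i*
  (\int[mu]_x (complex.Re (u x) * complex.Im (w x)) +
   \int[mu]_x (complex.Im (u x) * complex.Re (w x))).
Proof.
move=> [ur ui] [wr wi]; apply: complex_ext => /=.
  under eq_Rintegral do rewrite complex_ReM.
  by rewrite RintegralB//; exact: integrable_box_supported.
under eq_Rintegral do rewrite complex_ImM.
by rewrite RintegralD//; exact: integrable_box_supported.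
Qed.

Lemma ae_eq_regular_distr u v w : cbox_locally_integrable u ->
  cbox_locally_integrable v -> cbox_supported w ->
  {ae mu, forall x, u x = v x} -> regular_distr mu u w = regular_distr mu v w.
Proof.
move=> lu lv sw uv.
have /= [/integrableP[ur _] /integrableP[ui _]] := cintegrable_box_supported lu sw.
have /= [/integrableP[vr _] /integrableP[vi _]] := cintegrable_box_supported lv sw.
apply: complex_ext => /=; rewrite /Rintegral; congr fine; apply: ae_eq_integral => //;
  by apply: filterS uv => x -> _.
Qed.

(** The complex identity follows from four real ones: each part of the potential against each part
    of the test function, [P] selecting the latter. *)
Lemma helmholtz_complex (kappa c : R[i]) u w lw (v : R[i]) :
  cbox_locally_integrable u -> cbox_supported w -> cbox_supported lw ->
  (forall P : R[i] -> R, P = @complex.Re R \/ P = @complex.Im R ->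
    \int[mu]_x (complex.Re (u x) * P (lw x)) =
    \int[mu]_x (complex.Re (kappa * u x) * P (w x)) + complex.Re c * P v /\
    \int[mu]_x (complex.Im (u x) * P (lw x)) =
    \int[mu]_x (complex.Im (kappa * u x) * P (w x)) + complex.Im c * P v) ->
  regular_distr mu u lw = kappa * regular_distr mu u w + c * v.
Proof.
move=> lu sw slw h.
rewrite -regular_distrZ// regular_distrE// regular_distrE//; last first.
  exact: cbox_locally_integrableZ.
have [rr ir] := h _ (or_introl erefl); have [ri ii] := h _ (or_intror erefl).
apply: complex_ext; rewrite ?complex_ReD ?complex_ImD ?complex_ReM ?complex_ImM/=; rewrite ?rr ?ir ?ri ?ii; ring.
Qed.

End regular_distributions.

Section local_integrability.
Context {R : realType}.

Lemma box_locally_integrable_log2 (a c : R * R -> R) : continuous a -> continuous c ->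
  box_locally_integrable (lam2 R) box2 (fun p => a p * ln (sqr2 p) + c p).
Proof.
move=> ca cc.
have mu_ : measurable_fun [set: measurableTypeR R * measurableTypeR R]
    (fun p => a p * ln (sqr2 p) + c p).
  apply: measurable_funD; last exact: continuous_measurable2.
  apply: measurable_funM; first exact: continuous_measurable2.
  apply: measurableT_comp; first exact: measurable_ln.
  exact: (continuous_measurable2 (@continuous_sqr2 R)).
split=> // B B0.
have [Ma Ma0 hMa] := continuous_bounded_on (@compact_box2 _ B) ca.
have [Mc Mc0 hMc] := continuous_bounded_on (@compact_box2 _ B) cc.
pose K : R := Ma * (2 * B ^+ 2) + Mc.
apply: (@ae_dominated_integrable _ _ _ (lam2 R) (box2 B) _
  (fun p => K + (2 * Ma) * dom2 p)) => //.
  have -> : (EFin \o (fun p => K + 2 * Ma * dom2 p)) =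
      (fun p => (EFin \o cst K) p + (2 * Ma)%:E * (EFin \o dom2) p)%E.
    by apply/funext => p /=; rewrite EFinD EFinM.
  apply: integrableD => //.
    by apply: (@continuous_integrable2 _ (cst K)); exact: continuous_cst_fun.
  by apply: integrableZl => //; exact: integrable_dom2.
apply: ae_lam2W => p p1 p2 pB; have s0 := sqr2_gt0 p1.
rewrite (le_trans (ler_normD _ _))// normrM.
rewrite [leRHS](_ : _ = Ma * (2 * B ^+ 2 + 2 * dom2 p) + Mc); last by rewrite /K; ring.
apply: lerD; last exact: hMc.
apply: ler_pM => //; first exact: hMa.
apply: le_trans (abs_ln_le s0) _; apply: lerD; first exact: sqr2_box.
by rewrite ler_pM2l//; exact: le_dom2.
Qed.

Lemma box_locally_integrable_potential3 (h : R -> R) : continuous h ->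
  box_locally_integrable (lam3 R) box3
    (fun p => h (Num.sqrt (sqr3 p)) * (Num.sqrt (sqr3 p))^-1).
Proof.
move=> ch.
split; first exact: measurable_potential3.
move=> B B0.
pose P : R := Num.sqrt (3 * B ^+ 2).
have [Mh Mh0 hMh] := continuous_bounded_on (@segment_compact _ (- P) P) ch.
apply: (@ae_dominated_integrable _ _ _ (lam3 R) (box3 B) _
  (fun p => (Mh * P) * dom3 p)) => //.
- exact: measurable_potential3.
- exact: integrable_dom3Z.
apply: ae_lam3W => p p1 p2 p3 pB; have s0 := sqr3_gt0 p1.
have v0 : 0 < Num.sqrt (sqr3 p) by rewrite sqrtr_gt0.
rewrite normrM -mulrA normfV (gtr0_norm v0); apply: ler_pM.
- exact: normr_ge0.
- by rewrite invr_ge0 ltW.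
- apply: hMh; rewrite -/(box1 P) box1P gtr0_norm//.
  by apply: ler_wsqrtr; exact: sqr3_box.
- exact: sqrt_inv_le_dom3.
Qed.

End local_integrability.

(** * Hankel functions *)

Section planar_hankel.
Context {R : realType}.
Implicit Types (k : R[i]) (p : R * R) (B : R).

Lemma psum0 (c : nat -> R) : psum c 0 = c 0%N.
Proof.
apply: cvg_lim => //; rewrite -(cvg_shiftS (pseries c 0)).
rewrite (_ : [sequence _]_n = cst (c 0%N)); first exact: cvg_cst.
apply/funext => n; rewrite /pseries/= /series/= big_nat_recl//= expr0 mulr1.
by rewrite big1 ?addr0// => i _; rewrite expr0n/= mulr0.
Qed.

(** [c'] and [d'] are separate sequences because multiplication by the complex [bessel_q k] mixes
    real and imaginary parts. The term [- 2 (j+1) c_(j+1)] removes the cross term [8 f']. *)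
Lemma fundamental2_series B (c d c' d' : nat -> R) psi px pxx py pyy : 0 < B ->
  entire c -> entire d -> entire c' -> entire d' ->
  (forall j, j.+1%:R ^+ 2 * c j.+1 = c' j) ->
  (forall j, j.+1%:R ^+ 2 * d j.+1 = d' j - 2 * (j.+1%:R * c j.+1)) ->
  planar_test B psi px pxx py pyy ->
  \int[lam2 R]_(p in box2 B)
    ((psum c (sqr2 p) * ln (sqr2 p) + psum d (sqr2 p)) * (pxx p + pyy p)) =
  \int[lam2 R]_(p in box2 B)
    (4 * (psum c' (sqr2 p) * ln (sqr2 p) + psum d' (sqr2 p)) * psi p)
  + 4 * pi * (c 0%N * psi 0).
Proof.
move=> B0 ec ed ec' ed' hc hd T.
have ec1 := entire_diffs ec; have ec2 := entire_diffs ec1.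
have ed1 := entire_diffs ed; have ed2 := entire_diffs ed1.
rewrite (fundamental2 B0 (fun s => @der_psum R _ s ec) (fun s => @der_psum R _ s ec1) (continuous_psum ec2)
  (fun s => @der_psum R _ s ed) (fun s => @der_psum R _ s ed1) (continuous_psum ed2) T) psum0.
congr (_ + _); apply: eq_Rintegral => p _; rewrite !psum_bessel//.
have -> : (fun j => j.+1%:R ^+ 2 * c j.+1) = c' by apply/funext.
have -> : (fun j => j.+1%:R ^+ 2 * d j.+1) =
    (fun j => d' j + (-2) * pseries_diffs c j).
  by apply/funext => j; rewrite hd /pseries_diffs mulNr.
rewrite psumD ?psumZ//; last exact: entireZ.
by ring.
Qed.

(** Equal to [H_0^(1)(k r)] off the origin, in the form that [fundamental2] handles. *)
Definition planar_formula k (p : R * R) : R[i] :=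
  cpsum (hankel_log_coef k) (sqr2 p) * (ln (sqr2 p))%:C +
  cpsum (hankel_reg_coef k) (sqr2 p).

Lemma planar_formula_Re k p : complex.Re (planar_formula k p) =
  psum (fun j => complex.Re (hankel_log_coef k j)) (sqr2 p) * ln (sqr2 p) +
  psum (fun j => complex.Re (hankel_reg_coef k j)) (sqr2 p).
Proof. by rewrite complex_ReD complex_ReZr. Qed.

Lemma planar_formula_Im k p : complex.Im (planar_formula k p) =
  psum (fun j => complex.Im (hankel_log_coef k j)) (sqr2 p) * ln (sqr2 p) +
  psum (fun j => complex.Im (hankel_reg_coef k j)) (sqr2 p).
Proof. by rewrite complex_ImD complex_ImZr. Qed.

(** The logarithmic series starts with [i / pi], so the point mass is [4 pi (i / pi) = 4 i], purely
    imaginary: only the second identity contains it. *)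
Lemma planar_formula_helmholtz k B psi px pxx py pyy : 0 < B ->
  planar_test B psi px pxx py pyy ->
  \int[lam2 R]_(p in box2 B) (complex.Re (planar_formula k p) * (pxx p + pyy p)) =
  \int[lam2 R]_(p in box2 B) (complex.Re (- k ^+ 2 * planar_formula k p) * psi p) /\
  \int[lam2 R]_(p in box2 B) (complex.Im (planar_formula k p) * (pxx p + pyy p)) =
  \int[lam2 R]_(p in box2 B) (complex.Im (- k ^+ 2 * planar_formula k p) * psi p)
  + 4 * psi 0.
Proof.
move=> B0 T.
have el := centire_hankel_log k; have er := centire_hankel_reg k.
have [elr eli] := el; have [err eri] := er.
have [eqlr eqli] := centireZ (bessel_q k) el.
have [eqrr eqri] := centireZ (bessel_q k) er.
have kq : - k ^+ 2 = (4 : R)%:C * bessel_q k.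
  by rewrite -nat_complex /bessel_q exprMn exprVn; field.
have l0 : hankel_log_coef k 0 = 0 +i* pi^-1.
  rewrite /hankel_log_coef /bessel_coef expr0 mul1r expr1n invr1 mulr1.
  by apply: complex_ext => /=; ring.
have qE p : bessel_q k * planar_formula k p =
    cpsum (fun j => bessel_q k * hankel_log_coef k j) (sqr2 p) * (ln (sqr2 p))%:C +
    cpsum (fun j => bessel_q k * hankel_reg_coef k j) (sqr2 p).
  by rewrite (cpsumZ _ _ el) (cpsumZ _ _ er) /planar_formula mulrDr mulrA.
have ReS (a b : R) z w z' : a%:C * z = w - 2 * b%:C * z' ->
    a * complex.Re z = complex.Re w - 2 * (b * complex.Re z').
  rewrite nat_complex -mul_complex => /(congr1 (@complex.Re R)).
  by rewrite complex_ReD raddfN/= !complex_ReZ mulrA.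
have ImS (a b : R) z w z' : a%:C * z = w - 2 * b%:C * z' ->
    a * complex.Im z = complex.Im w - 2 * (b * complex.Im z').
  rewrite nat_complex -mul_complex => /(congr1 (@complex.Im R)).
  by rewrite complex_ImD raddfN/= !complex_ImZ mulrA.
have RelS j : j.+1%:R ^+ 2 * complex.Re (hankel_log_coef k j.+1) =
    complex.Re (bessel_q k * hankel_log_coef k j).
  by rewrite -hankel_log_coefS [RHS]complex_ReZ.
have ImlS j : j.+1%:R ^+ 2 * complex.Im (hankel_log_coef k j.+1) =
    complex.Im (bessel_q k * hankel_log_coef k j).
  by rewrite -hankel_log_coefS [RHS]complex_ImZ.
split.
  have := fundamental2_series B0 elr err eqlr eqrr RelS
    (fun j => ReS _ _ _ _ _ (hankel_reg_coefS k j)) T.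
  rewrite l0 [complex.Re _]/= mul0r mulr0 addr0 => h.
  under eq_Rintegral do rewrite planar_formula_Re.
  rewrite h; apply: eq_Rintegral => p _; congr (_ * _).
  by rewrite kq -mulrA qE complex_ReZ complex_ReD complex_ReZr.
have := fundamental2_series B0 eli eri eqli eqri ImlS
  (fun j => ImS _ _ _ _ _ (hankel_reg_coefS k j)) T.
rewrite l0 => h.
under eq_Rintegral do rewrite planar_formula_Im.
rewrite h; congr (_ + _).
  apply: eq_Rintegral => p _; congr (_ * _).
  by rewrite kq -mulrA qE complex_ImZ complex_ImD complex_ImZr.
by rewrite /= -!mulrA mulVKf ?gt_eqF ?pi_gt0//; exact: lt0r_neq0 (pi_gt0 R).
Qed.

Lemma cbox_locally_integrable_planar_formula k :
  cbox_locally_integrable (lam2 R) box2 (planar_formula k).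
Proof.
have [[lr li] [rr ri]] := (centire_hankel_log k, centire_hankel_reg k).
have rad (c : nat -> R) : entire c -> continuous (fun p => psum c (sqr2 p)).
  by move=> ec; apply: continuous_radial2 => s _; exact: continuous_psum.
split.
  by under eq_fun do rewrite planar_formula_Re; apply: box_locally_integrable_log2; exact: rad.
by under eq_fun do rewrite planar_formula_Im; apply: box_locally_integrable_log2; exact: rad.
Qed.

Definition planar_hankel k (p : R * R) : R[i] := hankelH0 (k * (radius2 p)%:C).

Lemma planar_hankelE k p : k != 0 -> p.1 != 0 -> planar_hankel k p = planar_formula k p.
Proof. by move=> k0 p1; rewrite /planar_hankel hankelH0E//; exact: sqr2_gt0. Qed.

Lemma planar_hankelE0 k p : k != 0 -> p != 0 -> planar_hankel k p = planar_formula k p.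
Proof.
move=> k0 p0; rewrite /planar_hankel hankelH0E// lt_neqAle sqr2_ge0 andbT eq_sym.
apply: contra p0; rewrite paddr_eq0 ?sqr_ge0// !sqrf_eq0.
by case: p => x y /= /andP[/eqP -> /eqP ->].
Qed.

(* [planar_hankel] and [planar_formula] differ at the origin only, which gives
   measurability. *)
Lemma cbox_locally_integrable_planar_hankel k : k != 0 ->
  cbox_locally_integrable (lam2 R) box2 (planar_hankel k).
Proof.
move=> k0.
have [[mr ir] [mi ii]] := cbox_locally_integrable_planar_formula k.
pose O : set (measurableTypeR R * measurableTypeR R) := [set 0] `*` [set 0].
have mO : measurable O by apply: measurableX; exact: measurable_set1.
have key (P : R[i] -> R) : (forall z w, P (z + w) = P z + P w) ->
    box_locally_integrable (lam2 R) box2 (fun p => P (planar_formula k p)) ->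
    box_locally_integrable (lam2 R) box2 (fun p => P (planar_hankel k p)).
  move=> PD [mP iP].
  have mH : measurable_fun [set: measurableTypeR R * measurableTypeR R]
      (fun p => P (planar_hankel k p)).
    have -> : (fun p => P (planar_hankel k p)) = (fun p => P (planar_formula k p) +
        (P (planar_hankel k 0) - P (planar_formula k 0)) * \1_O p).
      apply/funext => p; rewrite indicE; have [->|p0] := eqVneq p 0.
        by rewrite mem_set//= mulr1 addrC subrK.
      rewrite memNset; first by rewrite mulr0 addr0 planar_hankelE0.
      by case: p p0 => x y p0 [/= x0 y0]; move: p0; rewrite x0 y0 eqxx.
    by apply: measurable_funD => //; apply: measurable_funM.
  split=> // B B0.
  apply: (@ae_dominated_integrable _ _ _ (lam2 R) (box2 B) _
    (fun p => `|P (planar_formula k p)|)) => //.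
    exact: integrable_norm (iP B B0).
  by apply: ae_lam2W => p p1 p2 _; rewrite planar_hankelE.
by split; apply: key => //; [exact: complex_ReD|exact: complex_ImD].
Qed.

End planar_hankel.

(** * The spherical Hankel function *)

Section spatial_hankel.
Context {R : realType}.
Implicit Types (k z : R[i]) (p : R * R * R) (B : R).

Definition cder (f : R -> R[i]) (t : R) (a : R[i]) : Prop :=
  der (fun t => complex.Re (f t)) t (complex.Re a) /\
  der (fun t => complex.Im (f t)) t (complex.Im a).

Lemma cderZ z (f : R -> R[i]) t a : cder f t a -> cder (fun t => z * f t) t (z * a).
Proof.
move=> [dr di]; split.
  rewrite (_ : (fun t => complex.Re (z * f t)) =
    (fun t => complex.Re z * complex.Re (f t) - complex.Im z * complex.Im (f t))).
    by rewrite complex_ReM; apply: derB; exact: derZ.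
  by apply/funext => u; rewrite complex_ReM.
rewrite (_ : (fun t => complex.Im (z * f t)) =
  (fun t => complex.Re z * complex.Im (f t) + complex.Im z * complex.Re (f t))).
  by rewrite complex_ImM; apply: derD; exact: derZ.
by apply/funext => u; rewrite complex_ImM.
Qed.

Lemma cder_cexp z t : cder (fun t => cexp (z * t%:C)) t (z * cexp (z * t%:C)).
Proof.
have dR : der (fun t => complex.Re (z * t%:C)) t (complex.Re z).
  under eq_fun do rewrite complex_ReZr.
  by apply: der_eq; [apply: derZ; exact: der_id|rewrite mulr1].
have dI : der (fun t => complex.Im (z * t%:C)) t (complex.Im z).
  under eq_fun do rewrite complex_ImZr.
  by apply: der_eq; [apply: derZ; exact: der_id|rewrite mulr1].
have dE : der (fun t => expR (complex.Re (z * t%:C))) t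
    (expR (complex.Re (z * t%:C)) * complex.Re z).
  by apply: (@der_comp _ expR (fun t => complex.Re (z * t%:C))) => //; exact: is_derive_expR.
have dC : der (fun t => cos (complex.Im (z * t%:C))) t
    (- sin (complex.Im (z * t%:C)) * complex.Im z).
  by apply: (@der_comp _ cos (fun t => complex.Im (z * t%:C))) => //; exact: is_derive_cos.
have dS : der (fun t => sin (complex.Im (z * t%:C))) t
    (cos (complex.Im (z * t%:C)) * complex.Im z).
  by apply: (@der_comp _ sin (fun t => complex.Im (z * t%:C))) => //; exact: is_derive_sin.
have RE w : complex.Re (cexp w) = expR (complex.Re w) * cos (complex.Im w).
  by rewrite /cexp complex_ReZ.
have IE w : complex.Im (cexp w) = expR (complex.Re w) * sin (complex.Im w).
  by rewrite /cexp complex_ImZ.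
split.
  under eq_fun do rewrite RE.
  by apply: der_eq; [apply: derM; [exact: dE|exact: dC]|rewrite [RHS]complex_ReM RE IE; ring].
under eq_fun do rewrite IE.
by apply: der_eq; [apply: derM; [exact: dE|exact: dS]|rewrite [RHS]complex_ImM RE IE; ring].
Qed.

(** The product [r h_0^(1)(k r)], smooth in [r]: the numerator [f] of [f(r)/r]. *)
Definition spherical_wave k (t : R) : R[i] := - 'i%C / k * cexp (('i%C * k) * t%:C).

Lemma cder_spherical_wave k t :
  cder (spherical_wave k) t ('i%C * k * spherical_wave k t).
Proof. by rewrite /spherical_wave mulrCA; apply: cderZ; exact: cder_cexp. Qed.

Lemma spherical_wave0 k : spherical_wave k 0 = - 'i%C / k.
Proof.
rewrite /spherical_wave (_ : 0%:C = 0 :> R[i])// mulr0 /cexp/= expR0 cos0 sin0.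
by rewrite [X in _ * X](_ : _ = 1) ?mulr1//; apply: complex_ext => /=; ring.
Qed.

Definition spatial_hankel k (p : R * R * R) : R[i] := sph_hankelh0 (k * (radius3 p)%:C).

(** Valid at the origin too, where the convention [0^-1 = 0] makes both sides [0]; hence
    measurability follows from that of [f(r)/r] directly. *)
Lemma spatial_hankelE k p : spatial_hankel k p =
  spherical_wave k (Num.sqrt (sqr3 p)) * ((Num.sqrt (sqr3 p))^-1)%:C.
Proof.
rewrite /spatial_hankel /sph_hankelh0 /spherical_wave inv_complex.
rewrite -[radius3 p]/(Num.sqrt (sqr3 p)) (mulrA 'i%C) invfM (mulrA (- 'i%C)).
by rewrite mulrAC.
Qed.

Lemma spatial_hankel_Re k p : complex.Re (spatial_hankel k p) =
  complex.Re (spherical_wave k (Num.sqrt (sqr3 p))) * (Num.sqrt (sqr3 p))^-1.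
Proof. by rewrite spatial_hankelE complex_ReZr. Qed.

Lemma spatial_hankel_Im k p : complex.Im (spatial_hankel k p) =
  complex.Im (spherical_wave k (Num.sqrt (sqr3 p))) * (Num.sqrt (sqr3 p))^-1.
Proof. by rewrite spatial_hankelE complex_ImZr. Qed.

Lemma cbox_locally_integrable_spatial_hankel k :
  cbox_locally_integrable (lam3 R) box3 (spatial_hankel k).
Proof.
have dr t := (cder_spherical_wave k t).1; have di t := (cder_spherical_wave k t).2.
split.
  under eq_fun do rewrite spatial_hankel_Re.
  apply: (@box_locally_integrable_potential3 _ (fun t => complex.Re (spherical_wave k t))).
  exact: der_continuousT dr.
under eq_fun do rewrite spatial_hankel_Im.
apply: (@box_locally_integrable_potential3 _ (fun t => complex.Im (spherical_wave k t))).
exact: der_continuousT di.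
Qed.

(** Two derivatives multiply [spherical_wave] by [(i k)^2 = - k^2], and its value [- i / k] at [0]
    turns the mass [- 4 pi f(0)] into [4 pi i / k]. *)
Lemma spatial_hankel_helmholtz k B psi px pxx py pyy pz pzz : 0 < B ->
  spatial_test B psi px pxx py pyy pz pzz ->
  \int[lam3 R]_(p in box3 B)
    (complex.Re (spatial_hankel k p) * (pxx p + pyy p + pzz p)) =
  \int[lam3 R]_(p in box3 B) (complex.Re (- k ^+ 2 * spatial_hankel k p) * psi p)
  + complex.Re (4 * (pi : R)%:C * 'i%C / k) * psi 0 /\
  \int[lam3 R]_(p in box3 B)
    (complex.Im (spatial_hankel k p) * (pxx p + pyy p + pzz p)) =
  \int[lam3 R]_(p in box3 B) (complex.Im (- k ^+ 2 * spatial_hankel k p) * psi p)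
  + complex.Im (4 * (pi : R)%:C * 'i%C / k) * psi 0.
Proof.
move=> B0 T.
have d1 := cder_spherical_wave k.
have d2 t := cderZ ('i%C * k) (d1 t).
have ii : 'i%C * k * ('i%C * k) = - k ^+ 2.
  by rewrite mulrACA -expr2 sqr_i mulN1r -expr2.
have cc := fun t => cderZ ('i%C * k) (d2 t).
have E4 : 4 * (pi : R)%:C * 'i%C / k = (4 * pi)%:C * (- spherical_wave k 0).
  rewrite spherical_wave0 mul_complex -nat_complex.
  by rewrite mulNr opprK !mulrA.
have qE p : - k ^+ 2 * spatial_hankel k p =
    ('i%C * k * ('i%C * k * spherical_wave k (Num.sqrt (sqr3 p)))) *
    ((Num.sqrt (sqr3 p))^-1)%:C.
  by rewrite spatial_hankelE -ii !mulrA.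
split.
  have := fundamental3 B0 (fun t => (d1 t).1) (fun t => (d2 t).1)
    (der_continuousT (fun t => (cc t).1)) T.
  move=> h; under eq_Rintegral do rewrite spatial_hankel_Re mulrC.
  rewrite h E4 complex_ReZ raddfN/= mulrN mulNr mulrA; congr (_ - _).
  by apply: eq_Rintegral => p _; rewrite qE complex_ReZr mulrC.
have := fundamental3 B0 (fun t => (d1 t).2) (fun t => (d2 t).2)
  (der_continuousT (fun t => (cc t).2)) T.
move=> h; under eq_Rintegral do rewrite spatial_hankel_Im mulrC.
rewrite h E4 complex_ImZ raddfN/= mulrN mulNr mulrA; congr (_ - _).
by apply: eq_Rintegral => p _; rewrite qE complex_ImZr mulrC.
Qed.

End spatial_hankel.

(** * Test functions *)

Section directional.
Context {R : realType} {E : normedModType R}.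
Implicit Types (f : E -> R) (v : E) (g : R -> E).

(** Along a line parallel to [v] the two difference quotients coincide as functions of [h]. *)
Lemma is_derive_line f g v x a : (forall h, g (h + x) = h *: v + g x) ->
  is_derive (g x) v f a <-> der (f \o g) x a.
Proof.
move=> gE.
have EQ : (fun h => h^-1 *: ((f \o shift (g x)) (h *: v) - f (g x))) =
    (fun h => h^-1 *: (((f \o g) \o shift x) (h *: (1 : R)) - (f \o g) x)).
  by apply/funext => h; rewrite /= -gE /GRing.scale/= mulr1.
split=> -[df dv]; split.
- by move: df; rewrite /derivable EQ.
- by rewrite -dv /derive EQ.
- by move: df; rewrite /derivable EQ.
- by rewrite -dv /derive EQ.
Qed.

Lemma der_line f g v x : (forall h, g (h + x) = h *: v + g x) ->
  derivable f (g x) v -> der (fun t => f (g t)) x ('D_v f (g x)).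
Proof. by move=> gE df; apply/(is_derive_line _ _ gE); exact: derivableP. Qed.

(** Openness matters: near each point of [O] the function is constantly zero, so the next derivative
    vanishes there too. *)
Lemma iter_partial_eq0 (O : set E) f (vs : seq E) : open O ->
  (forall x, O x -> f x = 0) -> forall x, O x -> iter_partial vs f x = 0.
Proof.
move=> oO f0; elim: vs => [|v vs IH] x Ox /=; first exact: f0.
rewrite (@near_eq_derive _ _ _ _ (cst 0)) ?derive_cst//.
by near=> y; apply: IH; near: y; exact: open_nbhs_nbhs.
Unshelve. all: by end_near. Qed.

Lemma open_norm_gt (B : R) : open [set x : E | B < `|x|].
Proof.
apply: (@open_comp _ _ (fun x : E => `|x|) [set r | B < r]).
  by move=> x _; exact: norm_continuous.
exact: open_gt.
Qed.

Lemma compact_norm_bound (K : set E) : compact K ->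
  exists2 B : R, 0 < B & forall x, K x -> `|x| <= B.
Proof.
move=> /compact_bounded [M [_ hM]]; exists (`|M| + 1); first by rewrite ltr_pwDr.
by move=> x; apply: hM; rewrite (le_lt_trans (ler_norm _))// ltrDl.
Qed.

Lemma compact_support_bound (phi : E -> R[i]) :
  compact (closure [set x | phi x != 0]) ->
  exists2 B : R, 0 < B & forall x, B < `|x| -> phi x = 0.
Proof.
move=> /compact_norm_bound[B B0 hB]; exists B => // x hx.
apply/eqP; apply: contraTT hx => phi0; rewrite -leNgt.
by apply: hB; exact: subset_closure.
Qed.

End directional.

Section test_functions.
Context {R : realType}.

Lemma box2_norm B (p : R * R) : box2 B p = (`|p| <= B) :> Prop.
Proof.
rewrite /box2 /setX/= !box1P prod_normE ge_max.
by apply/propext; split => [[-> ->]|/andP[]].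
Qed.

Lemma box3_norm B (p : R * R * R) : box3 B p = (`|p| <= B) :> Prop.
Proof.
rewrite /box3 /setX/= box1P [`|p|]prod_normE ge_max; apply/propext.
by split=> [[]|/andP[]]; rewrite box2_norm => -> ->.
Qed.

(** The box has half-side [B + 1] so that its boundary lies in the open set [B < |p|], where [psi]
    vanishes with all its derivatives. *)
Lemma smooth2_test (psi : R * R -> R) (B : R) : smooth (basis2 R) psi -> 0 < B ->
  (forall p, B < `|p| -> psi p = 0) ->
  [/\ exists px pxx py pyy, planar_test (B + 1) psi px pxx py pyy /\
        forall p, real_laplacian (basis2 R) psi p = pxx p + pyy p,
      box_supported box2 psi, box_supported box2 (real_laplacian (basis2 R) psi) &
      forall p, ~ box2 (B + 1) p -> psi p = 0 /\ real_laplacian (basis2 R) psi p = 0].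
Proof.
move=> spsi B0 psi0.
have e1 : (1, 0) \in basis2 R by rewrite inE eqxx.
have e2 : (0, 1) \in basis2 R by rewrite !inE eqxx orbT.
have van vs p : B < `|p| -> iter_partial vs psi p = 0.
  by apply: (@iter_partial_eq0 _ _ [set x | B < `|x|]); [exact: open_norm_gt|exact: psi0].
have [c0 d0] := spsi [::] isT.
have m1 v : v \in basis2 R -> all (mem (basis2 R)) [:: v] by move=> vb; rewrite /= vb.
have m2 v : v \in basis2 R -> all (mem (basis2 R)) [:: v; v].
  by move=> vb; rewrite /= vb.
have [c1 d1] := spsi _ (m1 _ e1); have [c2 d2] := spsi _ (m1 _ e2).
have [c11 _] := spsi _ (m2 _ e1); have [c22 _] := spsi _ (m2 _ e2).
have g1 x y h : (h + x, y) = h *: ((1, 0) : R * R) + (x, y).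
  by congr pair; rewrite /= /GRing.scale/= ?mulr1 ?mulr0 ?add0r.
have g2 x y h : (x, h + y) = h *: ((0, 1) : R * R) + (x, y).
  by congr pair; rewrite /= /GRing.scale/= ?mulr1 ?mulr0 ?add0r.
have nx (e y : R) : `|e| = B + 1 -> B < `|(e, y)|.
  by move=> eB; rewrite prod_normE lt_max/= eB ltrDl ltr01.
have ny (x e : R) : `|e| = B + 1 -> B < `|(x, e)|.
  by move=> eB; rewrite prod_normE lt_max/= eB ltrDl ltr01 orbT.
have T : planar_test (B + 1) psi ('D_(1, 0) psi) ('D_(1, 0) ('D_(1, 0) psi))
        ('D_(0, 1) psi) ('D_(0, 1) ('D_(0, 1) psi)).
  split.
  - exact: c0.
  - exact: c1.
  - exact: c11.
  - exact: c2.
  - exact: c22.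
  - by move=> x y; apply: (der_line (g := fun x => (x, y))); [exact: g1|exact: (d0 _ _ e1)].
  - by move=> x y; apply: (der_line (g := fun x => (x, y))); [exact: g1|exact: (d1 _ _ e1)].
  - by move=> x y; apply: (der_line (g := fun y => (x, y))); [exact: g2|exact: (d0 _ _ e2)].
  - by move=> x y; apply: (der_line (g := fun y => (x, y))); [exact: g2|exact: (d2 _ _ e2)].
  - by move=> e y eB; split; [exact: psi0 (nx _ _ eB)|exact: (van [:: (1, 0)]) (nx _ _ eB)].
  - by move=> e x eB; split; [exact: psi0 (ny _ _ eB)|exact: (van [:: (0, 1)]) (ny _ _ eB)].
have lE p : real_laplacian (basis2 R) psi p =
    'D_(1, 0) ('D_(1, 0) psi) p + 'D_(0, 1) ('D_(0, 1) psi) p.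
  by rewrite /real_laplacian /basis2 big_cons big_cons big_nil [X in _ + X]addr0.
have off p : ~ box2 (B + 1) p -> psi p = 0 /\ real_laplacian (basis2 R) psi p = 0.
  rewrite box2_norm => /negP; rewrite -ltNge => hp.
  have {}hp : B < `|p| by apply: lt_trans hp; rewrite ltrDl.
  split; first exact: psi0.
  have v1 : 'D_(1, 0) ('D_(1, 0) psi) p = 0 := van [:: (1, 0); (1, 0)] p hp.
  have v2 : 'D_(0, 1) ('D_(0, 1) psi) p = 0 := van [:: (0, 1); (0, 1)] p hp.
  by rewrite lE v1 v2 addr0.
have supp f : continuous f -> (forall p, ~ box2 (B + 1) p -> f p = 0) ->
    box_supported box2 f.
  move=> cf f0; split; first exact: continuous_measurable2.
  have [M M0 hM] := continuous_bounded_on (@compact_box2 _ (B + 1)) cf.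
  exists (B + 1), M; split=> //; [exact: addr_gt0|exact: ltW|].
  move=> p; have [pB|/f0 ->] := pselect (box2 (B + 1) p); first exact: hM.
  by rewrite normr0 ltW.
split; [by do 4!eexists; split; [exact: T|exact: lE]|by apply: supp => // p /off[]| |exact: off].
apply: supp; last by move=> p /off[].
have -> : real_laplacian (basis2 R) psi =
    (fun p => 'D_(1, 0) ('D_(1, 0) psi) p + 'D_(0, 1) ('D_(0, 1) psi) p).
  by apply/funext => p; exact: lE.
exact: (continuous_add c11 c22).
Qed.

Lemma smooth3_test (psi : R * R * R -> R) (B : R) : smooth (basis3 R) psi -> 0 < B ->
  (forall p, B < `|p| -> psi p = 0) ->
  [/\ exists px pxx py pyy pz pzz, spatial_test (B + 1) psi px pxx py pyy pz pzz /\
        forall p, real_laplacian (basis3 R) psi p = pxx p + pyy p + pzz p,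
      box_supported box3 psi, box_supported box3 (real_laplacian (basis3 R) psi) &
      forall p, ~ box3 (B + 1) p -> psi p = 0 /\ real_laplacian (basis3 R) psi p = 0].
Proof.
move=> spsi B0 psi0.
have e1 : (1, 0, 0) \in basis3 R by rewrite inE eqxx.
have e2 : (0, 1, 0) \in basis3 R by rewrite !inE eqxx orbT.
have e3 : (0, 0, 1) \in basis3 R by rewrite !inE eqxx !orbT.
have van vs p : B < `|p| -> iter_partial vs psi p = 0.
  by apply: (@iter_partial_eq0 _ _ [set x | B < `|x|]); [exact: open_norm_gt|exact: psi0].
have [c0 d0] := spsi [::] isT.
have m1 v : v \in basis3 R -> all (mem (basis3 R)) [:: v] by move=> vb; rewrite /= vb.
have m2 v : v \in basis3 R -> all (mem (basis3 R)) [:: v; v].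
  by move=> vb; rewrite /= vb.
have [c1 d1] := spsi _ (m1 _ e1); have [c2 d2] := spsi _ (m1 _ e2).
have [c3 d3] := spsi _ (m1 _ e3).
have [c11 _] := spsi _ (m2 _ e1); have [c22 _] := spsi _ (m2 _ e2).
have [c33 _] := spsi _ (m2 _ e3).
have g1 x y z h : (h + x, y, z) = h *: ((1, 0, 0) : R * R * R) + (x, y, z).
  by congr (_, _, _); rewrite /= /GRing.scale/= ?mulr1 ?mulr0 ?add0r.
have g2 x y z h : (x, h + y, z) = h *: ((0, 1, 0) : R * R * R) + (x, y, z).
  by congr (_, _, _); rewrite /= /GRing.scale/= ?mulr1 ?mulr0 ?add0r.
have g3 x y z h : (x, y, h + z) = h *: ((0, 0, 1) : R * R * R) + (x, y, z).
  by congr (_, _, _); rewrite /= /GRing.scale/= ?mulr1 ?mulr0 ?add0r.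
have nx (e y z : R) : `|e| = B + 1 -> B < `|(e, y, z)|.
  by move=> eB; rewrite !prod_normE !lt_max/= eB ltrDl ltr01.
have ny (x e z : R) : `|e| = B + 1 -> B < `|(x, e, z)|.
  by move=> eB; rewrite !prod_normE !lt_max/= eB ltrDl ltr01 orbT.
have nz (x y e : R) : `|e| = B + 1 -> B < `|(x, y, e)|.
  by move=> eB; rewrite !prod_normE !lt_max/= eB ltrDl ltr01 orbT.
have T : spatial_test (B + 1) psi
        ('D_(1, 0, 0) psi) ('D_(1, 0, 0) ('D_(1, 0, 0) psi))
        ('D_(0, 1, 0) psi) ('D_(0, 1, 0) ('D_(0, 1, 0) psi))
        ('D_(0, 0, 1) psi) ('D_(0, 0, 1) ('D_(0, 0, 1) psi)).
  split.
  - exact: c0.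
  - exact: c1.
  - exact: c11.
  - exact: c2.
  - exact: c22.
  - exact: c3.
  - exact: c33.
  - by move=> x y z; apply: (der_line (g := fun x => (x, y, z))); [exact: g1|exact: (d0 _ _ e1)].
  - by move=> x y z; apply: (der_line (g := fun x => (x, y, z))); [exact: g1|exact: (d1 _ _ e1)].
  - by move=> x y z; apply: (der_line (g := fun y => (x, y, z))); [exact: g2|exact: (d0 _ _ e2)].
  - by move=> x y z; apply: (der_line (g := fun y => (x, y, z))); [exact: g2|exact: (d2 _ _ e2)].
  - by move=> x y z; apply: (der_line (g := fun z => (x, y, z))); [exact: g3|exact: (d0 _ _ e3)].
  - by move=> x y z; apply: (der_line (g := fun z => (x, y, z))); [exact: g3|exact: (d3 _ _ e3)].
  - by move=> e y z eB; split; [exact: psi0 (nx _ _ _ eB)|exact: (van [:: (1, 0, 0)]) (nx _ _ _ eB)].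
  - by move=> e x z eB; split; [exact: psi0 (ny _ _ _ eB)|exact: (van [:: (0, 1, 0)]) (ny _ _ _ eB)].
  - by move=> e x y eB; split; [exact: psi0 (nz _ _ _ eB)|exact: (van [:: (0, 0, 1)]) (nz _ _ _ eB)].
have lE p : real_laplacian (basis3 R) psi p =
    'D_(1, 0, 0) ('D_(1, 0, 0) psi) p + 'D_(0, 1, 0) ('D_(0, 1, 0) psi) p +
    'D_(0, 0, 1) ('D_(0, 0, 1) psi) p.
  rewrite /real_laplacian /basis3 big_cons big_cons big_cons big_nil.
  by rewrite [X in _ + (_ + X)]addr0 addrA.
have off p : ~ box3 (B + 1) p -> psi p = 0 /\ real_laplacian (basis3 R) psi p = 0.
  rewrite box3_norm => /negP; rewrite -ltNge => hp.
  have {}hp : B < `|p| by apply: lt_trans hp; rewrite ltrDl.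
  split; first exact: psi0.
  have v1 : 'D_(1, 0, 0) ('D_(1, 0, 0) psi) p = 0 := van [:: (1, 0, 0); (1, 0, 0)] p hp.
  have v2 : 'D_(0, 1, 0) ('D_(0, 1, 0) psi) p = 0 := van [:: (0, 1, 0); (0, 1, 0)] p hp.
  have v3 : 'D_(0, 0, 1) ('D_(0, 0, 1) psi) p = 0 := van [:: (0, 0, 1); (0, 0, 1)] p hp.
  have add3 (a b c : R) : a = 0 -> b = 0 -> c = 0 -> a + b + c = 0.
    by move=> -> -> ->; rewrite !addr0.
  exact: (eq_trans (lE p) (add3 _ _ _ v1 v2 v3)).
have supp f : continuous f -> (forall p, ~ box3 (B + 1) p -> f p = 0) ->
    box_supported box3 f.
  move=> cf f0; split; first exact: continuous_measurable3.
  have [M M0 hM] := continuous_bounded_on (@compact_box3 _ (B + 1)) cf.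
  exists (B + 1), M; split=> //; [exact: addr_gt0|exact: ltW|].
  move=> p; have [pB|/f0 ->] := pselect (box3 (B + 1) p); first exact: hM.
  by rewrite normr0 ltW.
split; [by do 6!eexists; split; [exact: T|exact: lE]|by apply: supp => // p /off[]| |exact: off].
apply: supp; last by move=> p /off[].
have -> : real_laplacian (basis3 R) psi =
    (fun p => 'D_(1, 0, 0) ('D_(1, 0, 0) psi) p + 'D_(0, 1, 0) ('D_(0, 1, 0) psi) p +
      'D_(0, 0, 1) ('D_(0, 0, 1) psi) p).
  by apply/funext => p; exact: lE.
exact: (continuous_add (continuous_add c11 c22) c33).
Qed.

Lemma Rintegral_supported d (X : measurableType d) (mu : {measure set X -> \bar R})
    (D : set X) (f : X -> R) : (forall x, ~ D x -> f x = 0) ->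
  \int[mu]_x f x = \int[mu]_(x in D) f x.
Proof.
move=> f0; rewrite [RHS]Rintegral_mkcond; apply: eq_Rintegral => x _.
by rewrite patchE; case: ifPn => // xD; rewrite f0//; move: xD; rewrite notin_setE.
Qed.

End test_functions.

(** * A smooth bump function that does not vanish at the origin *)

Section bump.
Context {R : realType}.
Implicit Types (P : {poly R}) (f g : R -> R) (t u : R).

(** The [n]-th power of [u / n <= 1 + u / n <= exp (u / n)]. *)
Lemma expr_le_expR n u : 0 <= u -> u ^+ n <= n%:R ^+ n * expR u.
Proof.
move=> u0; case: n => [|n]; first by rewrite !expr0 mul1r (le_trans _ (expR_ge1Dx u))// lerDl.
have n0 : 0 < n.+1%:R :> R by [].
have -> : expR u = expR (u / n.+1%:R) ^+ n.+1.
  by rewrite -expRM_natl mulrC divfK// gt_eqF.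
rewrite -exprMn lerXn2r ?nnegrE ?mulr_ge0 ?expR_ge0//.
rewrite mulrC -ler_pdivrMr//; apply: le_trans (expR_ge1Dx _).
by rewrite lerDr.
Qed.

(** The power [u^m] is carried along because multiplying the polynomial by the variable raises it by
    one in the induction. *)
Lemma horner_le_expR P m : exists2 C : R, 0 <= C &
  forall u, 0 <= u -> u ^+ m * `|P.[u]| <= C * expR u.
Proof.
elim/poly_ind: P m => [|P c IH] m.
  by exists 0 => // u _; rewrite horner0 normr0 mulr0 mul0r.
have [C C0 hC] := IH m.+1.
exists (C + m%:R ^+ m * `|c|) => [|u u0].
  by rewrite addr_ge0// mulr_ge0// exprn_ge0.
rewrite hornerD hornerM hornerX hornerC.
apply: le_trans (_ : u ^+ m * (`|P.[u]| * u + `|c|) <= _).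
  apply: ler_wpM2l; first exact: exprn_ge0.
  by rewrite (le_trans (ler_normD _ _))// normrM (ger0_norm u0).
rewrite mulrDr mulrDl; apply: lerD.
  by apply: le_trans (hC _ u0); rewrite exprSr -mulrA (mulrC u).
rewrite mulrAC; apply: ler_wpM2r => //; exact: expr_le_expR.
Qed.

(* The classical smooth function that is flat at 0, multiplied by [P (1 / t)];
   these products are stable under differentiation. *)
Definition flat P t : R := if 0 < t then P.[t^-1] * expR (- t^-1) else 0.

(** [horner_le_expR] at [u = 1 / t] with [m = 2]. A quadratic bound is what gives derivative zero at
    [0]. *)
Lemma flat_le P : exists2 C : R, 0 <= C & forall t, `|flat P t| <= C * t ^+ 2.
Proof.
have [C C0 hC] := horner_le_expR P 2.
exists C => // t; rewrite /flat; case: ifPn => [t0|_]; last first.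
  by rewrite normr0 mulr_ge0// sqr_ge0.
have ti : 0 <= t^-1 by rewrite invr_ge0 ltW.
rewrite normrM (gtr0_norm (expR_gt0 _)) expRN ler_pdivrMr ?expR_gt0//.
rewrite mulrAC -ler_pdivrMr ?exprn_gt0// mulrC -exprVn.
exact: hC.
Qed.

(** For [t > 0] both factors contribute [1 / t^2], with signs [P - P']; at [0] the difference
    quotient is at most [C |h|] by [flat_le]. *)
Lemma der_flat P t : der (flat P) t (flat ('X^2 * (P - P^`())) t).
Proof.
have [t0|t0|->] := ltgtP t 0.
- rewrite /flat ltNge (ltW t0)/=.
  apply: (@near_eq_is_derive _ _ _ (fun=> 0)).
  near=> z; rewrite ltNge ifN// negbK; apply: ltW; near: z.
  exact: lt_nbhsl.
- rewrite /flat t0.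
  apply: (@near_eq_is_derive _ _ _ (fun t => P.[t^-1] * expR (- t^-1))).
    near=> z; rewrite ifT//; near: z; exact: lt_nbhsr.
  have dV : der (fun t => t^-1) t (- 1 / t ^+ 2).
    by apply: (@derV _ (fun t => t)); [rewrite gt_eqF|exact: der_id].
  have dP : der (fun t => P.[t^-1]) t (P^`().[t^-1] * (- 1 / t ^+ 2)).
    by apply: (@der_comp _ (horner P) (fun t => t^-1)) => //; exact: is_derive_poly.
  have dE : der (fun t => expR (- t^-1)) t (expR (- t^-1) * - (- 1 / t ^+ 2)).
    apply: (@der_comp _ expR (fun t => - t^-1)); first exact: is_derive_expR.
    exact: derN.
  apply: der_eq; first exact: (derM dP dE).
  by rewrite hornerM hornerXn hornerD hornerN exprVn; ring.
- have flat0 Q : flat Q 0 = 0 by rewrite /flat ltxx.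
  rewrite flat0; have [C C0 hC] := flat_le P.
  have lim0 : h^-1 *: ((flat P \o shift 0) (h *: (1 : R)) - flat P 0) @[h --> 0^'] --> (0 : R).
    apply/cvgrPdist_le => e e0.
    have C1 : 0 < C + 1 by rewrite ltr_wpDl.
    near=> h.
    have h0 : h != 0 by near: h; exact: nbhs_dnbhs_neq.
    have he : `|h| <= e / (C + 1).
      near: h; apply: dnbhs0_le; exact: divr_gt0.
    rewrite sub0r normrN flat0 subr0 /= addr0 /GRing.scale/= mulr1 normrM normfV.
    rewrite ler_pdivrMl ?normr_gt0//; apply: le_trans (hC h) _.
    rewrite -real_normK ?num_real// expr2 mulrCA ler_pM2l ?normr_gt0//.
    apply: le_trans (_ : (C + 1) * `|h| <= _); first by rewrite ler_wpM2r// lerDl.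
    by rewrite mulrC -ler_pdivlMr.
  split; first exact: cvgP lim0.
  exact: cvg_lim lim0.
Unshelve. all: by end_near. Qed.

Fixpoint Ck (n : nat) f : Prop :=
  if n is n'.+1 then exists2 f', (forall t, der f t (f' t)) & Ck n' f' else True.

Definition Cinfty f : Prop := forall n, Ck n f.

Lemma Ck_pred n f : Ck n.+1 f -> Ck n f.
Proof.
elim: n f => // n IH f [f' df cf]; exists f' => //; exact: IH.
Qed.

Lemma CkD n f g : Ck n f -> Ck n g -> Ck n (fun t => f t + g t).
Proof.
elim: n f g => // n IH f g [f' df cf] [g' dg cg].
by exists (fun t => f' t + g' t); [move=> t; exact: derD|exact: IH].
Qed.

Lemma CkM n f g : Ck n f -> Ck n g -> Ck n (fun t => f t * g t).
Proof.
elim: n f g => // n IH f g cf cg; have cf0 := Ck_pred cf; have cg0 := Ck_pred cg.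
case: cf cg => [f' df cf] [g' dg cg].
exists (fun t => f' t * g t + f t * g' t); first by move=> t; exact: derM.
by apply: CkD; exact: IH.
Qed.

Lemma Ck_affine n (a b : R) f : Ck n f -> Ck n (fun t => f (a * t + b)).
Proof.
elim: n f => // n IH f [f' df cf].
exists (fun t => f' (a * t + b) * a); last first.
  apply: CkM; first exact: IH.
  (* The constant [a] has derivative zero, and the zero function is its own derivative. *)
  by elim: n {IH cf} => // n IHn; exists (fun=> 0) => [t|]; [exact: der_cst|];
    elim: n {IHn} => // n IHn; exists (fun=> 0) => [t|//]; exact: der_cst.
move=> t; apply: (@der_comp _ f (fun t => a * t + b)); first exact: df.
apply: der_eq; first by apply: derD; [apply: derZ; exact: der_id|exact: der_cst].
by rewrite mulr1 addr0.
Qed.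

Lemma Cinfty_flat P : Cinfty (flat P).
Proof.
move=> n; elim: n P => // n IH P.
by exists (flat ('X^2 * (P - P^`()))) => // t; exact: der_flat.
Qed.

(** On []-1, 1[] this is [exp (- 1/(1+t) - 1/(1-t))]; the arguments have the form required by
    [Ck_affine]. *)
Definition bump t : R := flat 1 (1 * t + 1) * flat 1 (-1 * t + 1).

Lemma Cinfty_bump : Cinfty bump.
Proof. by move=> n; apply: CkM; apply: Ck_affine; exact: Cinfty_flat. Qed.

Lemma bump_eq0 t : 1 <= `|t| -> bump t = 0.
Proof.
rewrite /bump /flat mul1r mulN1r ler_normr => /orP[t1|t1].
  by rewrite [X in _ * X]ifF ?mulr0//; apply/negbTE; rewrite -leNgt; lra.
by rewrite ifF ?mul0r//; apply/negbTE; rewrite -leNgt; lra.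
Qed.

Lemma bump0_neq0 : bump 0 != 0.
Proof.
rewrite /bump /flat !mulr0 !add0r ltr01 hornerC mul1r mulf_neq0//;
  exact: lt0r_neq0 (expR_gt0 _).
Qed.

Definition dbump n : R -> R := iter n (fun f t => 'D_1 f t) bump.

Lemma Cinfty_derive f : Cinfty f ->
  (forall t, der f t ('D_1 f t)) /\ Cinfty (fun t => 'D_1 f t).
Proof.
move=> cf.
have df t : der f t ('D_1 f t).
  by have [f' df _] := cf 1%N; have [h _] := df t; exact: derivableP.
split=> // n; have [f' df' cf'] := cf n.+1.
by rewrite (_ : (fun t => _) = f')//; apply/funext => t; have [_ e] := df' t; exact: e.
Qed.

Lemma Cinfty_dbump n : Cinfty (dbump n).
Proof.
elim: n => [|n IH]; first exact: Cinfty_bump.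
exact: (Cinfty_derive IH).2.
Qed.

Lemma der_dbump n t : der (dbump n) t (dbump n.+1 t).
Proof. exact: (Cinfty_derive (Cinfty_dbump n)).1. Qed.

Lemma continuous_dbump n : continuous (dbump n).
Proof. exact: der_continuousT (der_dbump n). Qed.

Definition bump2 (p : R * R) : R := bump p.1 * bump p.2.
Definition bump3 (p : R * R * R) : R := bump p.1.1 * bump p.1.2 * bump p.2.

(** Partial derivatives stay in the family of products of derivatives of [bump], so every iterated
    partial derivative of [bump2] is known explicitly. *)
Lemma is_derive_bump2 m n (x y : R) :
  is_derive (x, y) ((1, 0) : R * R) (fun p => dbump m p.1 * dbump n p.2)
    (dbump m.+1 x * dbump n y) /\
  is_derive (x, y) ((0, 1) : R * R) (fun p => dbump m p.1 * dbump n p.2)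
    (dbump m x * dbump n.+1 y).
Proof.
have gx h : (fun x : R => (x, y)) (h + x) = h *: ((1, 0) : R * R) + (fun x : R => (x, y)) x.
  by congr pair; rewrite /= /GRing.scale/= ?mulr1 ?mulr0 ?add0r.
have gy h : (fun y : R => (x, y)) (h + y) = h *: ((0, 1) : R * R) + (fun y : R => (x, y)) y.
  by congr pair; rewrite /= /GRing.scale/= ?mulr1 ?mulr0 ?add0r.
split.
  apply/(@is_derive_line R _ _ (fun x => (x, y)) _ x _ gx).
  have h := derM (der_dbump m x) (der_cst (dbump n y) x).
  by apply: (der_eq h); rewrite mulr0 addr0.
apply/(@is_derive_line R _ _ (fun y => (x, y)) _ y _ gy).
exact: (derZ (dbump m x) (der_dbump n y)).
Qed.

Lemma is_derive_bump3 l m n (x y z : R) :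
  [/\ is_derive (x, y, z) ((1, 0, 0) : R * R * R)
        (fun p => dbump l p.1.1 * dbump m p.1.2 * dbump n p.2)
        (dbump l.+1 x * dbump m y * dbump n z),
      is_derive (x, y, z) ((0, 1, 0) : R * R * R)
        (fun p => dbump l p.1.1 * dbump m p.1.2 * dbump n p.2)
        (dbump l x * dbump m.+1 y * dbump n z) &
      is_derive (x, y, z) ((0, 0, 1) : R * R * R)
        (fun p => dbump l p.1.1 * dbump m p.1.2 * dbump n p.2)
        (dbump l x * dbump m y * dbump n.+1 z)].
Proof.
have gx h : (fun x : R => (x, y, z)) (h + x) =
    h *: ((1, 0, 0) : R * R * R) + (fun x : R => (x, y, z)) x.
  by congr (_, _, _); rewrite /= /GRing.scale/= ?mulr1 ?mulr0 ?add0r.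
have gy h : (fun y : R => (x, y, z)) (h + y) =
    h *: ((0, 1, 0) : R * R * R) + (fun y : R => (x, y, z)) y.
  by congr (_, _, _); rewrite /= /GRing.scale/= ?mulr1 ?mulr0 ?add0r.
have gz h : (fun z : R => (x, y, z)) (h + z) =
    h *: ((0, 0, 1) : R * R * R) + (fun z : R => (x, y, z)) z.
  by congr (_, _, _); rewrite /= /GRing.scale/= ?mulr1 ?mulr0 ?add0r.
split.
- apply/(@is_derive_line R _ _ (fun x => (x, y, z)) _ x _ gx).
  have h := derM (derM (der_dbump l x) (der_cst (dbump m y) x)) (der_cst (dbump n z) x).
  by apply: (der_eq h); rewrite !mulr0 !addr0.
- apply/(@is_derive_line R _ _ (fun y => (x, y, z)) _ y _ gy).
  have h := derM (derZ (dbump l x) (der_dbump m y)) (der_cst (dbump n z) y).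
  by apply: (der_eq h); rewrite mulr0 addr0.
- apply/(@is_derive_line R _ _ (fun z => (x, y, z)) _ z _ gz).
  exact: (derZ (dbump l x * dbump m y) (der_dbump n z)).
Qed.

Lemma smooth_bump2 : smooth (basis2 R) bump2.
Proof.
have key vs : all (mem (basis2 R)) vs ->
    exists m n, iter_partial vs bump2 = (fun p => dbump m p.1 * dbump n p.2).
  elim: vs => [|v vs IH] /=; first by exists 0%N, 0%N.
  move=> /andP[vb /IH [m [n ->]]]; move: vb; rewrite !inE => /orP[]/eqP ->.
    exists m.+1, n; apply/funext => -[x y].
    by have [[_ ->] _] := is_derive_bump2 m n x y.
  exists m, n.+1; apply/funext => -[x y].
  by have [_ [_ ->]] := is_derive_bump2 m n x y.
move=> vs /key [m [n ->]]; split.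
  apply: continuous_mul; apply: (@continuous_comp_at _ _ (dbump _)) => p;
    do ?[exact: continuous_dbump]; [exact: cvg_fst|exact: cvg_snd].
move=> v [x y]; rewrite !inE => /orP[]/eqP ->.
  by have [[]] := is_derive_bump2 m n x y.
by have [_ []] := is_derive_bump2 m n x y.
Qed.

Lemma smooth_bump3 : smooth (basis3 R) bump3.
Proof.
have key vs : all (mem (basis3 R)) vs ->
    exists l m n, iter_partial vs bump3 =
      (fun p => dbump l p.1.1 * dbump m p.1.2 * dbump n p.2).
  elim: vs => [|v vs IH] /=; first by exists 0%N, 0%N, 0%N.
  move=> /andP[vb /IH [l [m [n ->]]]]; move: vb; rewrite !inE => /or3P[]/eqP ->.
  - exists l.+1, m, n; apply/funext => -[[x y] z].
    by have [[_ ->] _ _] := is_derive_bump3 l m n x y z.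
  - exists l, m.+1, n; apply/funext => -[[x y] z].
    by have [_ [_ ->] _] := is_derive_bump3 l m n x y z.
  - exists l, m, n.+1; apply/funext => -[[x y] z].
    by have [_ _ [_ ->]] := is_derive_bump3 l m n x y z.
move=> vs /key [l [m [n ->]]]; split.
  apply: continuous_mul; last first.
    apply: (@continuous_comp_at _ _ (dbump n)) => p; first exact: continuous_dbump.
    exact: cvg_snd.
  apply: continuous_mul; apply: (@continuous_comp_at _ _ (dbump _)) => p;
    do ?[exact: continuous_dbump]; apply: continuous_comp; do ?[exact: cvg_fst|exact: cvg_snd].
move=> v [[x y] z]; rewrite !inE => /or3P[]/eqP ->.
- by have [[]] := is_derive_bump3 l m n x y z.
- by have [_ []] := is_derive_bump3 l m n x y z.
- by have [_ _ []] := is_derive_bump3 l m n x y z.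
Qed.

Lemma test_function_real (E : normedModType R) (basis : seq E) (f : E -> R) (K : set E) :
  smooth basis f -> compact K -> closed K -> (forall x, ~ K x -> f x = 0) ->
  test_function basis (fun x => (f x)%:C).
Proof.
move=> sf cK clK f0; split=> //=.
  have s0 vs : iter_partial vs (fun _ : E => 0 : R) = (fun=> 0).
    elim: vs => //= v vs ->; apply/funext => x; exact: derive_cst.
  move=> vs _; rewrite s0; split; first exact: continuous_cst_fun.
  by move=> v x _; exact: derivable_cst.
apply: (subclosed_compact _ cK); first exact: closed_closure.
rewrite [X in _ `<=` X](closure_id K).1//; apply: closure_subset => x /=.
by move=> fx; apply: contrapT => nK; move: fx; rewrite f0// eqxx.
Qed.

Lemma test_function_bump2 : test_function (basis2 R) (fun p => (bump2 p)%:C).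
Proof.
apply: (@test_function_real _ _ _ (box2 1)); first exact: smooth_bump2.
- exact: compact_box2.
- by apply: compact_closed; [exact: norm_hausdorff|exact: compact_box2].
move=> [x y]; rewrite /bump2/= box2_norm prod_normE ge_max => /negP.
rewrite negb_and -!ltNge => /orP[/ltW/bump_eq0 ->|/ltW/bump_eq0 ->];
  by rewrite ?mul0r ?mulr0.
Qed.

Lemma test_function_bump3 : test_function (basis3 R) (fun p => (bump3 p)%:C).
Proof.
apply: (@test_function_real _ _ _ (box3 1)); first exact: smooth_bump3.
- exact: compact_box3.
- by apply: compact_closed; [exact: norm_hausdorff|exact: compact_box3].
move=> [[x y] z]; rewrite /bump3/= box3_norm !prod_normE !ge_max => /negP.
rewrite !negb_and -!ltNge -orbA => /or3P[/ltW/bump_eq0 ->|/ltW/bump_eq0 ->|/ltW/bump_eq0 ->];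
  by rewrite ?mul0r ?mulr0 ?mul0r.
Qed.

End bump.

(** * Helmholtz equations *)

Section helmholtz_distributions.
Context {R : realType}.
Implicit Types (k : R[i]).

(** The box identities become identities over the plane because [phi] and its Laplacian vanish off
    the box; the Hankel function is replaced by [planar_formula], equal to it almost everywhere. *)
Lemma planar_hankel_distr k phi : k != 0 -> test_function (basis2 R) phi ->
  [/\ cbox_supported box2 phi, cbox_supported box2 (laplacian (basis2 R) phi) &
  regular_distr (lam2 R) (planar_hankel k) (laplacian (basis2 R) phi) =
  - k ^+ 2 * regular_distr (lam2 R) (planar_hankel k) phi + 4 * 'i%C * phi 0].
Proof.
move=> k0 [sr si cphi]; have [B B0 hB] := compact_support_bound cphi.
have B10 : 0 < B + 1 by rewrite addr_gt0.
have key psi : smooth (basis2 R) psi -> (forall p, B < `|p| -> psi p = 0) ->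
    [/\ box_supported box2 psi, box_supported box2 (real_laplacian (basis2 R) psi) &
      \int[lam2 R]_p (complex.Re (planar_formula k p) * real_laplacian (basis2 R) psi p) =
      \int[lam2 R]_p (complex.Re (- k ^+ 2 * planar_formula k p) * psi p) +
        complex.Re (4 * 'i%C : R[i]) * psi 0 /\
      \int[lam2 R]_p (complex.Im (planar_formula k p) * real_laplacian (basis2 R) psi p) =
      \int[lam2 R]_p (complex.Im (- k ^+ 2 * planar_formula k p) * psi p) +
        complex.Im (4 * 'i%C : R[i]) * psi 0].
  move=> spsi psi0; have [[px [pxx [py [pyy [T lE]]]]] bpsi blpsi off] := smooth2_test spsi B0 psi0.
  split=> //; have [hr hi] := planar_formula_helmholtz k B10 T.
  have c4 : (4 * 'i%C : R[i]) = 0 +i* 4.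
    by rewrite nat_complex; apply: complex_ext; rewrite ?complex_ReZ ?complex_ImZ/= ?mulr0 ?mulr1.
  have lE' : real_laplacian (basis2 R) psi = (fun p => pxx p + pyy p) by apply/funext.
  rewrite c4 /= mul0r addr0; rewrite lE' in off *.
  by split; rewrite !(@Rintegral_supported _ _ _ _ (box2 (B + 1))) ?hr ?hi// => p /off[e1 e2];
    rewrite ?e1 ?e2 mulr0.
have [br blr hr] := key _ sr (fun p hp => congr1 (@complex.Re R) (hB p hp)).
have [bi bli hi] := key _ si (fun p hp => congr1 (@complex.Im R) (hB p hp)).
have sphi : cbox_supported box2 phi by exact (conj br bi).
have slphi : cbox_supported box2 (laplacian (basis2 R) phi) by exact (conj blr bli).
have mb := @measurable_box2 R.
have lf := cbox_locally_integrable_planar_formula k.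
have ae w : cbox_supported box2 w ->
    regular_distr (lam2 R) (planar_hankel k) w = regular_distr (lam2 R) (planar_formula k) w.
  move=> sw; apply: (ae_eq_regular_distr mb _ lf sw).
  - exact: cbox_locally_integrable_planar_hankel.
  - by apply: ae_lam2W => p p1 _; exact: planar_hankelE.
split; [exact: sphi|exact: slphi|].
rewrite (ae _ sphi) (ae _ slphi); apply: (helmholtz_complex mb lf sphi slphi).
by move=> P [->|->]; [exact hr|exact hi].
Qed.

Lemma spatial_hankel_distr k phi : test_function (basis3 R) phi ->
  [/\ cbox_supported box3 phi, cbox_supported box3 (laplacian (basis3 R) phi) &
  regular_distr (lam3 R) (spatial_hankel k) (laplacian (basis3 R) phi) =
  - k ^+ 2 * regular_distr (lam3 R) (spatial_hankel k) phi +
  4 * (pi : R)%:C * 'i%C / k * phi 0].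
Proof.
move=> [sr si cphi]; have [B B0 hB] := compact_support_bound cphi.
have B10 : 0 < B + 1 by rewrite addr_gt0.
have key psi : smooth (basis3 R) psi -> (forall p, B < `|p| -> psi p = 0) ->
    [/\ box_supported box3 psi, box_supported box3 (real_laplacian (basis3 R) psi) &
      \int[lam3 R]_p (complex.Re (spatial_hankel k p) * real_laplacian (basis3 R) psi p) =
      \int[lam3 R]_p (complex.Re (- k ^+ 2 * spatial_hankel k p) * psi p) +
        complex.Re (4 * (pi : R)%:C * 'i%C / k) * psi 0 /\
      \int[lam3 R]_p (complex.Im (spatial_hankel k p) * real_laplacian (basis3 R) psi p) =
      \int[lam3 R]_p (complex.Im (- k ^+ 2 * spatial_hankel k p) * psi p) +
        complex.Im (4 * (pi : R)%:C * 'i%C / k) * psi 0].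
  move=> spsi psi0; have [[px [pxx [py [pyy [pz [pzz [T lE]]]]]]] bpsi blpsi off] := smooth3_test spsi B0 psi0.
  split=> //; have [hr hi] := spatial_hankel_helmholtz k B10 T.
  have lE' : real_laplacian (basis3 R) psi = (fun p => pxx p + pyy p + pzz p) by apply/funext.
  rewrite lE' in off *.
  by split; rewrite !(@Rintegral_supported _ _ _ _ (box3 (B + 1))) ?hr ?hi// => p /off[e1 e2];
    rewrite ?e1 ?e2 mulr0.
have [br blr hr] := key _ sr (fun p hp => congr1 (@complex.Re R) (hB p hp)).
have [bi bli hi] := key _ si (fun p hp => congr1 (@complex.Im R) (hB p hp)).
have sphi : cbox_supported box3 phi by exact (conj br bi).
have slphi : cbox_supported box3 (laplacian (basis3 R) phi) by exact (conj blr bli).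
have mb := @measurable_box3 R.
have lf := cbox_locally_integrable_spatial_hankel k.
split; [exact: sphi|exact: slphi|].
apply: (helmholtz_complex mb lf sphi slphi).
by move=> P [->|->]; [exact hr|exact hi].
Qed.

End helmholtz_distributions.

(** * Local integrability on compact sets and on boxes *)

Section local_integrability.
Context {R : realType} d (X : measurableType d).
Variables (mu : {measure set X -> \bar R}) (box : R -> set X).

(** Proved for arbitrary sets, from the definition by simple functions: the compact set [K] below is
    given through a predicate and comes without measurability. *)
Lemma ge0_le_integral_subset (K D : set X) (f : X -> \bar R) :
  (forall x, 0 <= f x)%E -> K `<=` D ->
  (\int[mu]_(x in K) f x <= \int[mu]_(x in D) f x)%E.
Proof.
move=> f0 KD; rewrite !ge0_integralE//; apply: ereal_sup_le => _ [h hf <-].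
exists h => // x; apply: (le_trans (hf x)); rewrite !patchE.
case: ifPn => [xK|_]; first by rewrite ifT// inE; apply: KD; rewrite inE in xK.
by case: ifPn.
Qed.

Lemma locally_integrable_forP (is_compact : set X -> Prop) (u : X -> R[i]) :
  (forall B, is_compact (box B)) ->
  (forall K, is_compact K -> exists2 B, 0 < B & K `<=` box B) ->
  locally_integrable_for mu is_compact u <-> cbox_locally_integrable mu box u.
Proof.
move=> cbox cK.
suff key (f : X -> R) : (measurable_fun setT f /\
    forall K, is_compact K -> (\int[mu]_(x in K) `|f x|%:E < +oo)%E) <->
    box_locally_integrable mu box f.
  by split=> -[/key ? /key ?]; split.
split=> -[mf intf]; split=> //.
  move=> B B0; apply/integrableP; split; last exact: intf.
  by apply/measurable_EFinP; exact: measurable_funTS.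
move=> K /cK[B B0 KB]; have /integrableP[_] := intf B B0.
by apply: le_lt_trans; apply: ge0_le_integral_subset => // x; rewrite lee_fin.
Qed.

End local_integrability.

(** * The Morse-Ingard system *)

Section morse_ingard_algebra.
Variables (F : numFieldType) (I Om La ga Q : F).
Let A := 1 - I * (ga * La).
Let B := 1 - I * (ga * Om) - I * La.
Hypotheses (I2 : I ^+ 2 = -1) (Om0 : Om != 0) (ga0 : ga != 0) (ga1 : ga - 1 != 0).
Hypotheses (A0 : A != 0) (Q0 : Q != 0).
Hypothesis QE : Q ^+ 2 = 4 * (I * Om + ga * Om * La) + B ^+ 2.

(** With [w = B + Q] or [w = B - Q], [s] is the square of a wave number. The first equation is the
    definition of [m] rearranged; the second, after substituting [m], is the dispersion relation
    [q0]. *)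
Lemma plane_wave_modes (w s m : F) : (w - B) ^+ 2 = Q ^+ 2 ->
  s = I / (2 * Om) * (w / A) -> m = ga / (ga - 1) * (1 + I * Om * s) ->
  - (Om * s) + I - I * ((ga - 1) / ga) * m = 0 /\
  - (A * s * m) + (ga * (1 - La / Om) + La / Om) * m - ga * (1 - La / Om) = 0.
Proof.
move=> wE sE mE.
have I0 : I ^+ 2 + 1 = 0 by rewrite I2 addNr.
have w0 : (w - B) ^+ 2 - (4 * (I * Om + ga * Om * La) + B ^+ 2) = 0.
  by rewrite wE QE subrr.
have q0 : I * Om * A * s ^+ 2 + B * s - 1 = 0.
  (* [field] treats [I] and [w] as indeterminates, so the expression is written as a combination of
     the two vanishing polynomials of [I0] and [w0]. *)
  transitivity ((I * w ^+ 2 / (4 * Om * A) - A^-1) * (I ^+ 2 + 1) -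
    I / (4 * Om * A) * ((w - B) ^+ 2 - (4 * (I * Om + ga * Om * La) + B ^+ 2))).
    by rewrite sE /A; field; rewrite Om0 A0.
  by rewrite I0 w0 !mulr0 subrr.
split.
  transitivity (- (Om * s) * (I ^+ 2 + 1)); last by rewrite I0 mulr0.
  by rewrite mE; field; rewrite ga0 ga1.
transitivity (- (ga / (ga - 1)) * (I * Om * A * s ^+ 2 + B * s - 1)).
  by rewrite mE /A /B; field; rewrite ga1 Om0.
by rewrite q0 mulr0.
Qed.

Variables st sp mt mp : F.
Hypothesis stE : st = I / (2 * Om) * ((B + Q) / A).
Hypothesis spE : sp = I / (2 * Om) * ((B - Q) / A).
Hypothesis mtE : mt = ga / (ga - 1) * (1 + I * Om * st).
Hypothesis mpE : mp = ga / (ga - 1) * (1 + I * Om * sp).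

Lemma mode_ratio_diff : mt - mp = - (ga / (ga - 1) * (Q / A)).
Proof.
apply/eqP; rewrite -subr_eq0; apply/eqP.
transitivity (ga / (ga - 1) * (Q / A) * (I ^+ 2 + 1)); last by rewrite I2 addNr mulr0.
by rewrite mtE mpE stE spE; field; rewrite Om0 ga1 A0.
Qed.

(** The unknowns are the coefficients already multiplied by the delta strengths of their modes,
    which makes the statement common to the plane and to space. *)
Lemma point_source_amplitudes (x y : F) :
  Om * (x + y) = 1 /\ A * (mp * x + mt * y) = - I * (ga * (La / Om)) <->
  x = (ga - 1) / (ga * Om * Q) * (I * (I * mt + (mt - 1) * (ga * La))) /\
  y = - ((ga - 1) / (ga * Om * Q) * (I * (I * mp + (mp - 1) * (ga * La)))).
Proof.
have dm := mode_ratio_diff.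
have dm0 : mt - mp != 0.
  by rewrite dm oppr_eq0 !mulf_neq0// invr_eq0.
set x0 := (ga - 1) / _ * _; set y0 := - ((ga - 1) / _ * _).
have s0 : Om * (x0 + y0) = 1.
  (* With [I^2 = -1] the middle factor is [- A], which cancels the denominator of [mt - mp]. *)
  transitivity ((ga - 1) / (ga * Q) * (I ^+ 2 + I * (ga * La)) * (mt - mp)).
    by rewrite /x0 /y0; field; rewrite ga0 Om0 Q0.
  by rewrite I2 dm /A; field; rewrite ga0 Q0 ga1 A0.
have d0 : A * (mp * x0 + mt * y0) = - I * (ga * (La / Om)).
  transitivity (A * ((ga - 1) / (ga * Om * Q) * (I * (ga * La)) * (mt - mp))).
    by rewrite /x0 /y0; field; rewrite ga0 Om0 Q0.
  by rewrite dm; field; rewrite ga0 Om0 Q0 ga1 A0.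
split=> [[s d]|[-> ->]]; last by [].
have e1 : x + y = x0 + y0 by apply: (mulfI Om0); rewrite s s0.
have e2 : mp * x + mt * y = mp * x0 + mt * y0 by apply: (mulfI A0); rewrite d d0.
have ey : y = y0.
  apply: (mulfI dm0); transitivity ((mp * x + mt * y) - mp * (x + y)); first by ring.
  by rewrite e1 e2; ring.
by split=> //; apply: (addIr y0); rewrite -{1}ey.
Qed.

End morse_ingard_algebra.

(** * From the weak system to point-source amplitudes, in any dimension *)

Section free_space_green.
Context {R : realType} {E : normedModType R} (basis : seq E).
Variables (Omega Lambda gamma : R) (Q kt kp mt mp : R[i]).
Hypotheses (Omega_gt0 : 0 < Omega) (gamma_gt0 : 0 < gamma) (gamma_neq1 : gamma != 1).
Hypothesis QE : Q ^+ 2 = 4 * ('i%C * Omega%:C + (gamma * Omega * Lambda)%:C)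
  + (1 - 'i%C * (gamma * Omega)%:C - 'i%C * Lambda%:C) ^+ 2.
Hypothesis Q_neq0 : Q != 0.
Hypothesis ktE : kt ^+ 2 = 'i%C / (2 * Omega%:C)
  * ((1 - 'i%C * (gamma * Omega)%:C - 'i%C * Lambda%:C + Q)
     / (1 - 'i%C * (gamma * Lambda)%:C)).
Hypothesis kpE : kp ^+ 2 = 'i%C / (2 * Omega%:C)
  * ((1 - 'i%C * (gamma * Omega)%:C - 'i%C * Lambda%:C - Q)
     / (1 - 'i%C * (gamma * Lambda)%:C)).
Hypothesis mtE : mt = (gamma / (gamma - 1))%:C * (1 + 'i%C * Omega%:C * kt ^+ 2).
Hypothesis mpE : mp = (gamma / (gamma - 1))%:C * (1 + 'i%C * Omega%:C * kp ^+ 2).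

Variables (loc : (E -> R[i]) -> Prop) (D : (E -> R[i]) -> (E -> R[i]) -> R[i]).
Variable supp : (E -> R[i]) -> Prop.
Variables (Hp Ht : E -> R[i]) (cp ct : R[i]).
Hypothesis test_supp : forall phi, test_function basis phi ->
  supp phi /\ supp (laplacian basis phi).
Hypothesis locD : forall a b u v, loc u -> loc v -> loc (fun x => a * u x + b * v x).
Hypothesis DD : forall a b u v w, loc u -> loc v -> supp w ->
  D (fun x => a * u x + b * v x) w = a * D u w + b * D v w.
Hypothesis eqD : forall u v w, loc u -> loc v -> supp w ->
  (forall x, x != 0 -> u x = v x) -> D u w = D v w.
Hypotheses (locHp : loc Hp) (locHt : loc Ht).
Hypothesis helmholtzp : forall phi, test_function basis phi ->
  D Hp (laplacian basis phi) = - kp ^+ 2 * D Hp phi + cp * phi 0.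
Hypothesis helmholtzt : forall phi, test_function basis phi ->
  D Ht (laplacian basis phi) = - kt ^+ 2 * D Ht phi + ct * phi 0.
Hypothesis nonzero_test : exists2 phi, test_function basis phi & phi 0 != 0.

Let Om : R[i] := Omega%:C.
Let La : R[i] := Lambda%:C.
Let ga : R[i] := gamma%:C.
Let A : R[i] := 1 - 'i%C * (ga * La).

Lemma i_sqr : ('i%C : R[i]) ^+ 2 = -1.
Proof. by rewrite expr2; apply: complex_ext; rewrite ?complex_ReM ?complex_ImM/=; ring. Qed.

Lemma Om_neq0 : Om != 0.
Proof. by rewrite fmorph_eq0 gt_eqF. Qed.

Lemma ga_neq0 : ga != 0.
Proof. by rewrite fmorph_eq0 gt_eqF. Qed.

Lemma ga1_neq0 : ga - 1 != 0.
Proof. by rewrite -(rmorph1 (real_complex R)) -rmorphB fmorph_eq0 subr_eq0. Qed.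

Lemma A_neq0 : A != 0.
Proof.
apply/eqP => /(congr1 (@complex.Re R)); rewrite /A /ga /La -rmorphM.
by rewrite complex_ReD /= => /eqP; rewrite !(mul0r, mul1r, mulr0, subr0, sub0r, oppr0, addr0) oner_eq0.
Qed.

(** [D] abstracts the integral pairing, [loc] and [supp] the functions it is linear on, and [cp],
    [ct] the delta strengths in the Helmholtz equations of the two modes. The regular parts cancel
    mode by mode, which leaves two numerical equations. *)
Lemma morse_ingard_combination a b T P : loc T -> loc P ->
  (forall x, x != 0 -> T x = a * Hp x + b * Ht x) ->
  (forall x, x != 0 -> P x = a * mp * Hp x + b * mt * Ht x) ->
  morse_ingard basis Omega Lambda gamma (D T) (D P) <->
  a * cp = (ga - 1) / (ga * Om * Q) * ('i%C * ('i%C * mt + (mt - 1) * (ga * La))) /\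
  b * ct = - ((ga - 1) / (ga * Om * Q) * ('i%C * ('i%C * mp + (mp - 1) * (ga * La)))).
Proof.
move=> lT lP TE PE.
have CM (x y : R) : (x * y)%:C = x%:C * y%:C := rmorphM _ x y.
have CV (x : R) : (x^-1)%:C = (x%:C)^-1 := fmorphV _ x.
have CD (x y : R) : (x + y)%:C = x%:C + y%:C := rmorphD _ x y.
have CN (x : R) : (- x)%:C = - x%:C := rmorphN _ x.
have C1 : (1 : R)%:C = 1 := rmorph1 _.
move: QE ktE kpE mtE mpE; rewrite !(CM, CV, CD, CN, C1) -/Om -/La -/ga.
set B := 1 - 'i%C * (ga * Om) - 'i%C * La => qE stE spE ntE npE.
have [t1 t2] : - (Om * kt ^+ 2) + 'i%C - 'i%C * ((ga - 1) / ga) * mt = 0 /\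
    - (A * kt ^+ 2 * mt) + (ga * (1 - La / Om) + La / Om) * mt - ga * (1 - La / Om) = 0.
  apply: (plane_wave_modes i_sqr Om_neq0 ga_neq0 ga1_neq0 A_neq0 qE _ stE ntE).
  by rewrite addrAC subrr add0r.
have [p1 p2] : - (Om * kp ^+ 2) + 'i%C - 'i%C * ((ga - 1) / ga) * mp = 0 /\
    - (A * kp ^+ 2 * mp) + (ga * (1 - La / Om) + La / Om) * mp - ga * (1 - La / Om) = 0.
  apply: (plane_wave_modes i_sqr Om_neq0 ga_neq0 ga1_neq0 A_neq0 qE _ spE npE).
  by rewrite addrAC subrr add0r sqrrN.
have DT w : supp w -> D T w = a * D Hp w + b * D Ht w.
  by move=> sw; rewrite -DD//; apply: eqD => //; exact: locD.
have DP w : supp w -> D P w = a * mp * D Hp w + b * mt * D Ht w.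
  by move=> sw; rewrite -DD//; apply: eqD => //; exact: locD.
(* Both sides of the system applied to [phi]: the brackets [p1], [t1], [p2], [t2] annihilate
   everything but the multiples of [phi 0]. *)
have sys phi : test_function basis phi ->
    Om * D T (laplacian basis phi) + 'i%C * D T phi - 'i%C * ((ga - 1) / ga) * D P phi =
      Om * (a * cp + b * ct) * phi 0 /\
    A * D P (laplacian basis phi) + (ga * (1 - La / Om) + La / Om) * D P phi
      - ga * (1 - La / Om) * D T phi = A * (mp * (a * cp) + mt * (b * ct)) * phi 0.
  move=> tphi; have [s1 s2] := test_supp tphi.
  rewrite !DT// !DP// !helmholtzp// !helmholtzt//.
  set hp := D Hp phi; set ht := D Ht phi; split.
    transitivity (Om * (a * cp + b * ct) * phi 0 +
      (a * hp * (- (Om * kp ^+ 2) + 'i%C - 'i%C * ((ga - 1) / ga) * mp) +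
       b * ht * (- (Om * kt ^+ 2) + 'i%C - 'i%C * ((ga - 1) / ga) * mt))); first by ring.
    by rewrite p1 t1 !mulr0 !addr0.
  transitivity (A * (mp * (a * cp) + mt * (b * ct)) * phi 0 +
    (a * hp * (- (A * kp ^+ 2 * mp) + (ga * (1 - La / Om) + La / Om) * mp - ga * (1 - La / Om)) +
     b * ht * (- (A * kt ^+ 2 * mt) + (ga * (1 - La / Om) + La / Om) * mt - ga * (1 - La / Om)))).
    by ring.
  by rewrite p2 t2 !mulr0 !addr0.
rewrite -(point_source_amplitudes i_sqr Om_neq0 ga_neq0 ga1_neq0 A_neq0 Q_neq0 stE spE ntE npE).
rewrite /morse_ingard /distr_eq /distr_laplacian /dirac0 !(CM, CV, CD, CN, C1) -/Om -/La -/ga -/A.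
split=> [[e1 e2]|[e1 e2]].
  (* A single test function determines the amplitudes, after division by [phi 0]. *)
  have [phi tphi phi0] := nonzero_test; have [s1 s2] := sys _ tphi.
  split; apply: (mulIf phi0).
    by rewrite -s1 mul1r; exact: e1.
  by rewrite -s2; exact: e2.
split=> phi /sys[s1 s2]; first by rewrite s1 e1 mul1r.
by rewrite s2 e2.
Qed.

(** Every representation of a solution in the span has the amplitudes [a * cp] and [b * ct]
    prescribed, and nonzero strengths then fix [a] and [b]. *)
Lemma green_pair_unique b1 b2 :
  b1 * cp = (ga - 1) / (ga * Om * Q) * ('i%C * ('i%C * mt + (mt - 1) * (ga * La))) ->
  b2 * ct = - ((ga - 1) / (ga * Om * Q) * ('i%C * ('i%C * mp + (mp - 1) * (ga * La)))) ->
  cp != 0 -> ct != 0 ->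
  is_unique_pair
    (fun T P : E -> R[i] =>
       in_span Hp (fun x => mp * Hp x) Ht (fun x => mt * Ht x) T P /\
       [/\ loc T, loc P & morse_ingard basis Omega Lambda gamma (D T) (D P)])
    (fun x => b1 * Hp x + b2 * Ht x)
    (fun x => b1 * mp * Hp x + b2 * mt * Ht x).
Proof.
move=> e1 e2 cp0 ct0; split.
  split.
    by exists b1, b2 => x _; rewrite !mulrA.
  split; [exact: locD|exact: locD|].
  by apply/(@morse_ingard_combination b1 b2) => //; exact: locD.
move=> T P [[a [b TP]] [lT lP sys]].
have TE x : x != 0 -> T x = a * Hp x + b * Ht x by move=> /TP[].
have PE x : x != 0 -> P x = a * mp * Hp x + b * mt * Ht x.
  by move=> /TP[_ ->]; rewrite !mulrA.
have [ea eb] := (morse_ingard_combination lT lP TE PE).1 sys.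
have ab1 : a = b1 by apply: (mulIf cp0); rewrite ea e1.
have bb2 : b = b2 by apply: (mulIf ct0); rewrite eb e2.
by move=> x x0; rewrite TE// PE// ab1 bb2.
Qed.

End free_space_green.

Section spaces_green.
Context {R : realType}.

Lemma locally_integrable2P (u : R * R -> R[i]) :
  locally_integrable_for (lam2 R) (@compact (R * R)%type) u <->
  cbox_locally_integrable (lam2 R) box2 u.
Proof.
have cK (K : set (R * R)) : compact K -> exists2 B : R, 0 < B & K `<=` box2 B.
  by move=> /compact_norm_bound[B B0 KB]; exists B => // x /KB; rewrite box2_norm.
exact: (@locally_integrable_forP R _ _ (lam2 R) box2 _ u
  (@compact_box2 R) cK).
Qed.

Lemma locally_integrable3P (u : R * R * R -> R[i]) :
  locally_integrable_for (lam3 R) (@compact (R * R * R)%type) u <->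
  cbox_locally_integrable (lam3 R) box3 u.
Proof.
have cK (K : set (R * R * R)) : compact K -> exists2 B : R, 0 < B & K `<=` box3 B.
  by move=> /compact_norm_bound[B B0 KB]; exists B => // x /KB; rewrite box3_norm.
exact: (@locally_integrable_forP R _ _ (lam3 R) box3 _ u
  (@compact_box3 R) cK).
Qed.

Lemma im_gt0_neq0 (k : R[i]) : 0 < complex.Im k -> k != 0.
Proof. by move=> k0; apply/eqP => ke; move: k0; rewrite ke ltxx. Qed.

End spaces_green.

Theorem mainTheorem3 (R : realType) (Omega Lambda gamma : R)
    (Q kt kp mt mp : R[i])
    (Omega_gt0 : 0 < Omega) (Lambda_gt0 : 0 < Lambda) (gamma_gt0 : 0 < gamma)
    (gamma_neq1 : gamma != 1)
    (QE : Q ^+ 2 = 4 * ('i%C * Omega%:C + (gamma * Omega * Lambda)%:C)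
                   + (1 - 'i%C * (gamma * Omega)%:C - 'i%C * Lambda%:C) ^+ 2)
    (Q_neq0 : Q != 0)
    (ktE : kt ^+ 2 = 'i%C / (2 * Omega%:C)
             * ((1 - 'i%C * (gamma * Omega)%:C - 'i%C * Lambda%:C + Q)
                / (1 - 'i%C * (gamma * Lambda)%:C)))
    (kpE : kp ^+ 2 = 'i%C / (2 * Omega%:C)
             * ((1 - 'i%C * (gamma * Omega)%:C - 'i%C * Lambda%:C - Q)
                / (1 - 'i%C * (gamma * Lambda)%:C)))
    (kt_im : 0 < complex.Im kt) (kp_im : 0 < complex.Im kp)
    (mtE : mt = (gamma / (gamma - 1))%:C * (1 + 'i%C * Omega%:C * kt ^+ 2))
    (mpE : mp = (gamma / (gamma - 1))%:C * (1 + 'i%C * Omega%:C * kp ^+ 2)) :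
  (let H (k : R[i]) (x : R * R) := hankelH0 (k * (radius2 x)%:C) in
   let b1 := (gamma - 1)%:C / (4 * gamma%:C * Omega%:C * Q)
             * ('i%C * mt + (mt - 1) * (gamma * Lambda)%:C) in
   let b2 := - ((gamma - 1)%:C / (4 * gamma%:C * Omega%:C * Q))
             * ('i%C * mp + (mp - 1) * (gamma * Lambda)%:C) in
   is_unique_pair
     (fun T P : R * R -> R[i] =>
        in_span (H kp) (fun x => mp * H kp x) (H kt) (fun x => mt * H kt x) T P
        /\ weak_solution2 Omega Lambda gamma T P)
     (fun x => b1 * H kp x + b2 * H kt x)
     (fun x => b1 * mp * H kp x + b2 * mt * H kt x))
  /\
  (let h (k : R[i]) (x : R * R * R) := sph_hankelh0 (k * (radius3 x)%:C) in
   let c1 := kp * (gamma - 1)%:C / (4 * (pi : R)%:C * gamma%:C * Omega%:C * Q)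
             * ('i%C * mt + (mt - 1) * (gamma * Lambda)%:C) in
   let c2 := - (kt * (gamma - 1)%:C
                / (4 * (pi : R)%:C * gamma%:C * Omega%:C * Q))
             * ('i%C * mp + (mp - 1) * (gamma * Lambda)%:C) in
   is_unique_pair
     (fun T P : R * R * R -> R[i] =>
        in_span (h kp) (fun x => mp * h kp x) (h kt) (fun x => mt * h kt x) T P
        /\ weak_solution3 Omega Lambda gamma T P)
     (fun x => c1 * h kp x + c2 * h kt x)
     (fun x => c1 * mp * h kp x + c2 * mt * h kt x)).
Proof.
have kp0 := im_gt0_neq0 kp_im; have kt0 := im_gt0_neq0 kt_im.
have i0 : ('i%C : R[i]) != 0 by apply: im_gt0_neq0; rewrite ltr01.
have n4 : (4 : R[i]) != 0 by rewrite pnatr_eq0.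
have Om0 : Omega%:C != 0 by rewrite fmorph_eq0 gt_eqF.
have ga0 : gamma%:C != 0 by rewrite fmorph_eq0 gt_eqF.
have pi0 : (pi : R)%:C != 0 by rewrite fmorph_eq0 gt_eqF ?pi_gt0.
have g1 : (gamma - 1)%:C = gamma%:C - 1 by rewrite rmorphB rmorph1.
have gl : (gamma * Lambda)%:C = gamma%:C * Lambda%:C by rewrite rmorphM.
split.
  move=> H b1 b2.
  have l2P := @locally_integrable2P R.
  have mb := @measurable_box2 R.
  apply: (@green_pair_unique R (R * R)%type (basis2 R) Omega Lambda gamma Q kt kp mt mp
    Omega_gt0 gamma_gt0 gamma_neq1 QE Q_neq0 ktE kpE mtE mpE
    (locally_integrable_for (lam2 R) (@compact (R * R)%type)) (regular_distr (lam2 R))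
    (cbox_supported box2) (planar_hankel kp) (planar_hankel kt) (4 * 'i%C) (4 * 'i%C)).
  - by move=> phi tphi; have [sphi slphi _] := planar_hankel_distr kp0 tphi.
  - move=> a b u v /l2P lu /l2P lv; apply/l2P.
    by apply: (cbox_locally_integrableD mb); apply: (cbox_locally_integrableZ mb).
  - move=> a b u v w /l2P lu /l2P lv sw.
    have lZ c f := @cbox_locally_integrableZ _ _ _ (lam2 R) _ mb c f.
    rewrite (regular_distrD mb (lZ a _ lu) (lZ b _ lv) sw).
    by rewrite (regular_distrZ mb a lu sw) (regular_distrZ mb b lv sw).
  (* Agreement off the origin is agreement almost everywhere. *)
  - move=> u v w /l2P lu /l2P lv sw uv; apply: (ae_eq_regular_distr mb lu lv sw).
    apply: ae_lam2W => p p1 _; apply: uv; apply: contraNneq p1 => ->; exact: eqxx.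
  - exact/l2P/cbox_locally_integrable_planar_hankel.
  - exact/l2P/cbox_locally_integrable_planar_hankel.
  - by move=> phi tphi; have [_ _] := planar_hankel_distr kp0 tphi.
  - by move=> phi tphi; have [_ _] := planar_hankel_distr kt0 tphi.
  - exists (fun p => (bump2 p)%:C); first exact: test_function_bump2.
    by rewrite fmorph_eq0 /bump2 mulf_neq0// bump0_neq0.
  (* The strength [4 i] cancels the [4] in the denominator of [b1] and supplies the factor [i] of
     the amplitude. *)
  - rewrite /b1 g1 gl. field.
    by rewrite ga0 Om0 Q_neq0.
  - rewrite /b2 g1 gl; field.
    by rewrite ga0 Om0 Q_neq0.
  - by rewrite mulf_neq0.
  - by rewrite mulf_neq0.
move=> h c1 c2.
have l3P := @locally_integrable3P R.
have mb := @measurable_box3 R.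
apply: (@green_pair_unique R (R * R * R)%type (basis3 R) Omega Lambda gamma Q kt kp mt mp
  Omega_gt0 gamma_gt0 gamma_neq1 QE Q_neq0 ktE kpE mtE mpE
  (locally_integrable_for (lam3 R) (@compact (R * R * R)%type)) (regular_distr (lam3 R))
  (cbox_supported box3) (spatial_hankel kp) (spatial_hankel kt)
  (4 * (pi : R)%:C * 'i%C / kp) (4 * (pi : R)%:C * 'i%C / kt)).
- by move=> phi tphi; have [sphi slphi _] := spatial_hankel_distr kp tphi.
- move=> a b u v /l3P lu /l3P lv; apply/l3P.
  by apply: (cbox_locally_integrableD mb); apply: (cbox_locally_integrableZ mb).
- move=> a b u v w /l3P lu /l3P lv sw.
  have lZ c f := @cbox_locally_integrableZ _ _ _ (lam3 R) _ mb c f.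
  rewrite (regular_distrD mb (lZ a _ lu) (lZ b _ lv) sw).
  by rewrite (regular_distrZ mb a lu sw) (regular_distrZ mb b lv sw).
- move=> u v w /l3P lu /l3P lv sw uv; apply: (ae_eq_regular_distr mb lu lv sw).
  apply: ae_lam3W => p p1 _ _; apply: uv; apply: contraNneq p1 => ->; exact: eqxx.
- exact/l3P/cbox_locally_integrable_spatial_hankel.
- exact/l3P/cbox_locally_integrable_spatial_hankel.
- by move=> phi tphi; have [_ _] := spatial_hankel_distr kp tphi.
- by move=> phi tphi; have [_ _] := spatial_hankel_distr kt tphi.
- exists (fun p => (bump3 p)%:C); first exact: test_function_bump3.
  by rewrite fmorph_eq0; apply: mulf_neq0; [apply: mulf_neq0|]; exact: bump0_neq0.
(* The strength [4 pi i / kp] accounts for the factor [kp / (4 pi)] of [c1]. *)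
- rewrite /c1 g1 gl; move: (pi : R)%:C pi0 => P P0; field.
  by rewrite ga0 Om0 Q_neq0 kp0 P0.
- rewrite /c2 g1 gl; move: (pi : R)%:C pi0 => P P0; field.
  by rewrite ga0 Om0 Q_neq0 kt0 P0.
- by rewrite !mulf_neq0// invr_eq0.
- by rewrite !mulf_neq0// invr_eq0.
Qed.
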